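(* Let $p_\eta$ be a distribution over $S\subseteq\mathbb{R}^d$ belonging to an exponential family $\mathcal{E}(T,h)$ with natural parameter $\eta\in\mathcal{H}\subseteq\mathbb{R}^k$. Let $\eta^{(1)},\eta^{(2)}\in\mathcal{H}$ with $\eta^{(1)}\le\eta^{(2)}$ coordinatewise, $I_j=[\eta^{(1)}_j,\eta^{(2)}_j]$ for $j\in[k]$, $R=\eta^{(2)}-\eta^{(1)}$, $m=\frac{\eta^{(1)}+\eta^{(2)}}{2}$, and assume $\prod_{j\in[k]}I_j\subseteq\mathcal{H}$. Let $\eta\sim\mathcal{U}\left(\prod_{j}I_j\right)$, let $X=(X_1,\dots,X_n)\sim p_\eta^{\otimes n}$, let $X_i'\sim p_\eta$ be an independent sample, and let $X_{\sim i}$ denote $X$ with $X_i$ replaced by $X_i'$. Let $M:S^n\to\prod_{j\in[k]}[-\frac{R_j}{2},\frac{R_j}{2}]$ be an $(\varepsilon,\delta)$-differentially private mechanism with $\varepsilon\in[0,1]$, $\delta\ge0$, such that $\mathbb{E}_{X,M}\left[\|M(X)-(\eta-m)\|_2^2\right]\le\alpha^2\le\frac{\|R\|_2^2}{24}$ for every $\eta\in\prod_j I_j$. Define $s\in\mathbb{R}^k$ by $s_j=\left[\frac{R_j^2}{4}-(\eta_j-m_j)^2\right]\left[M_j(X_{\sim i})-(\eta_j-m_j)\right]$. Then for every $t_0>0$ there is an index $i\in[n]$ such that $$n\left\{2\delta t_0+2\varepsilon\,\mathbb{E}_{\eta}\left[\sqrt{\mathbb{E}_{X_{\sim i},M}\left[s^\top\Sigma_T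 s\right]}\right]+2\,\mathbb{E}_\eta\left[\int_{t_0}^\infty\Pr_{X_i}\left[\|T(X_i)-\mu_T\|_2>\frac{4t}{\|R\|_\infty^3\sqrt{k}}\right]dt\right]\right\}\ge\frac{\|R\|_2^2}{24}.$$
   Context: Exponential family: given $S\subseteq\mathbb{R}^d$, $h:S\to\mathbb{R}_{\ge0}$ and $T:S\to\mathbb{R}^k$, the family $\mathcal{E}(T,h)$ consists of the densities (or probability mass functions) $p_\eta(x)=h(x)\exp(\eta^\top T(x)-Z(\eta))$, $x\in S$, where $Z(\eta)=\ln\int_S h(x)\exp(\eta^\top T(x))\,dx$ and $\eta$ ranges over the natural parameter range $\mathcal{H}=\{\eta: Z(\eta)<\infty\}$. For a given $\eta$, $\mu_T=\mathbb{E}_{X\sim p_\eta}[T(X)]$ and $\Sigma_T=\mathbb{E}_{X\sim p_\eta}[(T(X)-\mu_T)(T(X)-\mu_T)^\top]$ (both depend on $\eta$). $\mathcal{U}(A)$ is the uniform distribution on $A$. A randomized algorithm $M:\mathcal{X}^n\to\mathcal{Y}$ is $(\varepsilon,\delta)$-differentially private if for every pair of datasets differing in exactly one entry and every measurable $Y$, $\Pr[M(X)\in Y]\le e^{\varepsilon}\Pr[M(X')\in Y]+\delta$. *)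

(* Defs.v *)
From HB Require Import structures.
From mathcomp Require Import all_boot all_order all_algebra.
From mathcomp Require Import all_classical all_reals all_analysis.

Set Implicit Arguments.
Unset Strict Implicit.
Unset Printing Implicit Defensive.

Import Order.TTheory GRing.Theory Num.Theory.
Import numFieldNormedType.Exports.

Local Open Scope classical_set_scope.
Local Open Scope ring_scope.

(* R^d is d.-tuple (measurableTypeR R), whose sigma-algebra is generated by the
   coordinate maps, i.e. the Borel sets; vectors that enter matrix expressions
   are converted by [vec]. *)
Notation euclid R d := (d.-tuple (measurableTypeR R)).

Section tuple_measures.
Context (R : realType).

Definition tuple_cons (d : measure_display) (T : measurableType d) (n : nat)
    (p : T * n.-tuple T) : n.+1.-tuple T := cons_tuple p.1 p.2.

Lemma measurable_tuple_cons (d : measure_display) (T : measurableType d) n :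
  measurable_fun [set: T * n.-tuple T] (@tuple_cons d T n).
Proof. exact: (measurable_cons measurable_fst measurable_snd). Qed.

HB.instance Definition _ (d : measure_display) (T : measurableType d) n :=
  isMeasurableFun.Build _ _ _ _ (@tuple_cons d T n)
    (@measurable_tuple_cons d T n).

Fixpoint product_prob (d : measure_display) (T : measurableType d) (n : nat) :
    ('I_n -> probability T R) -> probability (n.-tuple T) R :=
  match n with
  | 0 => fun=> \d_([tuple] : 0.-tuple T)
  | n'.+1 => fun P =>
      distribution (P ord0 \x product_prob (fun i => P (lift ord0 i)))%E
        (@tuple_cons d T n')
  end.

Definition iid (d : measure_display) (T : measurableType d) (n : nat)
    (P : probability T R) : probability (n.-tuple T) R :=
  product_prob (fun _ : 'I_n => P).

Definition cons_measure (d : measure_display) (T : measurableType d) (n : nat)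
    (m : {measure set (T * n.-tuple T) -> \bar R}) :=
  pushforward m (@tuple_cons d T n).

HB.instance Definition _ (d : measure_display) (T : measurableType d) n
    (m : {measure set (T * n.-tuple T) -> \bar R}) :=
  Measure.copy (cons_measure m)
    (measure_function_pushforward__canonical__measure_function_Measure
       m (@measurable_tuple_cons d T n)).

(* The variant [\x^] of the binary product only asks its first factor to be
   sigma-finite. *)
Fixpoint lebesgue_space (d : nat) : {measure set (euclid R d) -> \bar R} :=
  match d with
  | 0 => \d_([tuple] : euclid R 0)
  | d'.+1 => cons_measure (@lebesgue_measure R \x^ lebesgue_space d')%E
  end.

(* The degenerate interval [a, a] carries the point mass at a. *)
Definition uniform_itv (a b : R) : probability (measurableTypeR R) R :=
  match pselect (a < b) with
  | left ab => uniform_prob ab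
  | right _ => \d_(a : measurableTypeR R)
  end.

Definition box (k : nat) (a b : euclid R k) : set (euclid R k) :=
  [set y | forall j, tnth a j <= tnth y j <= tnth b j].

(* The uniform distribution on a box is the product of the uniform
   distributions on its sides. *)
Definition uniform_box (k : nat) (a b : euclid R k) : probability (euclid R k) R :=
  product_prob (fun j => uniform_itv (tnth a j) (tnth b j)).

End tuple_measures.

Section vectors.
Context (R : realType) (k : nat).

Definition vec (x : euclid R k) : 'cV[R]_k := \col_j tnth x j.

Definition dot (u v : 'cV[R]_k) : R := (u^T *m v) ord0 ord0.

Definition norm2 (v : 'cV[R]_k) : R := Num.sqrt (\sum_j v j ord0 ^+ 2).

Definition normoo (v : 'cV[R]_k) : R := \big[Num.max/0]_j `|v j ord0|.

End vectors.

Variant family_kind := Continuous | Discrete.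

Section exponential_family.
Context (R : realType) (d k : nat).

(* Densities are taken with respect to Lebesgue measure and probability mass
   functions with respect to counting measure. *)
Definition base_measure (K : family_kind) : {measure set (euclid R d) -> \bar R} :=
  match K with
  | Continuous => lebesgue_space R d
  | Discrete => @counting (euclid R d) R
  end.

Variables (K : family_kind) (S : set (euclid R d)) (h : euclid R d -> R)
  (T : euclid R d -> euclid R k).

Definition log_partition (eta : euclid R k) : \bar R :=
  lne (\int[base_measure K]_(x in S)
    (h x * expR (dot (vec eta) (vec (T x))))%:E).

Definition natural_range : set (euclid R k) :=
  [set eta | (log_partition eta < +oo)%E].

Definition expfam_density (eta : euclid R k) (x : euclid R d) : R :=
  h x * expR (dot (vec eta) (vec (T x)) - fine (log_partition eta)).

(* [p eta] is the law p_eta of E(T, h).  It exists for every eta in the natural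
   range unless h vanishes almost everywhere on S, in which case the family is
   empty. *)
Definition is_expfam (p : euclid R k -> probability (euclid R d) R) :=
  forall eta, natural_range eta -> forall A, measurable A ->
    p eta A = (\int[base_measure K]_(x in S `&` A) (expfam_density eta x)%:E)%E.

Definition mean_stat (P : probability (euclid R d) R) : 'cV[R]_k :=
  \col_j \int[P]_(x in S) tnth (T x) j.

Definition cov_stat (P : probability (euclid R d) R) : 'M[R]_k :=
  \matrix_(i, j) \int[P]_(x in S)
    ((vec (T x) - mean_stat P) *m (vec (T x) - mean_stat P)^T) i j.

End exponential_family.

Section differential_privacy.
Context (R : realType) (d d' : measure_display).
Context (X : measurableType d) (Y : measurableType d') (n : nat).

Definition datasets (S : set X) : set (n.-tuple X) :=
  [set x | forall i, S (tnth x i)].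

Definition neighbours (x x' : n.-tuple X) :=
  exists i, tnth x i <> tnth x' i /\
    forall j, j != i -> tnth x j = tnth x' j.

(* A randomized algorithm on S^n is a probability kernel on the ambient space,
   of which only the restriction to S^n is constrained or used. *)
Definition dp (eps delta : R) (S : set X) (M : R.-pker (n.-tuple X) ~> Y) :=
  forall x x', datasets S x -> datasets S x' -> neighbours x x' ->
    forall A, measurable A ->
      (M x A <= (expR eps)%:E * M x' A + delta%:E)%E.

Definition replace (x : n.-tuple X) (i : 'I_n) (x' : X) : n.-tuple X :=
  [tuple if j == i then x' else tnth x j | j < n].

End differential_privacy.

Section fingerprint.
Context (R : realType) (d k n : nat) (eta1 eta2 : euclid R k).

Definition range_vec : 'cV[R]_k := vec eta2 - vec eta1.

Definition midpoint : 'cV[R]_k := 2^-1 *: (vec eta1 + vec eta2).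

Definition centered_box : set (euclid R k) :=
  [set y | forall j, - (range_vec j ord0 / 2) <= tnth y j <= range_vec j ord0 / 2].

(* s, for the parameter eta and the output y of the mechanism. *)
Definition svec (eta y : euclid R k) : 'cV[R]_k :=
  \col_j ((range_vec j ord0 ^+ 2 / 4 - (tnth eta j - midpoint j ord0) ^+ 2) *
          (tnth y j - (tnth eta j - midpoint j ord0))).

Variables (S : set (euclid R d)) (T : euclid R d -> euclid R k)
  (p : euclid R k -> probability (euclid R d) R)
  (M : R.-pker (n.-tuple (euclid R d)) ~> (euclid R k)).

Definition mean_sq_error (eta : euclid R k) : \bar R :=
  (\int[iid n (p eta)]_x \int[M x]_y
     (norm2 (vec y - (vec eta - midpoint)) ^+ 2)%:E)%E.

(* E_{X_{~i}, M}[s^T Sigma_T s], where X_{~i} is built from X ~ p_eta^n and an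
   independent X_i' ~ p_eta. *)
Definition quad_form_mean (i : 'I_n) (eta : euclid R k) : \bar R :=
  (\int[(iid n (p eta) \x p eta)]_xx' \int[M (replace xx'.1 i xx'.2)]_y
     (((svec eta y)^T *m cov_stat S T (p eta) *m svec eta y) ord0 ord0)%:E)%E.

Definition tail_prob (i : 'I_n) (eta : euclid R k) (t : R) : \bar R :=
  iid n (p eta) [set x | datasets S x /\
    norm2 (vec (T (tnth x i)) - mean_stat S T (p eta)) >
      4 * t / (normoo range_vec ^+ 3 * Num.sqrt k%:R)].

End fingerprint.

(* Main.v *)
(* On the box, p_eta is p_m reweighted by exp(<eta - m, T>) up to a constant, so
   the derivative of E_eta[M_j] in eta_j is the covariance of M_j with
   sum_i T_j(X_i).  Weighting it by R_j^2/4 - (eta_j - m_j)^2, which vanishes at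
   the ends of I_j, and integrating by parts over eta_j turns it into
   E[2 (eta_j - m_j) M_j]; by accuracy these add up to at least
   |R|^2/12 - alpha^2 >= |R|^2/24.  Conversely the weighted covariance is the
   sum over i of E<s(M(X)), T(X_i) - mu>.  Privacy allows M(X) to be replaced by
   M(X_{~i}), which is independent of X_i, so that the main term vanishes; the
   cost is 2 eps times the first absolute moment, at most
   sqrt(E[s^T Sigma s]) by AM-GM, plus 2 delta t0 and a tail above t0.

   Integrability of T and T^2 and differentiability in eta hold only inside the
   box, so everything is done on a box shrunk by a factor 1 - tau, and
   tau tends to 0 at the end. *)

From HB Require Import structures.
Require Import Defs.
From mathcomp Require Import all_boot all_order all_algebra.
From mathcomp Require Import all_classical all_reals all_analysis.
From mathcomp Require Import measurable_realfun ring lra.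

Set Implicit Arguments.
Unset Strict Implicit.
Unset Printing Implicit Defensive.

Import Order.TTheory GRing.Theory Num.Theory.
Import numFieldNormedType.Exports.

Local Open Scope classical_set_scope.
Local Open Scope ring_scope.

(** * Densities and product measures *)

(** The notion that carries the argument is [tilted]: laws obtained from one probability by
    exponential weights over a box. It is stable under taking n independent samples, with the
    statistic summed over the sample, so the same lemmas give the integrability of T for one sample
    and the integration by parts for n. Accuracy enters through (y - c)^2 >= c^2 - 2 c y with c =
    eta_j - m_j, and R_j^2/12 is the variance of a uniform variable. The tail threshold comes from
    |s_j| <= |R|_oo^3/4: Cauchy-Schwarz over k coordinates gives |<s, T - mu>| <= |R|_oo^3 sqrt(k)/4
    times |T - mu|. Three obstacles shape the details. An interval I_j may be a point, and then T_j
    need not be integrable; s_j vanishes there, and the coordinate is dropped from the weights. The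
    mechanism is confined to its box only on datasets from S, so its outputs are clipped. Nothing is
    known about the measurability of p_eta in eta, so expectations are rewritten through the law at
    the midpoint before they are averaged, and the two integrands of the conclusion are only bounded
    below by measurable ones. *)

Section integration.
Local Open Scope ereal_scope.
Context (R : realType) (d : measure_display) (T : measurableType d).
Implicit Types (mu : {measure set T -> \bar R}).
Import HBNNSimple.

(** A nonnegative integral is a supremum over the simple functions below the integrand, so
    measurability plays no part in monotonicity. This is what allows comparison with the integrands
    over [eta] and over the tail level in the theorem. *)
Lemma ge0_le_integral_nomeas mu (D : set T) (f g : T -> \bar R) :
  (forall x, D x -> 0 <= f x) -> (forall x, D x -> f x <= g x) ->
  \int[mu]_(x in D) f x <= \int[mu]_(x in D) g x.
Proof.
move=> f0 fg.
have g0 x : D x -> 0 <= g x by move=> Dx; exact: le_trans (f0 _ Dx) (fg _ Dx).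
rewrite !ge0_integralE//; apply: ub_ereal_sup => _ [/= h hf <-].
apply: ereal_sup_ubound => /=; exists h => // x.
apply: le_trans (hf x) _; rewrite !patchE; case: ifPn => // /set_mem.
exact: fg.
Qed.

(** Simple functions first, then monotone limits. The base measure [mu] is arbitrary because
    counting measure on a Euclidean space is in general not sigma-finite, which rules out a
    Radon-Nikodym argument. *)
Lemma ge0_integral_density mu (P : {measure set T -> \bar R})
    (rho : T -> R) (f : T -> \bar R) :
  measurable_fun setT rho -> (forall x, 0 <= rho x)%R ->
  (forall A, measurable A -> P A = \int[mu]_(x in A) (rho x)%:E) ->
  measurable_fun setT f -> (forall x, 0 <= f x) ->
  \int[P]_x f x = \int[mu]_x (f x * (rho x)%:E).
Proof.
move=> /measurable_EFinP mrho rho0 PE mf f0.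
have nns (h : {nnsfun T >-> R}) :
    \int[P]_x (h x)%:E = \int[mu]_x ((h x)%:E * (rho x)%:E).
  under [LHS]eq_integral do rewrite fimfunE -fsumEFin//.
  rewrite [LHS]ge0_integral_fsum//; last 2 first.
  - by move=> r; exact/measurable_EFinP/measurableT_comp.
  - by move=> n x _; rewrite EFinM nnfun_muleindic_ge0.
  under [RHS]eq_integral.
    move=> x xD; rewrite fimfunE -fsumEFin// muleC ge0_mule_fsumr; last first.
      by move=> r; rewrite EFinM nnfun_muleindic_ge0.
    over.
  rewrite [RHS]ge0_integral_fsum//; last 2 first.
  - move=> r; apply: emeasurable_funM => //.
    by apply/measurable_EFinP; apply/measurableT_comp => //.
  - move=> r x _; apply: mule_ge0; first by rewrite lee_fin.
    by rewrite EFinM nnfun_muleindic_ge0.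
  apply: eq_fsbigr => r _.
  rewrite integralZl_indic_nnsfun//.
  (* A negative value is not attained by [h], so both sides are 0. *)
  have [r0|r0] := ltP r 0%R.
    have e : h @^-1` [set r] = set0.
      by apply: preimage_nnfun0.
    by rewrite e integral0_eq ?mule0 ?integral0_eq// => x _;
      rewrite indicE in_set0 ?mulr0 ?mule0.
  rewrite integral_indic// setIT PE//.
  under [RHS]eq_integral do rewrite EFinM muleCA.
  rewrite ge0_integralZl//; last 2 first.
  - apply: emeasurable_funM => //; exact/measurable_EFinP.
  - by move=> x _; rewrite mule_ge0// lee_fin.
  congr (_ * _); rewrite integral_mkcond; apply: eq_integral => x _.
  by rewrite patchE indicE; case: ifPn => _; rewrite ?mule1 ?mule0.
pose f_ := nnsfun_approx measurableT mf.
transitivity (lim (\int[P]_x (f_ n x)%:E @[n --> \oo])).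
  rewrite -monotone_convergence//=.
  - apply: eq_integral => ? /[!inE] xD; apply/esym/cvg_lim => //=.
    exact: cvg_nnsfun_approx.
  - by move=> n; exact/measurable_EFinP/measurable_funTS.
  - by move=> n ? _; rewrite lee_fin.
  - by move=> ? _ ? ? mn; rewrite lee_fin; exact/lefP/nd_nnsfun_approx.
under eq_fun do rewrite nns.
rewrite -monotone_convergence//=.
- apply: eq_integral => x /[!inE] xD; apply/cvg_lim => //=.
  apply: cvgeZr => //; exact: cvg_nnsfun_approx.
- move=> n; apply: emeasurable_funM => //.
  exact/measurable_EFinP/measurable_funTS.
- by move=> n ? _; rewrite mule_ge0// lee_fin.
- move=> ? _ ? ? mn; apply: lee_wpmul2r; first by rewrite lee_fin.
  by rewrite lee_fin; exact/lefP/nd_nnsfun_approx.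
Qed.

End integration.

Section tuples.
Local Open Scope ereal_scope.
Context (R : realType) (d : measure_display) (T : measurableType d).

Lemma measurable_replace n (i : 'I_n) :
  measurable_fun setT (fun z : n.-tuple T * T => replace z.1 i z.2).
Proof.
apply/measurable_fun_tnthP => j.
rewrite [X in measurable_fun _ X](_ : _ =
   (fun z : n.-tuple T * T => if j == i then z.2 else tnth z.1 j)); last first.
  by apply/funext => z /=; rewrite tnth_mktuple.
case: (j == i); first exact: measurable_snd.
by apply: (measurableT_comp (measurable_tnth j)); exact: measurable_fst.
Qed.

Lemma replace_cons0 n (x : T) (xs : n.-tuple T) y :
  replace (cons_tuple x xs) ord0 y = cons_tuple y xs.
Proof.
apply: eq_from_tnth => j; rewrite tnth_mktuple.
by case: (unliftP ord0 j) => [l ->|->]//=; rewrite !tnthS.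
Qed.

Lemma replace_consS n (x : T) (xs : n.-tuple T) i y :
  replace (cons_tuple x xs) (lift ord0 i) y = cons_tuple x (replace xs i y).
Proof.
apply: eq_from_tnth => j; rewrite tnth_mktuple.
case: (unliftP ord0 j) => [l ->|->]//=.
by rewrite !tnthS tnth_mktuple (inj_eq lift_inj).
Qed.

Lemma ge0_integral_product_prob_cons n (P : 'I_n.+1 -> probability T R)
    (f : n.+1.-tuple T -> \bar R) :
  measurable_fun setT f -> (forall x, 0 <= f x) ->
  \int[product_prob P]_x f x =
  \int[P ord0]_x \int[product_prob (fun i => P (lift ord0 i))]_xs
     f (cons_tuple x xs).
Proof.
move=> mf f0 /=; rewrite ge0_integral_distribution//.
rewrite fubini_tonelli1//.
- by apply: measurableT_comp => //; exact: measurable_tuple_cons.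
- by move=> x; exact: f0.
Qed.

(** Exchangeability: [tnth x i] and the fresh [y] have the same law and are independent, so trading
    them preserves the joint law. If [i] is the head this is Tonelli applied three times; otherwise
    the head is frozen and the induction hypothesis acts on the rest. Functions of one component
    only yield the marginal law of an entry and the invariance under resampling. *)
Lemma ge0_integral_swap n (P : 'I_n -> probability T R) (i : 'I_n)
    (F : n.-tuple T * T -> \bar R) :
  measurable_fun setT F -> (forall z, 0 <= F z) ->
  \int[product_prob P]_x \int[P i]_y F (replace x i y, tnth x i) =
  \int[product_prob P]_x \int[P i]_y F (x, y).
Proof.
elim: n P i F => [P []//|n IH P i F mF F0].
have mR : measurable_fun setT
    (fun z : n.+1.-tuple T * T => F (replace z.1 i z.2, tnth z.1 i)).
  apply: measurableT_comp => //; apply: measurable_fun_pair.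
    exact: measurable_replace.
  by apply: (measurableT_comp (measurable_tnth i)); exact: measurable_fst.
rewrite ge0_integral_product_prob_cons; last 2 first.
- exact: (measurable_fun_fubini_tonelli_F (m2 := P i) _ mR).
- by move=> x; exact: integral_ge0.
rewrite [RHS]ge0_integral_product_prob_cons; last 2 first.
- exact: (measurable_fun_fubini_tonelli_F (m2 := P i) _ mF).
- by move=> x; exact: integral_ge0.
have mcons : measurable_fun setT (fun z : T * n.-tuple T => cons_tuple z.1 z.2).
  exact: measurable_tuple_cons.
case: (unliftP ord0 i) => [j|] ij; subst i; last first.
  under eq_integral do under eq_integral do under eq_integral do
    rewrite replace_cons0 tnth0.
  have m3 : measurable_fun setT (fun z : (T * T) * n.-tuple T =>
      F (cons_tuple z.1.2 z.2, z.1.1)).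
    apply: measurableT_comp => //; apply: measurable_fun_pair.
      apply: (measurableT_comp mcons (g := fun z : (T * T) * n.-tuple T =>
        (z.1.2, z.2))); apply: measurable_fun_pair => //.
      exact: measurableT_comp measurable_snd measurable_fst.
    exact: measurableT_comp measurable_fst measurable_fst.
  transitivity (\int[P ord0]_x \int[P ord0]_y
      \int[product_prob (fun i => P (lift ord0 i))]_xs F (cons_tuple y xs, x)).
    apply: eq_integral => x _.
    rewrite (fubini_tonelli (fun z : n.-tuple T * T =>
      F (cons_tuple z.2 z.1, x)))//.
    apply: (measurableT_comp m3 (g := fun z : n.-tuple T * T => ((x, z.2), z.1))).
    by apply: measurable_fun_pair => //; apply: measurable_fun_pair.
  rewrite (fubini_tonelli (fun z : T * T =>
    \int[product_prob (fun i => P (lift ord0 i))]_xs F (cons_tuple z.2 xs, z.1)));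
    last 2 first.
  - exact: (measurable_fun_fubini_tonelli_F
      (m2 := product_prob (fun i => P (lift ord0 i))) _ m3).
  - by move=> z; exact: integral_ge0.
  apply: eq_integral => y _.
  rewrite (fubini_tonelli (fun z : T * n.-tuple T =>
    F (cons_tuple y z.2, z.1)))//.
  apply: (measurableT_comp m3 (g := fun z : T * n.-tuple T => ((z.1, y), z.2))).
  by apply: measurable_fun_pair => //; apply: measurable_fun_pair.
apply: eq_integral => x _.
under eq_integral do under eq_integral do rewrite replace_consS tnthS.
apply: (IH (fun i => P (lift ord0 i)) j (fun z => F (cons_tuple x z.1, z.2))).
- apply: measurableT_comp => //; apply: measurable_fun_pair => //.
  apply: (measurableT_comp mcons (g := fun z : n.-tuple T * T => (x, z.1))).
  by apply: measurable_fun_pair.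
- by move=> z; exact: F0.
Qed.

End tuples.

Lemma integral_prob_cst (R : realType) (d : measure_display)
    (T : measurableType d) (P : probability T R) (c : \bar R) :
  (\int[P]_x c = c)%E.
Proof. by rewrite integral_cst// [X in (_ * X)%E]probability_setT mule1. Qed.

Section transfer.
Local Open Scope ereal_scope.
Context (R : realType) (d d' : measure_display) (T : measurableType d)
  (T' : measurableType d').
Variables (P : {measure set T -> \bar R}) (Q : {measure set T' -> \bar R})
  (phi : T' -> T) (q : T' -> R).
Hypotheses (mphi : measurable_fun setT phi) (mq : measurable_fun setT q)
  (q0 : forall x, (0 <= q x)%R).
Hypothesis PQ : forall f : T -> \bar R, measurable_fun setT f ->
  (forall x, 0 <= f x) -> \int[P]_x f x = \int[Q]_x (f (phi x) * (q x)%:E).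

(** Since [q] is nonnegative, multiplication by it commutes with taking positive and negative parts.
    With [phi] the identity this is a change of density, with [q] constant 1 a change of
    variables. *)
Lemma transfer_integral (f : T -> \bar R) : measurable_fun setT f ->
  \int[P]_x f x = \int[Q]_x (f (phi x) * (q x)%:E).
Proof.
move=> mf; rewrite integralE [RHS]integralE; congr (_ - _).
- rewrite PQ//; last exact: measurable_funepos.
  apply: eq_integral => x _; rewrite !funeposE.
  by rewrite maxe_pMl ?lee_fin// mul0e.
- rewrite PQ//; last exact: measurable_funeneg.
  apply: eq_integral => x _; rewrite !funenegE.
  by rewrite maxe_pMl ?lee_fin// mul0e mulNe.
Qed.

Lemma transfer_integrable (f : T -> R) : measurable_fun setT f ->
  P.-integrable setT (EFin \o f) <->
  Q.-integrable setT (EFin \o (fun x => f (phi x) * q x)%R).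
Proof.
move=> mf.
have E : \int[P]_x `|(f x)%:E| = \int[Q]_x `|(f (phi x) * q x)%:E|.
  rewrite PQ//; last by apply: measurableT_comp => //; exact/measurable_EFinP.
  by apply: eq_integral => x _; rewrite EFinM abseM [X in _ = _ * X]gee0_abs ?lee_fin.
split=> /integrableP[mg i]; apply/integrableP; split.
- apply/measurable_EFinP; apply: measurable_funM => //.
  exact: measurableT_comp.
- by rewrite -E.
- exact/measurable_EFinP.
- by rewrite E.
Qed.

Lemma transfer_Rintegral (f : T -> R) : measurable_fun setT f ->
  (\int[P]_x f x = \int[Q]_x (f (phi x) * q x))%R.
Proof.
by move=> mf; rewrite /Rintegral transfer_integral//; exact/measurable_EFinP.
Qed.

End transfer.

Section iid.
Local Open Scope ereal_scope.
Context (R : realType) (d : measure_display) (T : measurableType d).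

Lemma ge0_integral_tnth n (P : 'I_n -> probability T R) (i : 'I_n)
    (f : T -> \bar R) :
  measurable_fun setT f -> (forall x, 0 <= f x) ->
  \int[P i]_x f x = \int[product_prob P]_x f (tnth x i).
Proof.
move=> mf f0; have := @ge0_integral_swap _ _ _ _ P i (fun z => f z.2).
rewrite /= => /(_ (measurableT_comp mf measurable_snd) (fun=> f0 _)) H.
transitivity (\int[product_prob P]_x \int[P i]_y f y).
  by rewrite integral_prob_cst.
rewrite -H; apply: eq_integral => x _.
by rewrite integral_prob_cst.
Qed.

Lemma ge0_integral_resample n (P : 'I_n -> probability T R) (i : 'I_n)
    (f : n.-tuple T -> \bar R) :
  measurable_fun setT f -> (forall x, 0 <= f x) ->
  \int[product_prob P]_x f x =
  \int[product_prob P]_x \int[P i]_y f (replace x i y).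
Proof.
move=> mf f0; have := @ge0_integral_swap _ _ _ _ P i (fun z => f z.1).
rewrite /= => /(_ (measurableT_comp mf measurable_fst) (fun=> f0 _)) ->.
apply: eq_integral => x _.
by rewrite integral_prob_cst.
Qed.

Lemma measurable_prod_tnth n (q : T -> R) : measurable_fun setT q ->
  measurable_fun setT (fun x : n.-tuple T => \prod_(i < n) q (tnth x i))%R.
Proof.
move=> mq; apply: measurable_prod => i _.
by apply: measurableT_comp => //; exact: measurable_tnth.
Qed.

(** Induction on the sample size: one factor of the density is pulled out with each entry that is
    integrated. *)
Lemma ge0_integral_iid_density n (P Q : probability T R) (q : T -> R) :
  measurable_fun setT q -> (forall x, 0 <= q x)%R ->
  (forall f : T -> \bar R, measurable_fun setT f -> (forall x, 0 <= f x) ->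
     \int[P]_x f x = \int[Q]_x (f x * (q x)%:E)) ->
  forall f : n.-tuple T -> \bar R, measurable_fun setT f ->
  (forall x, 0 <= f x) -> \int[iid n P]_x f x =
  \int[iid n Q]_x (f x * (\prod_(i < n) q (tnth x i))%:E).
Proof.
move=> mq q0 PQ; elim: n => [|n IH] f mf f0.
  by apply: eq_integral => x _; rewrite big_ord0 mule1.
have mprod := measurable_prod_tnth (n := n) mq.
have prod0 m (x : m.-tuple T) : (0 <= \prod_(i < m) q (tnth x i))%R.
  by apply: prodr_ge0.
have mcons : measurable_fun setT (fun z : T * n.-tuple T => cons_tuple z.1 z.2).
  exact: measurable_tuple_cons.
have mfc x : measurable_fun setT (fun xs : n.-tuple T => f (cons_tuple x xs)).
  apply: measurableT_comp => //.
  apply: (measurableT_comp mcons (g := fun z : n.-tuple T => (x, z))).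
  by apply: measurable_fun_pair.
rewrite ge0_integral_product_prob_cons// PQ; last 2 first.
- apply: (measurable_fun_fubini_tonelli_F (m2 := iid n P)
    (fun z : T * n.-tuple T => f (cons_tuple z.1 z.2))) => //.
  exact: (measurableT_comp mf mcons).
- by move=> x; apply: integral_ge0.
rewrite ge0_integral_product_prob_cons; last 2 first.
- apply: emeasurable_funM => //; apply/measurable_EFinP.
  exact: (measurable_prod_tnth mq).
- by move=> x; rewrite mule_ge0// lee_fin.
apply: eq_integral => x _; rewrite [X in X * _](IH _ (mfc x))//.
rewrite -ge0_integralZr ?lee_fin//.
- apply: eq_integral => xs _; rewrite big_ord_recl tnth0 -muleA -EFinM mulrC.
  by congr (_ * (_ * _)%:E); apply: eq_bigr => i _; rewrite tnthS.
- by apply: emeasurable_funM => //; exact/measurable_EFinP.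
- by move=> xs _; rewrite mule_ge0// lee_fin.
Qed.

End iid.

(** * Exponential tilting along one coordinate *)

Section exponential_bounds.
Context (R : realType).
Implicit Types (r a v t : R).

Lemma expR_norm_le v t : expR (v * t) <= expR (`|v| * `|t|).
Proof. by rewrite ler_expR (le_trans (ler_norm _))// normrM. Qed.

Lemma expR_norm_cosh r t : 0 <= r ->
  expR (r * `|t|) <= expR (r * t) + expR (- r * t).
Proof.
move=> r0; have [t0|t0] := leP 0 t.
  by rewrite ger0_norm// lerDl expR_ge0.
by rewrite ltr0_norm// mulNr -mulrN lerDr expR_ge0.
Qed.

Lemma expR_le_cosh r v t : `|v| <= r ->
  expR (v * t) <= expR (r * t) + expR (- r * t).
Proof.
move=> vr; apply: le_trans (expR_norm_cosh _ _); last exact: le_trans vr.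
apply: le_trans (expR_norm_le _ _) _.
by rewrite ler_expR ler_wpM2r.
Qed.

(** The gap r - a pays for the factor |t|, by (r - a) |t| <= exp((r - a) |t|). The bound blows up as
    a tends to r, which is why the statistic is controlled only strictly inside the box. *)
Lemma norm_expR_le_cosh r a v t : `|v| <= a -> a < r ->
  `|t| * expR (v * t) <= (expR (r * t) + expR (- r * t)) / (r - a).
Proof.
move=> va ar; have ra : 0 < r - a by rewrite subr_gt0.
rewrite ler_pdivlMr// mulrC.
have r0 : 0 <= r by rewrite (le_trans _ (ltW ar))// (le_trans _ va).
apply: le_trans (expR_norm_cosh _ r0).
apply: (@le_trans _ _ (expR ((r - a) * `|t|) * expR (a * `|t|))); last first.
  by rewrite -expRD -mulrDl subrK.
rewrite mulrA; apply: ler_pM.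
- by rewrite mulr_ge0// ltW.
- exact: expR_ge0.
- by apply: le_trans (expR_ge1Dx _); rewrite lerDr.
- apply: le_trans (expR_norm_le _ _) _; rewrite ler_expR.
  by rewrite ler_wpM2r.
Qed.

(** Each of the two factors t is paid by half of the gap, whence the constant 4. *)
Lemma sqr_expR_le_cosh r a v t : `|v| <= a -> a < r ->
  t ^+ 2 * expR (v * t) <= (expR (r * t) + expR (- r * t)) * (4 / (r - a) ^+ 2).
Proof.
move=> va ar; have ra : 0 < r - a by rewrite subr_gt0.
have r0 : 0 <= r by rewrite (le_trans _ (ltW ar))// (le_trans _ va).
rewrite mulrA ler_pdivlMr ?exprn_gt0//.
apply: (@le_trans _ _ (expR (r * `|t|) * 4)); last first.
  by rewrite ler_wpM2r// expR_norm_cosh.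
set s := (r - a) / 2 * `|t|.
have s0 : 0 <= s by rewrite /s mulr_ge0// divr_ge0// ltW.
have ss : s ^+ 2 <= expR ((r - a) * `|t|).
  rewrite (_ : (r - a) * `|t| = s + s); last by rewrite /s; field.
  have ses : s <= expR s by apply: le_trans (expR_ge1Dx _); rewrite lerDr.
  by rewrite expRD expr2 ler_pM.
have -> : t ^+ 2 * expR (v * t) * (r - a) ^+ 2 = s ^+ 2 * expR (v * t) * 4.
  by rewrite /s exprMn real_normK ?num_real//; field.
rewrite ler_wpM2r//.
apply: (@le_trans _ _ (expR ((r - a) * `|t|) * expR (a * `|t|))); last first.
  by rewrite -expRD -mulrDl subrK.
apply: ler_pM => //; rewrite ?sqr_ge0 ?expR_ge0//.
apply: le_trans (expR_norm_le _ _) _; rewrite ler_expR.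
by rewrite ler_wpM2r.
Qed.

End exponential_bounds.

Lemma le_integrableR (R : realType) (d : measure_display) (X : measurableType d)
    (mu : {measure set X -> \bar R}) (f g : X -> R) :
  measurable_fun setT f -> (forall x, `|f x| <= g x) ->
  mu.-integrable setT (EFin \o g) -> mu.-integrable setT (EFin \o f).
Proof.
move=> mf fg; apply: le_integrable => //; first exact/measurable_EFinP.
move=> x _ /=; rewrite lee_fin (le_trans (fg x))//.
exact: ler_norm.
Qed.

Section tilt.
Context (R : realType) (d : measure_display) (X : measurableType d)
  (nu : {measure set X -> \bar R}).
Variables (t : X -> R) (m r : R).
Hypothesis mt : measurable_fun setT t.

Let cosh x := expR (r * t x) + expR (- r * t x).

Lemma measurable_tilt v : measurable_fun setT (fun x => expR ((v - m) * t x)).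
Proof.
apply: (measurableT_comp (@measurable_expR R)).
exact: measurable_funM.
Qed.

Section one_function.
Variable f : X -> R.
Hypotheses (mf : measurable_fun setT f)
  (intf : nu.-integrable setT (EFin \o (fun x => `|f x| * cosh x))).

Lemma integrable_tilt v : `|v - m| <= r ->
  nu.-integrable setT (EFin \o (fun x => f x * expR ((v - m) * t x))).
Proof.
move=> vr; apply: le_integrableR intf.
  by apply: measurable_funM => //; exact: measurable_tilt.
move=> x; rewrite normrM ler_wpM2l// ger0_norm ?expR_ge0//.
exact: expR_le_cosh.
Qed.

Let dom a x := `|f x| * cosh x / (r - a).

Let int_dom a : nu.-integrable setT (EFin \o dom a).
Proof.
apply: (eq_integrable measurableT) (integrableZl measurableT ((r - a)^-1) intf).
by move=> x _ /=; rewrite -EFinM mulrC.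
Qed.

Let le_dom a v x : `|v - m| <= a -> a < r ->
  `|f x * t x * expR ((v - m) * t x)| <= dom a x.
Proof.
move=> va ar; rewrite -mulrA normrM /dom -mulrA ler_wpM2l//.
rewrite normrM (ger0_norm (expR_ge0 _)).
exact: norm_expR_le_cosh.
Qed.

Lemma integrable_tilt1 v : `|v - m| < r ->
  nu.-integrable setT (EFin \o (fun x => f x * t x * expR ((v - m) * t x))).
Proof.
move=> vr; apply: le_integrableR (int_dom `|v - m|).
  apply: measurable_funM; first exact: measurable_funM.
  exact: measurable_tilt.
by move=> x; exact: le_dom.
Qed.

(** Finiteness of the two exponential moments at the ends m - r and m + r dominates the derivative
    of the integrand on every smaller interval. *)
Lemma is_derive_tilt (v : R) : `|v - m| < r ->
  is_derive v (1 : R) (fun w : R => \int[nu]_x (f x * expR ((w - m) * t x)))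
    (\int[nu]_x (f x * t x * expR ((v - m) * t x))).
Proof.
(* Any radius strictly between |v - m| and r would do: the interval of radius [a] is a neighbourhood
   of [v] on which [dom a] is a uniform integrable bound. *)
move=> vr; pose a := (`|v - m| + r) / 2.
have va : `|v - m| < a by rewrite /a; lra.
have ar : a < r by rewrite /a; lra.
pose F w x := f x * expR ((w - m) * t x).
have dF (w : R) (x : X) : is_derive w (1 : R) (F ^~ x) (f x * t x * expR ((w - m) * t x)).
  have -> : (F ^~ x) = (f x) \*: (expR \o (fun w => (w - m) * t x)).
    by apply/funext => z; rewrite /F /=.
  apply: is_derive_eq.
  rewrite /GRing.scale/=; ring.
have Iv : `](m - a), (m + a)[%classic v by rewrite /= in_itv/= -ltr_distl.
have d1 w x : partial1of2 F w x = f x * t x * expR ((w - m) * t x).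
  rewrite partial1of2E; by apply: derive_val.
have Ia w : `](m - a), (m + a)[%classic w -> `|w - m| < a.
  by rewrite /= in_itv/= -ltr_distl.
have H : forall w, `](m - a), (m + a)[%classic w ->
    nu.-integrable setT (EFin \o F w).
  by move=> w /Ia wa; apply: integrable_tilt; rewrite (le_trans (ltW wa))// ltW.
have dom0 y : 0 <= dom a y.
  by rewrite /dom mulr_ge0// ?mulr_ge0// ?addr_ge0 ?expR_ge0// invr_ge0 ltW// subr_gt0.
have G_ub : forall w y, `](m - a), (m + a)[%classic w -> [set: X] y ->
    `|partial1of2 F w y| <= dom a y.
  by move=> w y /Ia wa _; rewrite d1; apply: le_dom => //; exact: ltW.
have dF1 (w : R) (y : X) : `](m - a), (m + a)[%classic w -> [set: X] y -> derivable (F ^~ y) w (1 : R).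
  by move=> _ _; have [] := dF w y.
apply: DeriveDef.
  exact: (derivable_under_integral measurableT Iv H dF1 dom0 (int_dom a) G_ub).
rewrite -derive1E.
rewrite (differentiation_under_integral measurableT Iv H dF1 dom0 (int_dom a) G_ub).
by apply: eq_Rintegral => x _; rewrite d1.
Qed.

Lemma continuous_tilt1 (v : R) : `|v - m| < r ->
  {for v, continuous (fun w : R => \int[nu]_x (f x * t x * expR ((w - m) * t x)))}.
Proof.
move=> vr; pose a := (`|v - m| + r) / 2.
have va : `|v - m| < a by rewrite /a; lra.
have ar : a < r by rewrite /a; lra.
have Ia w : `](m - a), (m + a)[%classic w -> `|w - m| < a.
  by rewrite /= in_itv/= -ltr_distl.
apply: (@continuity_under_integral _ _ _ nu (fun w x => f x * t x * expR ((w - m) * t x))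
  _ measurableT (m - a) (m + a) _ _ (dom a)).
- by move=> w /Ia wa; apply: integrable_tilt1; exact: lt_trans ar.
- apply: aeW => x _ /= w _.
  have D : is_derive w (1 : R) (fun l : R => f x * t x * expR ((l - m) * t x))
     (f x * t x * (t x * expR ((w - m) * t x))).
    have -> : (fun l : R => f x * t x * expR ((l - m) * t x)) =
       (f x * t x) \*: (expR \o (fun w => (w - m) * t x)).
      by apply/funext => z /=.
    apply: is_derive_eq.
    rewrite /GRing.scale/=; ring.
  by apply: differentiable_continuous; apply/derivable1_diffP; have [] := D.
- exact: int_dom.
- by move=> w /Ia wa; apply: aeW => x _; apply: le_dom => //; exact: ltW.
- by rewrite inE /= in_itv/= -ltr_distl.
Qed.

End one_function.
End tilt.

(** Under the tilted law with parameter v, [N v / L v] is the mean of [g], and its derivative is the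
    covariance of [g] and [t]; the factor [b] holds the weights of the other coordinates. Because a
    < r, the weight r^2 - (v - m)^2 does not vanish at the ends, and a boundary term remains that
    becomes small as a approaches r. *)
Lemma tilt_by_parts (R : realType) (d : measure_display) (X : measurableType d)
    (nu : {measure set X -> \bar R}) (t b g : X -> R) (m r a c : R) :
  measurable_fun setT t -> measurable_fun setT b -> measurable_fun setT g ->
  (forall x, 0 <= b x) -> (forall x, `|g x| <= c) -> 0 < a -> a < r ->
  nu.-integrable setT
    (EFin \o (fun x => b x * (expR (r * t x) + expR (- r * t x)))) ->
  let L v := \int[nu]_x (b x * expR ((v - m) * t x)) in
  let L1 v := \int[nu]_x (b x * t x * expR ((v - m) * t x)) in
  let N v := \int[nu]_x (g x * b x * expR ((v - m) * t x)) in
  let N1 v := \int[nu]_x (g x * b x * t x * expR ((v - m) * t x)) in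
  (forall v, `|v - m| < r -> 0 < L v) ->
  \int[lebesgue_measure]_(v in `[m - a, m + a])
     ((r ^+ 2 - (v - m) ^+ 2) * (N1 v / L v - N v / L v * (L1 v / L v))) =
  (r ^+ 2 - a ^+ 2) * (N (m + a) / L (m + a) - N (m - a) / L (m - a)) +
  \int[lebesgue_measure]_(v in `[m - a, m + a]) (2 * (v - m) * (N v / L v)).
Proof.
move=> mt mb mg b0 gc a0 ar intb L L1 N N1 L0.
have c0 x : 0 <= c := le_trans (normr_ge0 _) (gc x).
have intb' : nu.-integrable setT (EFin \o
    (fun x => `|b x| * (expR (r * t x) + expR (- r * t x)))).
  by apply: (eq_integrable measurableT) intb => x _ /=; rewrite ger0_norm.
have mgb : measurable_fun setT (fun x => g x * b x) by exact: measurable_funM.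
have mcosh : measurable_fun setT (fun x => expR (r * t x) + expR (- r * t x)).
  by apply: measurable_funD; apply: measurableT_comp => //; exact: measurable_funM.
have cosh0 x : 0 <= expR (r * t x) + expR (- r * t x).
  by rewrite addr_ge0 ?expR_ge0.
have intgb : nu.-integrable setT (EFin \o
    (fun x => `|g x * b x| * (expR (r * t x) + expR (- r * t x)))).
  apply: le_integrableR (integrableZl measurableT c intb).
    by apply: measurable_funM => //; exact: measurableT_comp.
  move=> x; rewrite ger0_norm ?mulr_ge0// normrM (ger0_norm (b0 x)).
  by rewrite -mulrA ler_wpM2r// mulr_ge0.
have r0 : 0 < r by exact: lt_trans ar.
have dL (v : R) : `|v - m| < r -> is_derive v (1 : R) L (L1 v).
  by move=> vr; exact: (is_derive_tilt mt mb intb').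
have dN (v : R) : `|v - m| < r -> is_derive v (1 : R) N (N1 v).
  by move=> vr; exact: (is_derive_tilt mt mgb intgb).
pose G v := N v / L v.
pose G1 v := N1 v / L v - N v / L v * (L1 v / L v).
have dG (v : R) : `|v - m| < r -> is_derive v (1 : R) G (G1 v).
  move=> vr; have dLv := dL _ vr; have dNv := dN _ vr.
  have Lv0 : L v != 0 by rewrite gt_eqF ?L0.
  have dV := is_deriveV Lv0 dLv.
  have := is_deriveM dNv dV; rewrite /G1 => dG.
  apply: is_derive_eq dG _; rewrite /GRing.scale/=.
  by field.
have ctsG (v : R) : `|v - m| < r -> {for v, continuous G}.
  move=> vr; apply: differentiable_continuous; apply/derivable1_diffP.
  by have [] := dG _ vr.
have ctsf (F F1 : R -> R) (v : R) : is_derive v (1 : R) F (F1 v) -> {for v, continuous F}.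
  by move=> [+ _] => /derivable1_diffP/differentiable_continuous.
have ctsG1 (v : R) : `|v - m| < r -> {for v, continuous G1}.
  move=> vr.
  have cL : {for v, continuous L} by apply: (ctsf _ L1); exact: dL.
  have cN : {for v, continuous N} by apply: (ctsf _ N1); exact: dN.
  have cL1 : {for v, continuous L1} by exact: (continuous_tilt1 mt mb intb').
  have cN1 : {for v, continuous N1} by exact: (continuous_tilt1 mt mgb intgb).
  have Lv0 : L v != 0 by rewrite gt_eqF ?L0.
  have cV : {for v, continuous (fun w => (L w)^-1)} by apply: cvgV.
  apply: cvgB; first exact: cvgM.
  by apply: cvgM; exact: cvgM.
have Ia v : v \in `[m - a, m + a] -> `|v - m| < r.
  by rewrite in_itv/= -ler_distl => /le_lt_trans; apply.
have aa : m - a < m + a by rewrite ltrD2l gtrN.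
pose F (v : R) := r ^+ 2 - (v - m) ^+ 2.
have dF (v : R) : is_derive v (1 : R) F (- (2 * (v - m))).
  have -> : F = cst (r ^+ 2) - (id - cst m) * (id - cst m).
    by apply/funext => w; rewrite /F /= expr2.
  apply: is_derive_eq; rewrite /GRing.scale/= !fctE; ring.
have cts2 (v : R) : {for v, continuous (fun w : R => - (2 * (w - m)))}.
  by apply: cvgN; apply: cvgM; [exact: cvg_cst|apply: cvgB; [exact: cvg_id|exact: cvg_cst]].
rewrite [LHS](@Rintegration_by_parts _ F G (fun v => - (2 * (v - m))) G1)//.
- have e1 : m + a - m = a by ring.
  have e2 : m - a - m = - a by ring.
  rewrite /F e1 e2 sqrrN -mulrBr; congr (_ + _).
  rewrite -[LHS]mulN1r -RintegralZl//.
    by apply: eq_Rintegral => v _; rewrite mulN1r mulNr opprK.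
  apply: continuous_compact_integrable; first exact: segment_compact.
  apply: continuous_in_subspaceT => v /set_mem/= /Ia vr.
  by apply: cvgM; [exact: cts2|exact: ctsG].
- by apply: continuous_in_subspaceT => v _; exact: cts2.
- split.
  + by move=> v _; have [] := dF v.
  + by apply: cvg_at_right_filter; apply: (ctsf F (fun v => - (2 * (v - m)))).
  + by apply: cvg_at_left_filter; apply: (ctsf F (fun v => - (2 * (v - m)))).
- by move=> v _; rewrite derive1E; apply: derive_val.
- apply: continuous_in_subspaceT => v /set_mem/= /Ia; exact: ctsG1.
- split.
  + move=> v /subset_itv_oo_cc/Ia vr; by have [] := dG _ vr.
  + by apply: cvg_at_right_filter; apply: ctsG; apply: Ia; rewrite in_itv/= lexx ltW.
  + by apply: cvg_at_left_filter; apply: ctsG; apply: Ia; rewrite in_itv/= lexx ltW.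
- move=> v /subset_itv_oo_cc/Ia vr; rewrite derive1E.
  by have [_ ] := dG _ vr.
Qed.

(** * Differential privacy and resampling *)

(** The bound exp x <= 1/(1 - x) is too weak near x = 1, so it is used at e/8 and then squared three
    times. As e <= 1, squaring replaces a slope a by at most 2a + a^2, and the slopes 0.1429,
    0.3063, 0.7065 end below 2. *)
Lemma expR_le1D2x (R : realType) (e : R) : 0 <= e -> e <= 1 ->
  expR e <= 1 + 2 * e.
Proof.
move=> e0 e1.
have sq (a b x y : R) : 0 <= a -> 2 * a + a ^+ 2 <= b -> 0 <= x ->
    x <= 1 + a * e -> y = x * x -> y <= 1 + b * e.
  move=> a0 ab x0 xa ->.
  have h : x * x <= (1 + a * e) * (1 + a * e) by rewrite ler_pM.
  apply: le_trans h _.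
  have : a ^+ 2 * e * e <= a ^+ 2 * e * 1.
    by rewrite ler_wpM2l// mulr_ge0// sqr_ge0.
  have : (2 * a + a ^+ 2) * e <= b * e by rewrite ler_wpM2r.
  lra.
have half x : expR x = expR (x / 2) * expR (x / 2) :> R.
  by rewrite -expRD -splitr.
(* 1/(1 - e/8) <= 1 + e/7 for e <= 1, and 1/7 < 0.1429. *)
have h3 : expR (e / 2 / 2 / 2) <= 1 + (1429 / 10000) * e.
  have d0 : 0 < 1 - e / 2 / 2 / 2 by lra.
  rewrite -[leLHS]invrK -expRN.
  apply: (@le_trans _ _ (1 - e / 2 / 2 / 2)^-1).
    rewrite lef_pV2 ?posrE ?expR_gt0//.
    by apply: le_trans (expR_ge1Dx _); rewrite lexx.
  rewrite -[leLHS]mul1r ler_pdivrMr//.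
  have : e * e <= e * 1 by rewrite ler_wpM2l.
  lra.
apply: (sq (7065 / 10000) 2 _ _ _ _ _ _ (half e)); [lra|lra|exact: expR_ge0|].
apply: (sq (3063 / 10000) (7065 / 10000) _ _ _ _ _ _ (half _)); [lra|lra|exact: expR_ge0|].
by apply: (sq (1429 / 10000) (3063 / 10000) _ _ _ _ _ _ (half _)); [lra|lra|exact: expR_ge0|].
Qed.

Section conull.
Context (R : realType) (d : measure_display) (T : measurableType d)
  (mu : {measure set T -> \bar R}).

Lemma le_Rintegral_conull (D : set T) (f g : T -> R) :
  measurable D -> mu (~` D) = 0%E ->
  mu.-integrable setT (EFin \o f) -> mu.-integrable setT (EFin \o g) ->
  (forall x, D x -> f x <= g x) -> \int[mu]_x f x <= \int[mu]_x g x.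
Proof.
move=> mD D0 intf intg fg.
have mCD : measurable (~` D) by exact: measurableC.
rewrite /Rintegral (negligible_integral mCD measurableT intf D0).
rewrite (negligible_integral mCD measurableT intg D0) setTD setCK.
apply: le_Rintegral => //.
- exact: integrableS intf.
- exact: integrableS intg.
Qed.

Lemma eq_integral_conull (D : set T) (f g : T -> \bar R) :
  measurable D -> mu (~` D) = 0%E -> measurable_fun setT f ->
  measurable_fun setT g -> (forall x, D x -> f x = g x) ->
  (\int[mu]_x f x = \int[mu]_x g x)%E.
Proof.
move=> mD D0 mf mg fg; apply: ae_eq_integral => //.
exists (~` D); split => //; first exact: measurableC.
by move=> x /= + Dx; apply => _; exact: fg.
Qed.

Lemma bounded_integrableR (f : T -> R) (c : R) : (mu setT < +oo)%E ->
  measurable_fun setT f -> (forall x, `|f x| <= c) ->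
  mu.-integrable setT (EFin \o f).
Proof.
move=> muT mf fc; apply: measurable_bounded_integrable => //.
by exists c; split; [exact: num_real|move=> M cM x _; exact: le_trans (fc x) (ltW cM)].
Qed.

End conull.

Lemma prob_bounded_integrable (R : realType) (d : measure_display)
    (T : measurableType d) (P : probability T R) (f : T -> R) (c : R) :
  measurable_fun setT f -> (forall x, `|f x| <= c) ->
  P.-integrable setT (EFin \o f).
Proof. by apply: bounded_integrableR; rewrite [X in (X < _)%E]probability_setT ltry. Qed.

Lemma prob_Rintegral_cst (R : realType) (d : measure_display)
    (T : measurableType d) (P : probability T R) (c : R) : \int[P]_x c = c.
Proof. by rewrite /Rintegral integral_prob_cst. Qed.

Lemma prob_bounded_Rintegral (R : realType) (d : measure_display)
    (T : measurableType d) (P : probability T R) (f : T -> R) (c : R) :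
  measurable_fun setT f -> (forall x, `|f x| <= c) -> `|\int[P]_x f x| <= c.
Proof.
move=> mf fc; have i := prob_bounded_integrable P mf fc.
apply: le_trans (le_normr_Rintegral measurableT i) _.
rewrite -[leRHS](prob_Rintegral_cst P); apply: le_Rintegral => //.
- by apply: (prob_bounded_integrable P (c := c)) => [|x]; rewrite ?normr_id//; exact: measurableT_comp.
- by apply: (prob_bounded_integrable P (c := `|c|)).
Qed.

Section dp_integral.
Context (R : realType) (d : measure_display) (Y : measurableType d).
Implicit Types (P Q : probability Y R) (eps delta : R).

Lemma ge0_integral_layer_cake P (f : Y -> R) : measurable_fun setT f ->
  (forall y, 0 <= f y) ->
  (\int[P]_y (f y)%:E =
   \int[@lebesgue_measure R]_(t in `[0%R, +oo[) P [set y | (t < f y)%R])%E.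
Proof.
move=> mf f0; pose X : {RV P >-> R} := mfun_Sub (mem_set mf).
have := @ge0_expectation_ccdf _ _ _ P X f0; rewrite expectation_def /= => ->.
apply: eq_integral => t _; rewrite /ccdf /distribution /pushforward.
by congr (P _); apply/seteqP; split => y /=; rewrite in_itv/= andbT.
Qed.

Lemma measurable_tail P (f : Y -> R) : measurable_fun setT f ->
  measurable_fun setT (fun t : R => P [set y | t < f y]).
Proof.
move=> mf; pose X : {RV P >-> R} := mfun_Sub (mem_set mf).
apply: eq_measurable_fun (@ccdf_measurable _ _ _ P X) => t _.
rewrite /ccdf /distribution /pushforward.
by congr (P _); apply/seteqP; split => y /=; rewrite in_itv/= andbT.
Qed.

(** The inequality between probabilities is integrated over the level sets {t < f}. Levels from t0
    on are empty, so delta is paid over a length t0 only. *)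
Lemma dp_le_integral P Q eps delta (t0 : R) (f : Y -> R) :
  0 <= delta -> 0 <= t0 ->
  (forall A, measurable A -> (P A <= (expR eps)%:E * Q A + delta%:E)%E) ->
  measurable_fun setT f -> (forall y, 0 <= f y <= t0) ->
  \int[P]_y f y <= expR eps * \int[Q]_y f y + delta * t0.
Proof.
move=> de0 t00 PQ mf f0t.
have f0 y : 0 <= f y by have /andP[] := f0t y.
have ft y : `|f y| <= t0 by rewrite ger0_norm//; have /andP[] := f0t y.
have iP := prob_bounded_integrable P mf ft.
have iQ := prob_bounded_integrable Q mf ft.
rewrite -lee_fin EFinD EFinM /Rintegral !fineK; last 2 first.
- exact: (integrable_fin_num _ iQ).
- exact: (integrable_fin_num _ iP).
rewrite !ge0_integral_layer_cake//.
have mA t : measurable [set y | t < f y].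
  have -> : [set y | t < f y] = f @^-1` `]t, +oo[.
    by apply/seteqP; split => y /=; rewrite in_itv/= andbT.
  by rewrite -[X in measurable X]setTI; apply: mf.
have mind : measurable_fun (`[0%R, +oo[%classic : set (measurableTypeR R))
    (fun t : measurableTypeR R => (\1_(`[0, t0[%classic : set (measurableTypeR R)) t : R)%:E).
  by apply/measurable_EFinP; apply: measurable_funTS; apply: measurable_indic.
rewrite -ge0_integralZl ?lee_fin ?expR_ge0//; last first.
  by apply: measurable_funTS; exact: measurable_tail.
have -> : (delta * t0)%:E = (\int[@lebesgue_measure R]_(t in `[0%R, +oo[)
    (delta%:E * (\1_(`[0, t0[%classic : set (measurableTypeR R)) t : R)%:E))%E.
  rewrite ge0_integralZl ?lee_fin//.
  rewrite integral_indic//.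
  have -> : (`[0, t0[ `&` `[0, +oo[)%classic = `[0, t0[%classic :> set R.
    by apply/setIidPl => x /=; rewrite !in_itv/= andbT => /andP[].
  rewrite [X in (_ * X)%E](_ : _ = @lebesgue_measure R `[0, t0[%classic)//.
  rewrite lebesgue_measure_itv/= lte_fin.
  by have [t0p|] := ltP 0 t0; rewrite ?oppr0 ?adde0 ?EFinM// => ?;
    rewrite (_ : t0 = 0) ?mulr0 ?mule0//; apply/eqP; rewrite eq_le t00 andbT.
rewrite -ge0_integralD//.
- apply: ge0_le_integral => //.
  + by apply: measurable_funTS; exact: measurable_tail.
  + apply: emeasurable_funD; apply: emeasurable_funM => //.
    by apply: measurable_funTS; exact: measurable_tail.
  + move=> t; rewrite /= in_itv/= andbT => t00'.
    rewrite indicE; have [tt0|tt0] := ltP t t0.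
      by rewrite mem_set ?mule1 ?PQ//= in_itv/= t00' tt0.
    rewrite (_ : [set y | t < f y] = set0) ?measure0; last first.
      apply/seteqP; split => y //=; have /andP[_ fy] := f0t y.
      by rewrite ltNge (le_trans fy).
    by rewrite adde_ge0// mule_ge0// lee_fin ?expR_ge0.
- by move=> t _; rewrite mule_ge0// lee_fin expR_ge0.
- apply: emeasurable_funM => //.
  by apply: measurable_funTS; exact: measurable_tail.
- by move=> t _; rewrite mule_ge0// lee_fin.
- exact: emeasurable_funM.
Qed.

(** [u] and [v] are the positive and negative parts of [f] cut at t0, so [u - v] differs from [f] by
    at most the excess of [B] over t0; this excess is paid once under [P] and once under [Q]. The
    upper bound on the mean of [u] uses privacy from [P] to [Q], the lower bound on the mean of [v]
    the opposite direction. *)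
Lemma dp_le_Rintegral P Q eps delta (t0 B : R) (f : Y -> R) :
  0 <= eps -> eps <= 1 -> 0 <= delta -> 0 <= t0 ->
  (forall A, measurable A -> (P A <= (expR eps)%:E * Q A + delta%:E)%E) ->
  (forall A, measurable A -> (Q A <= (expR eps)%:E * P A + delta%:E)%E) ->
  measurable_fun setT f -> (forall y, `|f y| <= B) ->
  \int[P]_y f y <= \int[Q]_y f y + 2 * eps * \int[Q]_y `|f y| +
    2 * delta * t0 + 2 * Num.max (B - t0) 0.
Proof.
move=> e0 e1 d0 t00 PQ QP mf fB.
pose u y := Num.min (Num.max (f y) 0) t0.
pose v y : R := Num.min (Num.max (- f y) 0) t0.
have mu_ : measurable_fun setT u.
  by apply: measurable_minr => //; exact: measurable_maxr.
have mv_ : measurable_fun setT v.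
  apply: measurable_minr => //; apply: measurable_maxr => //.
  exact: measurableT_comp.
have u0 y : 0 <= u y <= t0.
  by rewrite /u le_min ge_min t00 lexx orbT andbT le_max lexx orbT.
have v0 y : 0 <= v y <= t0.
  by rewrite /v le_min ge_min t00 lexx orbT andbT le_max lexx orbT.
have un y : `|u y| <= t0 by have /andP[? ?] := u0 y; rewrite ger0_norm.
have vn y : `|v y| <= t0 by have /andP[? ?] := v0 y; rewrite ger0_norm.
set K : R := Num.max (B - t0) 0.
have K0 : 0 <= K by rewrite /K le_max lexx orbT.
have KB : B - t0 <= K by rewrite /K le_max lexx.
have fuv y : [/\ f y <= u y - v y + K, u y - v y <= f y + K & u y + v y <= `|f y|].
  have := fB y; rewrite ler_norml => /andP[f1 f2]; rewrite /u /v.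
  case/orP: (le_total 0 (f y)) => f0.
    have f0' : - f y <= 0 by rewrite oppr_le0.
    rewrite (max_idPl f0) (max_idPr f0').
    rewrite (min_idPl t00) subr0 addr0 (ger0_norm f0).
    by have [ft|ft] := leP (f y) t0; split; lra.
  have f0' : 0 <= - f y by rewrite oppr_ge0.
  rewrite (max_idPr f0) (max_idPl f0').
  rewrite (min_idPl t00) sub0r add0r (ler0_norm f0).
  by have [ft|ft] := leP (- f y) t0; split; lra.
have iu (P' : probability Y R) := prob_bounded_integrable P' mu_ un.
have iv (P' : probability Y R) := prob_bounded_integrable P' mv_ vn.
have if_ (P' : probability Y R) := prob_bounded_integrable P' mf fB.
have ik (P' : probability Y R) (c : R) : P'.-integrable setT (EFin \o cst c).
  by apply: (prob_bounded_integrable P' (c := `|c|)).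
have iaf : Q.-integrable setT (EFin \o (fun y => `|f y|)).
  apply: (prob_bounded_integrable Q (c := B)) => [|x]; rewrite ?normr_id//.
  exact: measurableT_comp.
have iuv (P' : probability Y R) : P'.-integrable setT (EFin \o (fun y => u y - v y)).
  exact: (integrableB measurableT (iu P') (iv P')).
have h1 : \int[P]_y f y <= \int[P]_y u y - \int[P]_y v y + K.
  rewrite -(RintegralB measurableT (iu P) (iv P)).
  rewrite -[K](prob_Rintegral_cst P) -(RintegralD measurableT (iuv P) (ik P K)).
  apply: le_Rintegral => //; first exact: if_.
    exact: (integrableD measurableT (iuv P) (ik P K)).
  by move=> y _; have [] := fuv y.
have h2 : \int[Q]_y u y - \int[Q]_y v y <= \int[Q]_y f y + K.
  rewrite -(RintegralB measurableT (iu Q) (iv Q)).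
  rewrite -[K](prob_Rintegral_cst Q) -(RintegralD measurableT (if_ Q) (ik Q K)).
  apply: le_Rintegral => //; first exact: iuv.
    exact: (integrableD measurableT (if_ Q) (ik Q K)).
  by move=> y _; have [] := fuv y.
have h3 : \int[Q]_y u y + \int[Q]_y v y <= \int[Q]_y `|f y|.
  rewrite -(RintegralD measurableT (iu Q) (iv Q)).
  apply: le_Rintegral => //.
    exact: (integrableD measurableT (iu Q) (iv Q)).
  by move=> y _; have [] := fuv y.
have h4 := dp_le_integral d0 t00 PQ mu_ u0.
have h5 := dp_le_integral d0 t00 QP mv_ v0.
have := expR_le1D2x e0 e1.
move: h1 h2 h3 h4 h5.
have : 0 <= \int[Q]_y u y by apply: Rintegral_ge0 => y _; have /andP[] := u0 y.
have : 0 <= \int[Q]_y v y by apply: Rintegral_ge0 => y _; have /andP[] := v0 y.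
have : 0 <= \int[P]_y v y by apply: Rintegral_ge0 => y _; have /andP[] := v0 y.
have dt : 0 <= delta * t0 by rewrite mulr_ge0.
move: (\int[P]_y f y) (\int[P]_y u y) (\int[P]_y v y) (\int[Q]_y f y)
  (\int[Q]_y u y) (\int[Q]_y v y) (\int[Q]_y `|f y|) (expR eps) => a a' b' c a1 b1 n E.
move=> b'0 b10 a10 h1 h2 h3 h4 h5 hE.
have h6 : E * a1 <= (1 + 2 * eps) * a1 by rewrite ler_wpM2r.
have h7 : E * b' <= (1 + 2 * eps) * b' by rewrite ler_wpM2r.
have h8 : 2 * eps * (a1 + b1) <= 2 * eps * n by rewrite ler_wpM2l// mulr_ge0.
(* The relative error has to be measured by the mean of [v] under [Q], whereas privacy gives it
   under [P]. If the mean under [P] is the larger one there is nothing to prove; otherwise replacing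
   it by the mean under [Q] only increases the error. *)
have h9 : b1 <= b' + 2 * eps * b1 + delta * t0.
  have [bb|bb] := leP b1 b'.
    have : 0 <= 2 * eps * b1 by rewrite !mulr_ge0.
    lra.
  have : 2 * eps * b' <= 2 * eps * b1 by rewrite ler_wpM2l ?mulr_ge0// ltW.
  lra.
lra.
Qed.

End dp_integral.

(** * Mechanisms as kernels, and independent resampling of one entry *)

Section kernel_integral.
Context (R : realType) (d d' : measure_display).
Context (X : measurableType d) (Y : measurableType d').
Variable M : R.-pker X ~> Y.

(** A separate name for [M x], on which the structure of a probability is registered. *)
Definition kernel_prob (x : X) : set Y -> \bar R := M x.

HB.instance Definition _ (x : X) := Measure.on (kernel_prob x).

HB.instance Definition _ (x : X) :=
  Measure_isProbability.Build _ _ _ (kernel_prob x) (prob_kernel x).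

Definition kernel_mean (f : Y -> R) (x : X) : R := \int[kernel_prob x]_y f y.

Lemma kernel_mean_bounded (f : Y -> R) (c : R) : measurable_fun setT f ->
  (forall y, `|f y| <= c) -> forall x, `|kernel_mean f x| <= c.
Proof. by move=> mf fc x; exact: prob_bounded_Rintegral. Qed.

Lemma measurable_kernel_integral (f : Y -> R) : measurable_fun setT f ->
  measurable_fun setT (fun x => \int[M x]_y (f y)%:E)%E.
Proof.
move=> mf; under eq_fun do rewrite integralE.
apply: emeasurable_funB.
- apply: (@measurable_fun_integral_sfinite_kernel _ _ _ _ _
    (fun z => (EFin \o f)^\+ z.2)%E M) => [z|]; first exact: funepos_ge0.
  apply: measurableT_comp => //; apply: measurable_funepos.
  exact/measurable_EFinP.
- apply: (@measurable_fun_integral_sfinite_kernel _ _ _ _ _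
    (fun z => (EFin \o f)^\- z.2)%E M) => [z|]; first exact: funeneg_ge0.
  apply: measurableT_comp => //; apply: measurable_funeneg.
  exact/measurable_EFinP.
Qed.

Lemma measurable_kernel_mean (f : Y -> R) :
  measurable_fun setT f -> measurable_fun setT (kernel_mean f).
Proof.
move=> mf; rewrite /kernel_mean /Rintegral; apply: measurableT_comp => //.
exact: measurable_kernel_integral.
Qed.

Lemma kernel_mean_integrable (f : Y -> R) (c : R) (P : probability X R) :
  measurable_fun setT f -> (forall y, `|f y| <= c) ->
  P.-integrable setT (EFin \o kernel_mean f).
Proof.
move=> mf fc; apply: prob_bounded_integrable (kernel_mean_bounded mf fc).
exact: measurable_kernel_mean.
Qed.

End kernel_integral.

Section pullback.
Local Open Scope ereal_scope.
Context (R : realType) (d d' : measure_display) (T : measurableType d)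
  (T' : measurableType d').
Variables (P : {measure set T -> \bar R}) (Q : {measure set T' -> \bar R})
  (phi : T' -> T).
Hypothesis mphi : measurable_fun setT phi.
Hypothesis PQ : forall f : T -> \bar R, measurable_fun setT f ->
  (forall x, 0 <= f x) -> \int[P]_x f x = \int[Q]_x f (phi x).

Let PQ1 (f : T -> \bar R) : measurable_fun setT f -> (forall x, 0 <= f x) ->
  \int[P]_x f x = \int[Q]_x (f (phi x) * (cst 1%R x)%:E).
Proof. by move=> mf f0; rewrite PQ//; apply: eq_integral => x _; rewrite mule1. Qed.

Lemma pullback_integrable (f : T -> R) : measurable_fun setT f ->
  P.-integrable setT (EFin \o f) <->
  Q.-integrable setT (EFin \o (fun x => f (phi x))).
Proof.
move=> mf.
have -> : (fun x => f (phi x)) = (fun x => f (phi x) * cst 1%R x)%R.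
  by apply/funext => x; rewrite mulr1.
by apply: transfer_integrable => //.
Qed.

Lemma pullback_Rintegral (f : T -> R) : measurable_fun setT f ->
  (\int[P]_x f x = \int[Q]_x f (phi x))%R.
Proof.
move=> mf; rewrite (transfer_Rintegral (q := cst 1%R) (fun=> ler01) PQ1)//.
by apply: eq_Rintegral => x _; rewrite mulr1.
Qed.

End pullback.

Section joint.
Context (R : realType) (d : measure_display) (X : measurableType d) (n : nat).
Variables (P : probability X R) (i : 'I_n).
Let J := (iid n P \x P)%E.

Lemma measurable_product_set (S : 'I_n -> set X) :
  (forall j, measurable (S j)) ->
  measurable [set x : n.-tuple X | forall j, S j (tnth x j)].
Proof.
move=> mS; rewrite (_ : [set x | _] = \bigcap_(j in [set: 'I_n])
    ((fun x : n.-tuple X => tnth x j) @^-1` S j)).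
  apply: fin_bigcap_measurable => //.
  move=> j _; rewrite -[X in measurable X]setTI.
  exact: (measurable_tnth j).
by apply/seteqP; split=> x /= H j; have := H j; [move=> ? _|exact].
Qed.

(** Union bound over the coordinates, each of which has its own factor as marginal law. *)
Lemma product_prob_conull (Q : 'I_n -> probability X R) (S : 'I_n -> set X) :
  (forall j, measurable (S j)) -> (forall j, Q j (~` S j) = 0%E) ->
  product_prob Q (~` [set x | forall j, S j (tnth x j)]) = 0%E.
Proof.
move=> mS Q0; apply/eqP; rewrite eq_le measure_ge0 andbT.
have mD := measurable_product_set mS; set D := [set x | _] in mD *.
have -> : product_prob Q (~` D) = (\int[product_prob Q]_x (\1_(~` D) x)%:E)%E.
  by rewrite integral_indic ?setIT//; exact: measurableC.
have mSC j : measurable (~` S j) by exact: measurableC.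
have mind j : measurable_fun setT (fun y : X => (\1_(~` S j) y : R)%:E).
  by apply/measurable_EFinP; exact: measurable_indic.
have mindt j : measurable_fun setT
    (fun x : n.-tuple X => (\1_(~` S j) (tnth x j) : R)%:E).
  exact: measurableT_comp (mind j) (measurable_tnth j).
apply: (@le_trans _ _
  (\int[product_prob Q]_x \sum_(j < n) (\1_(~` S j) (tnth x j))%:E)%E).
  apply: ge0_le_integral => //.
  - by apply/measurable_EFinP; apply: measurable_indic; exact: measurableC.
  - exact: emeasurable_sum.
  - move=> x _; rewrite [X in (X%:E <= _)%E]indicE; case: (boolP (x \in _)) => [|_]; last first.
      by apply: sume_ge0.
    rewrite inE => /existsNP[j Sj].
    by rewrite (bigD1 j)//= indicE mem_set// leeDl// sume_ge0.
rewrite ge0_integral_sum// big1// => j _.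
rewrite -(ge0_integral_tnth Q j (mind j))//.
rewrite integral_indic// setIT; exact: Q0.
Qed.

Lemma measurable_datasets (S : set X) : measurable S ->
  measurable (datasets (n := n) S).
Proof. by move=> mS; exact: (measurable_product_set (S := fun=> S)). Qed.

Lemma iid_datasets_conull (S : set X) : measurable S -> P (~` S) = 0%E ->
  iid n P (~` datasets S) = 0%E.
Proof. by move=> mS P0; exact: (product_prob_conull (S := fun=> S)). Qed.

Lemma integral_joint1 (f : n.-tuple X -> \bar R) : measurable_fun setT f ->
  (forall x, 0 <= f x)%E -> (\int[iid n P]_x f x = \int[J]_z f z.1)%E.
Proof.
move=> mf f0; rewrite fubini_tonelli1//; last exact: measurableT_comp.
by apply: eq_integral => x _; rewrite /fubini_F/= integral_prob_cst.
Qed.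

Lemma integral_joint2 (f : X -> \bar R) : measurable_fun setT f ->
  (forall x, 0 <= f x)%E -> (\int[P]_x f x = \int[J]_z f z.2)%E.
Proof.
move=> mf f0; rewrite fubini_tonelli1//; last exact: measurableT_comp.
by rewrite /fubini_F/= integral_prob_cst.
Qed.

Definition joint_swap (z : n.-tuple X * X) := (replace z.1 i z.2, tnth z.1 i).

Lemma measurable_joint_swap : measurable_fun setT joint_swap.
Proof.
apply: measurable_fun_pair; first exact: measurable_replace.
by apply: (measurableT_comp (measurable_tnth i)); exact: measurable_fst.
Qed.

(** For z = (X, X_i'), the pair [joint_swap z] is (X_{~i}, X_i). A statement about M(X_{~i}) and X_i
    thus becomes one about a product measure, where the two components separate. *)
Lemma integral_joint_swap (f : n.-tuple X * X -> \bar R) :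
  measurable_fun setT f -> (forall x, 0 <= f x)%E ->
  (\int[J]_z f z = \int[J]_z f (joint_swap z))%E.
Proof.
move=> mf f0; rewrite fubini_tonelli1// fubini_tonelli1//; last first.
  by apply: measurableT_comp => //; exact: measurable_joint_swap.
exact: (esym (ge0_integral_swap (fun=> P) i mf f0)).
Qed.

Lemma joint_integrableM (u : n.-tuple X -> R) (c : R) (v : X -> R) :
  measurable_fun setT u -> (forall x, `|u x| <= c) ->
  P.-integrable setT (EFin \o v) ->
  J.-integrable setT (EFin \o (fun z => u z.1 * v z.2)).
Proof.
move=> mu_ uc iv.
have mv : measurable_fun setT v by apply/measurable_EFinP; exact: measurable_int iv.
have iv2 : J.-integrable setT (EFin \o (fun z => v z.2)).
  by apply/(pullback_integrable _ integral_joint2).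
have := integrableZl measurableT c (integrable_norm iv2).
apply: le_integrableR.
  by apply: measurable_funM; exact: measurableT_comp.
by move=> z; rewrite normrM ler_wpM2r.
Qed.

Lemma joint_RintegralM (u : n.-tuple X -> R) (c : R) (v : X -> R) :
  measurable_fun setT u -> (forall x, `|u x| <= c) ->
  P.-integrable setT (EFin \o v) ->
  \int[J]_z (u z.1 * v z.2) = \int[iid n P]_x u x * \int[P]_x v x.
Proof.
move=> mu_ uc iv; rewrite /Rintegral.
rewrite -(integral12_prod_meas1 (joint_integrableM mu_ uc iv)).
have iu := prob_bounded_integrable (iid n P) mu_ uc.
rewrite -[RHS]RintegralZr// /Rintegral; congr fine.
apply: eq_integral => x _; rewrite /fubini_F/=.
under eq_integral do rewrite EFinM.
rewrite integralZl// EFinM fineK//.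
exact: (integrable_fin_num _ iv).
Qed.

End joint.

Lemma joint_conull (R : realType) (d d' : measure_display) (X : measurableType d)
    (Y : measurableType d') (P : probability X R) (Q : probability Y R) A B :
  measurable A -> measurable B -> P (~` A) = 0%E -> Q (~` B) = 0%E ->
  (P \x Q)%E (~` (A `*` B)) = 0%E.
Proof.
move=> mA mB PA QB.
have c1 (d0 : measure_display) (T0 : measurableType d0) (P0 : probability T0 R) C :
    measurable C -> P0 (~` C) = 0%E -> P0 C = 1%E.
  by move=> mC; rewrite probability_setC// => /eqP; rewrite sube_eq ?add0e// => /eqP <-.
have c0 (d0 : measure_display) (T0 : measurableType d0) (P0 : probability T0 R) C :
    measurable C -> P0 C = 1%E -> P0 (~` C) = 0%E.
  by move=> mC e; rewrite probability_setC// e subee.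
apply: c0; first exact: measurableX.
rewrite /= product_measure1E//.
by rewrite [X in (X * _)%E](c1 _ _ P _ mA PA) [X in (_ * X)%E](c1 _ _ Q _ mB QB) mule1.
Qed.

Section integral_sums.
Context (R : realType) (d : measure_display) (T : measurableType d)
  (mu : {measure set T -> \bar R}).

Lemma integrable_sumR (I : finType) (f : I -> T -> R) :
  (forall j, mu.-integrable setT (EFin \o f j)) ->
  mu.-integrable setT (EFin \o (fun x => \sum_j f j x)).
Proof.
move=> fi; have := integrable_sum measurableT (P := xpredT) (index_enum I)
  (fun j _ => fi j).
by apply: eq_integrable => // x _; rewrite /= sumEFin.
Qed.

Lemma Rintegral_sum (I : finType) (f : I -> T -> R) :
  (forall j, mu.-integrable setT (EFin \o f j)) ->
  \int[mu]_x (\sum_j f j x) = \sum_j \int[mu]_x f j x.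
Proof.
move=> fi; rewrite /Rintegral.
under eq_integral do rewrite -sumEFin.
rewrite integral_sum// [RHS]sum_fine// => j _.
exact: (integrable_fin_num _ (fi j)).
Qed.

Lemma integrableZR (c : R) (f : T -> R) : mu.-integrable setT (EFin \o f) ->
  mu.-integrable setT (EFin \o (fun x => c * f x)).
Proof. by move=> fi; exact: (integrableZl measurableT c fi). Qed.

Lemma integrableDR (f g : T -> R) : mu.-integrable setT (EFin \o f) ->
  mu.-integrable setT (EFin \o g) ->
  mu.-integrable setT (EFin \o (fun x => f x + g x)).
Proof. by move=> fi gi; exact: (integrableD measurableT fi gi). Qed.

End integral_sums.

(** * The privacy bound for the correlation with one sample point *)

Section dp_fingerprint.
Context (R : realType) (d d' : measure_display) (X : measurableType d)
  (Y : measurableType d') (n : nat).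
Variables (S : set X) (M : R.-pker (n.-tuple X) ~> Y) (eps delta : R).
Hypotheses (mS : measurable S) (eps_ge0 : 0 <= eps) (eps_le1 : eps <= 1)
  (delta_ge0 : 0 <= delta) (M_dp : dp eps delta S M).

Lemma datasets_replace x (i : 'I_n) z : datasets S x -> S z ->
  datasets S (replace x i z).
Proof. by move=> Sx Sz j; rewrite tnth_mktuple; case: ifP. Qed.

(** Neighbours differ in exactly one entry, whereas X_{~i} may coincide with X when the fresh sample
    equals the old one; privacy is silent there, and this inequality fills the gap. *)
Lemma dp_trivial (x : n.-tuple X) A :
  (M x A <= (expR eps)%:E * M x A + delta%:E)%E.
Proof.
apply: (@le_trans _ _ ((expR eps)%:E * M x A)%E); last by rewrite leeDl ?lee_fin.
rewrite -{1}[M x A]mul1e; apply: lee_wpmul2r => //.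
by rewrite lee_fin -expR0 ler_expR.
Qed.

Lemma dp_replace x (i : 'I_n) z : datasets S x -> S z ->
  (forall A, measurable A ->
    (M x A <= (expR eps)%:E * M (replace x i z) A + delta%:E)%E) /\
  (forall A, measurable A ->
    (M (replace x i z) A <= (expR eps)%:E * M x A + delta%:E)%E).
Proof.
move=> Sx Sz; have Sr := datasets_replace i Sx Sz.
have [xz|xz] := pselect (tnth x i = z).
  have -> : replace x i z = x.
    apply: eq_from_tnth => j; rewrite tnth_mktuple.
    by case: eqVneq => // ->.
  by split=> A _; exact: dp_trivial.
split=> A mA; apply: M_dp => //.
- exists i; rewrite tnth_mktuple eqxx; split => // j ji.
  by rewrite tnth_mktuple (negbTE ji).
- exists i; rewrite tnth_mktuple eqxx; split => [/esym//|j ji].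
  by rewrite tnth_mktuple (negbTE ji).
Qed.

Variables (P : probability X R) (k : nat) (s : 'I_k -> Y -> R) (C : R)
  (tau : 'I_k -> X -> R) (B : X -> R) (i : 'I_n) (t0 : R).
Hypotheses (P_S : P (~` S) = 0%E)
  (ms : forall j, measurable_fun setT (s j))
  (sC : forall j y, `|s j y| <= C)
  (mtau : forall j, measurable_fun setT (tau j))
  (itau : forall j, P.-integrable setT (EFin \o tau j))
  (itau2 : forall j l, P.-integrable setT (EFin \o (fun x => tau j x * tau l x)))
  (tau_mean : forall j, \int[P]_x tau j x = 0)
  (mB : measurable_fun setT B)
  (iB : P.-integrable setT (EFin \o B))
  (sB : forall x y, `|\sum_(j < k) s j y * tau j x| <= B x)
  (t0_gt0 : 0 < t0).

Let sigma j := kernel_mean M (s j).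
Let sigma2 j l := kernel_mean M (fun y => s j y * s l y).

Let ms2 j l : measurable_fun setT (fun y => s j y * s l y).
Proof. exact: measurable_funM. Qed.

Let s2C j l y : `|s j y * s l y| <= C * C.
Proof. by rewrite normrM ler_pM. Qed.

(** This is E[s^T Sigma s] with Sigma the covariance matrix of the centred statistics [tau]; the
    expectation of s s^T and Sigma appear as separate factors by independence of M(X_{~i}) and
    X_i. *)
Let Q := \sum_(j < k) \sum_(l < k)
  (\int[iid n P]_x sigma2 j l x) * (\int[P]_x (tau j x * tau l x)).

Let exc x : R := Num.max (B x - t0) 0.

(** With the data fixed, the transfer from M(X) to M(X_{~i}) is applied to the linear function y ->
    <s(y), tau(X_i)>. The first absolute moment is bounded through 2|f| <= lam + f^2/lam, with [lam]
    left free because its best value depends on the average over the data. *)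
Lemma fingerprint_pointwise (lam : R) x z : 0 < lam -> datasets S x -> S z ->
  \sum_(j < k) sigma j x * tau j (tnth x i) <=
  \sum_(j < k) sigma j (replace x i z) * tau j (tnth x i) +
  eps * (lam + lam^-1 * \sum_(j < k) \sum_(l < k)
     sigma2 j l (replace x i z) * (tau j (tnth x i) * tau l (tnth x i))) +
  2 * delta * t0 + 2 * exc (tnth x i).
Proof.
move=> lam0 Sx Sz; set w := tnth x i; set x' := replace x i z.
have [PQ QP] := dp_replace i Sx Sz.
pose f y := \sum_(j < k) s j y * tau j w.
have is_ (P' : probability Y R) j : P'.-integrable setT (EFin \o s j).
  exact: prob_bounded_integrable (sC j).
have is2 (P' : probability Y R) j l :
    P'.-integrable setT (EFin \o (fun y => s j y * s l y)).
  exact: prob_bounded_integrable (s2C j l).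
have mf : measurable_fun setT f.
  by apply: measurable_sum => j; apply: measurable_funM.
have fE (P' : probability Y R) :
    \int[P']_y f y = \sum_(j < k) \int[P']_y s j y * tau j w.
  rewrite /f Rintegral_sum; last first.
    move=> j; apply: (eq_integrable measurableT) (integrableZR (tau j w) (is_ P' j)) => y _.
    by rewrite /= mulrC.
  by apply: eq_bigr => j _; rewrite RintegralZr//; exact: is_.
have f2E y : f y ^+ 2 = \sum_(j < k) \sum_(l < k) (s j y * s l y) * (tau j w * tau l w).
  rewrite expr2 /f big_distrl/=; apply: eq_bigr => j _.
  by rewrite big_distrr/=; apply: eq_bigr => l _; ring.
have if2jl (P' : probability Y R) j l :
    P'.-integrable setT (EFin \o (fun y => s j y * s l y * (tau j w * tau l w))).
  apply: (eq_integrable measurableT) (integrableZR (tau j w * tau l w) (is2 P' j l)) => y _.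
  by rewrite /= mulrC.
have if2 (P' : probability Y R) : P'.-integrable setT (EFin \o (fun y => f y ^+ 2)).
  under eq_fun do rewrite f2E.
  by apply: integrable_sumR => j; apply: integrable_sumR => l; exact: if2jl.
have f2I (P' : probability Y R) : \int[P']_y f y ^+ 2 = \sum_(j < k) \sum_(l < k)
    \int[P']_y (s j y * s l y) * (tau j w * tau l w).
  under eq_Rintegral do rewrite f2E.
  rewrite Rintegral_sum; last by move=> j; apply: integrable_sumR => l; exact: if2jl.
  apply: eq_bigr => j _; rewrite Rintegral_sum; last by move=> l; exact: if2jl.
  by apply: eq_bigr => l _; rewrite RintegralZr//; exact: is2.
have := dp_le_Rintegral (P := kernel_prob M x) (Q := kernel_prob M x')
  eps_ge0 eps_le1 delta_ge0 (ltW t0_gt0) PQ QP mf (sB w).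
rewrite !fE => H; apply: le_trans H _.
rewrite -/(exc w) lerD2r lerD2r lerD2l [2 * eps]mulrC -mulrA ler_wpM2l//.
apply: (@le_trans _ _ (\int[kernel_prob M x']_y (lam + lam^-1 * f y ^+ 2))).
  rewrite -RintegralZl//; last first.
    exact: integrable_norm (prob_bounded_integrable _ mf (sB w)).
  apply: le_Rintegral => //.
  - apply: integrableZR.
    exact: integrable_norm (prob_bounded_integrable _ mf (sB w)).
  - apply: integrableDR; last by apply: integrableZR; exact: if2.
    exact: (prob_bounded_integrable _ (c := `|lam|)).
  (* After multiplication by [lam] this is (lam - |f|)^2 >= 0. *)
  - move=> y _; rewrite -(ler_pM2l lam0) mulrDr mulVKf ?gt_eqF//.
    rewrite -(real_normK (num_real (f y))).
    have := sqr_ge0 (lam - `|f y|); lra.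
rewrite RintegralD//; last 2 first.
- exact: (prob_bounded_integrable _ (c := `|lam|)).
- by apply: integrableZR; exact: if2.
by rewrite prob_Rintegral_cst RintegralZl ?f2I//; exact: if2.
Qed.

Let msigma j : measurable_fun setT (sigma j).
Proof. exact: measurable_kernel_mean. Qed.

Let sigmaC j x : `|sigma j x| <= C.
Proof. exact: kernel_mean_bounded. Qed.

Let msigma2 j l : measurable_fun setT (sigma2 j l).
Proof. exact: measurable_kernel_mean. Qed.

Let sigma2C j l x : `|sigma2 j l x| <= C * C.
Proof. exact: kernel_mean_bounded (s2C j l) x. Qed.

Let mexc : measurable_fun setT exc.
Proof. by apply: measurable_maxr => //; exact: measurable_funB. Qed.

Let iexc : P.-integrable setT (EFin \o exc).
Proof.
have iB1 := integrableDR (integrable_norm iB)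
  (prob_bounded_integrable P (f := cst t0) (c := `|t0|) (measurable_cst t0) (fun=> lexx _)).
apply: le_integrableR iB1 => // x.
rewrite ger0_norm /exc; last by rewrite le_max lexx orbT.
apply: (@le_trans _ _ (`|B x| + t0)) => //.
rewrite ge_max; apply/andP; split; last by rewrite addr_ge0// ltW.
by rewrite lerD ?ler_norm// (le_trans _ (ltW t0_gt0))// oppr_le0 ltW.
Qed.

Let J := (iid n P \x P)%E.

Lemma fingerprint_integrable : (iid n P).-integrable setT
  (EFin \o (fun x => \sum_(j < k) sigma j x * tau j (tnth x i))).
Proof.
apply: integrable_sumR => j.
have H : (iid n P).-integrable setT (EFin \o (fun x => tau j (tnth x i))).
  apply/(pullback_integrable (measurable_tnth i)
    (ge0_integral_tnth (fun=> P) i) (mtau j)); exact: itau.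
apply: le_integrableR (integrableZR C (integrable_norm H)).
  apply: measurable_funM => //.
  by apply: measurableT_comp => //; exact: measurable_tnth.
by move=> x; rewrite normrM ler_wpM2r.
Qed.

Lemma fingerprint_lam (lam : R) : 0 < lam ->
  \int[iid n P]_x (\sum_(j < k) sigma j x * tau j (tnth x i)) <=
  eps * (lam + lam^-1 * Q) + 2 * delta * t0 + 2 * \int[P]_x exc x.
Proof.
move=> lam0.
pose H1 (z : n.-tuple X * X) := \sum_(j < k) sigma j z.1 * tau j z.2.
pose H2 (z : n.-tuple X * X) :=
  \sum_(j < k) \sum_(l < k) sigma2 j l z.1 * (tau j z.2 * tau l z.2).
pose c := eps * lam + 2 * delta * t0.
pose H z := H1 z + (eps * lam^-1) * H2 z + 2 * exc z.2 + c.
have iH1j j : J.-integrable setT (EFin \o (fun z => sigma j z.1 * tau j z.2)).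
  exact: joint_integrableM (msigma j) (sigmaC j) (itau j).
have iH1 : J.-integrable setT (EFin \o H1) by exact: integrable_sumR.
have iH2jl j l : J.-integrable setT
    (EFin \o (fun z => sigma2 j l z.1 * (tau j z.2 * tau l z.2))).
  exact: (joint_integrableM (msigma2 j l) (sigma2C j l) (itau2 j l)).
have iH2j j : J.-integrable setT (EFin \o (fun z =>
    \sum_(l < k) sigma2 j l z.1 * (tau j z.2 * tau l z.2))).
  exact: integrable_sumR.
have iH2 : J.-integrable setT (EFin \o H2) by exact: integrable_sumR.
have iH3 : J.-integrable setT (EFin \o (fun z => exc z.2)).
  by apply/(pullback_integrable measurable_snd (integral_joint2 n P) mexc).
have ic : J.-integrable setT (EFin \o (cst c)).
  by apply: (prob_bounded_integrable _ (c := `|c|)).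
have iH12 := integrableDR iH1 (integrableZR (eps * lam^-1) iH2).
have iH123 := integrableDR iH12 (integrableZR 2 iH3).
have iH : J.-integrable setT (EFin \o H) by exact: integrableDR iH123 ic.
have mH : measurable_fun setT H by apply/measurable_EFinP; exact: measurable_int iH.
have IH : \int[J]_z H z = eps * (lam + lam^-1 * Q) + 2 * delta * t0 + 2 * \int[P]_x exc x.
  rewrite /H (RintegralD measurableT iH123 ic).
  rewrite (RintegralD measurableT iH12 (integrableZR 2 iH3)).
  rewrite (RintegralD measurableT iH1 (integrableZR _ iH2)).
  rewrite !RintegralZl// prob_Rintegral_cst.
  rewrite -(pullback_Rintegral (integral_joint2 n P) mexc).
  rewrite Rintegral_sum// Rintegral_sum//.
  (* The product law splits each term into a product of integrals, and the factor coming from the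
     centred statistic is 0. *)
  rewrite big1 ?add0r => [|j _]; last first.
    by rewrite (joint_RintegralM (msigma j) (sigmaC j) (itau j)) tau_mean mulr0.
  rewrite [X in eps * lam^-1 * X](_ : _ = Q); first by rewrite /c; ring.
  apply: eq_bigr => j _; rewrite Rintegral_sum//; apply: eq_bigr => l _.
  exact: (joint_RintegralM (msigma2 j l) (sigma2C j l) (itau2 j l)).
rewrite -IH.
rewrite (pullback_Rintegral (integral_joint_swap P i) mH).
have mf : measurable_fun setT (fun x => \sum_(j < k) sigma j x * tau j (tnth x i)).
  by apply/measurable_EFinP; exact: measurable_int fingerprint_integrable.
rewrite (pullback_Rintegral (integral_joint1 P) mf).
(* The pointwise bound holds only for data in S, which is a set of full measure. *)
have mD := measurable_datasets (n := n) mS.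
apply: (@le_Rintegral_conull _ _ _ _ (datasets S `*` S)).
- exact: measurableX.
- by apply: joint_conull => //; exact: iid_datasets_conull.
- by apply/(pullback_integrable measurable_fst (integral_joint1 P) mf); exact: fingerprint_integrable.
- by apply/(pullback_integrable (measurable_joint_swap i) (integral_joint_swap P i) mH).
- move=> [x z] [/= Sx Sz]; apply: le_trans (fingerprint_pointwise lam0 Sx Sz) _.
  by rewrite /H /H1 /H2 /c /joint_swap/= le_eqVlt; apply/orP; left; apply/eqP; ring.
Qed.

Lemma dp_fingerprint :
  \int[iid n P]_x (\sum_(j < k) sigma j x * tau j (tnth x i)) <=
  2 * delta * t0 + 2 * eps * Num.sqrt Q + 2 * \int[P]_x exc x.
Proof.
(* lam = sqrt Q balances lam and Q/lam. If Q <= 0, the square root is 0 by convention, and lam is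
   sent to 0 instead. *)
have [Q0|Q0] := ltP 0 Q.
  have q0 : 0 < Num.sqrt Q by rewrite sqrtr_gt0.
  apply: le_trans (fingerprint_lam q0) _.
  have -> : (Num.sqrt Q)^-1 * Q = Num.sqrt Q.
    by rewrite -[X in _ * X](sqr_sqrtr (ltW Q0)) expr2 mulKf ?gt_eqF.
  by rewrite le_eqVlt; apply/orP; left; apply/eqP; ring.
rewrite ler0_sqrtr// mulr0 addr0; apply/ler_addgt0Pr => e e0.
apply: le_trans (fingerprint_lam e0) _.
have h : e^-1 * Q <= 0 by rewrite pmulr_rle0 ?invr_gt0.
have : eps * (e + e^-1 * Q) <= 1 * e.
  apply: (@le_trans _ _ (eps * e)); first by rewrite ler_wpM2l// gerDl.
  by rewrite ler_wpM2r// ltW.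
lra.
Qed.

End dp_fingerprint.

(** * Families tilted over a box *)

Lemma measurable_Rintegral_param (R : realType) (d1 d2 : measure_display)
    (T1 : measurableType d1) (T2 : measurableType d2)
    (mu : {sigma_finite_measure set T2 -> \bar R}) (f : T1 * T2 -> R) :
  measurable_fun setT f ->
  measurable_fun setT (fun x => \int[mu]_y f (x, y)).
Proof.
move=> mf; rewrite /Rintegral; apply: measurableT_comp => //.
have mfE : measurable_fun setT (EFin \o f) by exact/measurable_EFinP.
under eq_fun do rewrite integralE.
apply: emeasurable_funB.
- rewrite [X in measurable_fun _ X](_ : _ = fubini_F mu (EFin \o f)^\+%E).
    apply: measurable_fun_fubini_tonelli_F; last exact: funepos_ge0.
    exact: measurable_funepos.
  by apply/funext => x; apply: eq_integral => y _; rewrite !funeposE.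
- rewrite [X in measurable_fun _ X](_ : _ = fubini_F mu (EFin \o f)^\-%E).
    apply: measurable_fun_fubini_tonelli_F; last exact: funeneg_ge0.
    exact: measurable_funeneg.
  by apply/funext => x; apply: eq_integral => y _; rewrite !funenegE.
Qed.

Lemma measurable_invr (R : realType) : measurable_fun setT (@GRing.inv R).
Proof.
have -> : [set: R] = [set 0] `|` ~` [set 0] by rewrite setUv.
have m0 : measurable (~` [set (0 : R)]) by exact: measurableC.
apply/measurable_funU => //; split; first exact: measurable_fun_set1.
apply: open_continuous_measurable_fun.
  by apply: closed_openC; exact: closed_eq.
by move=> x /set_mem/= /eqP x0; exact: inv_continuous.
Qed.

Section tilted_family.
Context (R : realType) (d : measure_display) (X : measurableType d) (k : nat).
Variables (nu : probability X R) (T : 'I_k -> X -> R) (m r : 'I_k -> R).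

Definition cbox : set (euclid R k) :=
  [set eta | forall j, `|tnth eta j - m j| <= r j].

Definition tweight (eta : euclid R k) (x : X) : R :=
  expR (\sum_(j < k) (tnth eta j - m j) * T j x).

Definition tmass (eta : euclid R k) : R := \int[nu]_x tweight eta x.

(** An exponential family over a box with base measure and carrier function absorbed into the
    reference probability [nu]. Densities are expressed by their action on nonnegative integrands,
    and nothing is required of [P] outside the box. *)
Definition tilted (P : euclid R k -> probability X R) :=
  forall eta, cbox eta -> nu.-integrable setT (EFin \o tweight eta) /\
    forall f : X -> \bar R, measurable_fun setT f -> (forall x, 0 <= f x)%E ->
    (\int[P eta]_x f x =
     \int[nu]_x (f x * (tweight eta x / tmass eta)%:E))%E.

Hypotheses (mT : forall j, measurable_fun setT (T j))
  (r_ge0 : forall j, 0 <= r j).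

Lemma measurable_tweight2 : measurable_fun setT
  (fun z : euclid R k * X => tweight z.1 z.2).
Proof.
apply: (measurableT_comp (@measurable_expR R)).
apply: measurable_sum => j; apply: measurable_funM; last exact: measurableT_comp.
apply: measurable_funB => //.
exact: (measurableT_comp (measurable_tnth j) measurable_fst).
Qed.

Lemma measurable_tweight eta : measurable_fun setT (tweight eta).
Proof.
apply: (measurableT_comp measurable_tweight2 (g := fun x => (eta, x))).
exact: measurable_fun_pair.
Qed.

Lemma measurable_tmass : measurable_fun setT tmass.
Proof. exact: (measurable_Rintegral_param nu measurable_tweight2). Qed.

Lemma tweight_gt0 eta x : 0 < tweight eta x.
Proof. exact: expR_gt0. Qed.

Lemma tmass_ge0 eta : 0 <= tmass eta.
Proof. by apply: Rintegral_ge0 => x _; exact/ltW/tweight_gt0. Qed.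

Variable P : euclid R k -> probability X R.
Hypothesis P_tilted : tilted P.

Lemma tweight_integrable eta : cbox eta ->
  nu.-integrable setT (EFin \o tweight eta).
Proof. by move=> /P_tilted[]. Qed.

(** If the mass were 0, the convention 1/0 = 0 would make the density of [P eta] vanish,
    contradicting total mass 1. *)
Lemma tmass_gt0 eta : cbox eta -> 0 < tmass eta.
Proof.
move=> beta; rewrite lt_neqAle tmass_ge0 andbT; apply/eqP => L0.
have [_ /(_ (cst 1%E))] := P_tilted beta.
rewrite integral_prob_cst => /(_ (measurable_cst _) (fun=> lee01)).
rewrite -L0; under eq_integral do rewrite invr0 mulr0 mule0.
by rewrite integral0 => /eqP; rewrite onee_eq0.
Qed.

Let density_ge0 eta x : 0 <= tweight eta x / tmass eta.
Proof. by rewrite divr_ge0 ?tmass_ge0// ltW// tweight_gt0. Qed.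

Let mdensity eta : measurable_fun setT (fun x => tweight eta x / tmass eta).
Proof. by apply: measurable_funM => //; exact: measurable_tweight. Qed.

Lemma tilted_Rintegral eta (f : X -> R) : cbox eta -> measurable_fun setT f ->
  \int[P eta]_x f x = \int[nu]_x (f x * (tweight eta x / tmass eta)).
Proof.
move=> beta mf; have [_ H] := P_tilted beta.
exact: (transfer_Rintegral (phi := id) (density_ge0 eta) H).
Qed.

Lemma tilted_integrable eta (f : X -> R) : cbox eta -> measurable_fun setT f ->
  nu.-integrable setT (EFin \o (fun x => f x * tweight eta x)) ->
  (P eta).-integrable setT (EFin \o f).
Proof.
move=> beta mf fi; have [_ H] := P_tilted beta.
apply/(transfer_integrable (phi := id) _ (mdensity eta) (density_ge0 eta) H) => //.
apply: (eq_integrable measurableT) (integrableZR (tmass eta)^-1 fi) => x _ /=.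
by congr EFin; ring.
Qed.

Lemma tilted_RintegralE eta (f : X -> R) : cbox eta -> measurable_fun setT f ->
  nu.-integrable setT (EFin \o (fun x => f x * tweight eta x)) ->
  \int[P eta]_x f x = (\int[nu]_x (f x * tweight eta x)) / tmass eta.
Proof.
move=> beta mf fi; rewrite tilted_Rintegral// -RintegralZr//.
by apply: eq_Rintegral => x _; rewrite mulrA.
Qed.

Definition tcosh j x := expR (r j * T j x) + expR (- r j * T j x).
Definition tbound x := \prod_(j < k) tcosh j x.

Lemma tcosh_ge0 j x : 0 <= tcosh j x.
Proof. by rewrite addr_ge0 ?expR_ge0. Qed.

Definition corner (f : {ffun 'I_k -> bool}) : euclid R k :=
  [tuple m j + (if f j then r j else - r j) | j < k].

Lemma corner_cbox f : cbox (corner f).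
Proof.
move=> j; rewrite tnth_mktuple addrAC subrr add0r.
by case: ifP => _; rewrite ?normrN ger0_norm.
Qed.

(** Expanding the product of the sums of two exponentials gives the weights at the 2^k corners. The
    corners lie in the box, so a single integrable function dominates all weights of the box. *)
Lemma tboundE x : tbound x = \sum_(f : {ffun 'I_k -> bool}) tweight (corner f) x.
Proof.
rewrite /tbound; under eq_bigr => j _.
  have -> : tcosh j x =
      \sum_(b : bool) expR ((if b then r j else - r j) * T j x).
    by rewrite big_bool.
  over.
rewrite bigA_distr_bigA/=; apply: eq_bigr => f _.
rewrite /tweight expR_sum; apply: eq_bigr => j _.
by rewrite tnth_mktuple addrAC subrr add0r.
Qed.

Lemma tbound_integrable : nu.-integrable setT (EFin \o tbound).
Proof.
have -> : tbound = fun x => \sum_(f : {ffun 'I_k -> bool}) tweight (corner f) x.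
  by apply/funext => x; exact: tboundE.
by apply: integrable_sumR => f; apply: tweight_integrable; exact: corner_cbox.
Qed.

Lemma tweightE eta x :
  tweight eta x = \prod_(j < k) expR ((tnth eta j - m j) * T j x).
Proof. by rewrite /tweight expR_sum. Qed.

Lemma tweight_le eta x : cbox eta -> tweight eta x <= tbound x.
Proof.
move=> beta; rewrite tweightE; apply: ler_prod => j _.
by rewrite expR_ge0/= expR_le_cosh.
Qed.

Let tbound_mass := \int[nu]_x tbound x.

Lemma tbound_mass_gt0 : 0 < tbound_mass.
Proof.
have bm : cbox [tuple m j | j < k].
  by move=> j; rewrite tnth_mktuple subrr normr0.
apply: lt_le_trans (tmass_gt0 bm) _; apply: le_Rintegral => //.
- exact: tweight_integrable.
- exact: tbound_integrable.
- by move=> x _; exact: tweight_le.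
Qed.

Lemma tmass_le eta : cbox eta -> tmass eta <= tbound_mass.
Proof.
move=> beta; apply: le_Rintegral => //.
- exact: tweight_integrable.
- exact: tbound_integrable.
- by move=> x _; exact: tweight_le.
Qed.

(* The weights at eta and at its reflection in the centre of the box multiply
   to 1, so AM-GM bounds the two masses from below jointly. *)
Lemma tmass_lower eta : cbox eta -> tbound_mass^-1 <= tmass eta.
Proof.
move=> beta; pose eta' : euclid R k := [tuple 2 * m j - tnth eta j | j < k].
have beta' : cbox eta'.
  move=> j; rewrite tnth_mktuple -normrN (le_trans _ (beta j))//.
  by rewrite le_eqVlt; apply/orP; left; apply/eqP; congr `|_|; ring.
have c0 := tbound_mass_gt0; set c := tbound_mass in c0 *.
have ww x : tweight eta x * tweight eta' x = 1.
  rewrite /tweight -expRD -big_split/= big1 ?expR0// => j _.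
  by rewrite tnth_mktuple; ring.
have i1 := integrableZR c (tweight_integrable beta).
have i2 := integrableZR c^-1 (tweight_integrable beta').
have : 2 <= c * tmass eta + c^-1 * tmass eta'.
  rewrite /tmass -!RintegralZl//; last 2 first.
  - exact: tweight_integrable.
  - exact: tweight_integrable.
  rewrite -RintegralD// -[leLHS](prob_Rintegral_cst nu).
  apply: le_Rintegral => //.
  - by apply: (prob_bounded_integrable nu (c := 2)) => // x; rewrite ger0_norm.
  - exact: integrableDR i1 i2.
  - move=> x _; have := ww x; set a := tweight eta x; set b := tweight eta' x.
    move=> ab; have a0 : 0 < a := tweight_gt0 _ _.
    rewrite -(ler_pM2l (mulr_gt0 c0 a0)).
    have -> : c * a * (c * a + c^-1 * b) = (c * a) ^+ 2 + (a * b) * (c / c) by ring.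
    rewrite ab mulfV ?gt_eqF// mul1r.
    have := sqr_ge0 (c * a - 1); lra.
have : c^-1 * tmass eta' <= 1.
  by rewrite -(ler_pM2l c0) mulVKf ?gt_eqF// mulr1 tmass_le.
move=> h1 h2; rewrite -(ler_pM2l c0) mulfV ?gt_eqF//; lra.
Qed.

Lemma tdom (f c : R) eta j x : cbox eta -> 0 <= f -> 0 <= c ->
  f * expR ((tnth eta j - m j) * T j x) <= c * tcosh j x ->
  f * tweight eta x <= c * tbound x.
Proof.
move=> beta f0 c0 fc; rewrite tweightE /tbound (bigD1 j)//= [X in c * X](bigD1 j)//=.
rewrite !mulrA; apply: ler_pM => //.
- by rewrite mulr_ge0// expR_ge0.
- by apply: prodr_ge0 => l _; rewrite expR_ge0.
- by apply: ler_prod => l _; rewrite expR_ge0/= expR_le_cosh.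
Qed.

Hypothesis T_degenerate : forall j, r j = 0 -> forall x, T j x = 0.
Variable tau : R.
Hypotheses (tau_gt0 : 0 < tau) (tau_lt1 : tau < 1).

Definition ibox : set (euclid R k) :=
  [set eta | forall j, `|tnth eta j - m j| <= (1 - tau) * r j].

Lemma ibox_cbox : ibox `<=` cbox.
Proof.
move=> eta ieta j; apply: le_trans (ieta j) _.
by rewrite ler_piMl// gerBl ltW.
Qed.

Let gap_lt j : r j != 0 -> (1 - tau) * r j < r j.
Proof.
move=> r0; rewrite gtr_pMl ?gtrBl// lt_neqAle eq_sym r0.
exact: r_ge0.
Qed.

Let gapE j : r j - (1 - tau) * r j = tau * r j.
Proof. by ring. Qed.

Lemma tdom1 eta j x : ibox eta ->
  `|T j x| * tweight eta x <= (tau * r j)^-1 * tbound x.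
Proof.
move=> ieta; have beta := ibox_cbox ieta.
apply: (tdom (j := j)) => //; first by rewrite invr_ge0 mulr_ge0// ltW.
(* A degenerate coordinate has no gap to spend; its statistic is identically 0, so the left side
   vanishes. *)
have [r0|r0] := eqVneq (r j) 0.
  by rewrite T_degenerate// normr0 mul0r mulr_ge0 ?tcosh_ge0// invr_ge0 r0 mulr0.
by rewrite mulrC [leRHS]mulrC mulrC -gapE norm_expR_le_cosh// gap_lt.
Qed.

Lemma tdom2 eta j x : ibox eta ->
  T j x ^+ 2 * tweight eta x <= (4 / (tau * r j) ^+ 2) * tbound x.
Proof.
move=> ieta; have beta := ibox_cbox ieta.
have g0 : 0 <= 4 / (tau * r j) ^+ 2 by rewrite divr_ge0// sqr_ge0.
apply: (tdom (j := j)); rewrite ?sqr_ge0//.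
have [r0|r0] := eqVneq (r j) 0.
  by rewrite T_degenerate// expr0n mul0r mulr_ge0 ?tcosh_ge0.
by rewrite [leRHS]mulrC -gapE sqr_expR_le_cosh// gap_lt.
Qed.

Lemma tweightM_integrable (g : X -> R) (c : R) eta : measurable_fun setT g ->
  (forall x, `|g x| <= c) -> cbox eta ->
  nu.-integrable setT (EFin \o (fun x => g x * tweight eta x)).
Proof.
move=> mg gc beta; apply: le_integrableR (integrableZR c (tweight_integrable beta)).
  by apply: measurable_funM => //; exact: measurable_tweight.
by move=> x; rewrite normrM (gtr0_norm (tweight_gt0 _ _)) ler_wpM2r// ltW// tweight_gt0.
Qed.

Lemma tweightMT_integrable (g : X -> R) (c : R) eta j : measurable_fun setT g ->
  (forall x, `|g x| <= c) -> ibox eta ->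
  nu.-integrable setT (EFin \o (fun x => g x * T j x * tweight eta x)).
Proof.
move=> mg gc ieta.
apply: le_integrableR (integrableZR (c * (tau * r j)^-1) tbound_integrable).
  apply: measurable_funM; first exact: measurable_funM.
  exact: measurable_tweight.
move=> x; have c0 : 0 <= c := le_trans (normr_ge0 _) (gc x).
rewrite !normrM (gtr0_norm (tweight_gt0 _ _)) -!mulrA.
apply: ler_pM => //; last exact: tdom1.
by rewrite mulr_ge0// ltW// tweight_gt0.
Qed.

Lemma tweightT_integrable eta j : ibox eta ->
  nu.-integrable setT (EFin \o (fun x => T j x * tweight eta x)).
Proof.
move=> ieta.
apply: (eq_integrable measurableT) (tweightMT_integrable (g := cst 1) (c := 1) j _ _ ieta) => //.
- by move=> x _; rewrite /= mul1r.
- by move=> x; rewrite normr1.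
Qed.

Lemma tweightTT_integrable eta j l : ibox eta ->
  nu.-integrable setT (EFin \o (fun x => T j x * T l x * tweight eta x)).
Proof.
move=> ieta.
apply: le_integrableR (integrableZR (4 / (tau * r j) ^+ 2 + 4 / (tau * r l) ^+ 2) tbound_integrable).
  apply: measurable_funM; first exact: measurable_funM.
  exact: measurable_tweight.
move=> x; rewrite normrM (gtr0_norm (tweight_gt0 _ _)) mulrDl.
apply: le_trans (lerD (tdom2 j x ieta) (tdom2 l x ieta)).
rewrite -mulrDl ler_wpM2r ?(ltW (tweight_gt0 _ _))// normrM.
rewrite -(real_normK (num_real (T j x))) -(real_normK (num_real (T l x))).
have := sqr_ge0 (`|T j x| - `|T l x|).
have := sqr_ge0 (`|T j x| + `|T l x|).
have : 0 <= `|T j x| * `|T l x| by rewrite mulr_ge0.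
lra.
Qed.

(** The mean under [P eta], written through [nu]. This explicit ratio is measurable in [eta] on the
    whole space, while [P] itself is not assumed to depend measurably on [eta]. *)
Definition tmean (f : X -> R) (eta : euclid R k) : R :=
  (\int[nu]_x (f x * tweight eta x)) / tmass eta.

Lemma measurable_tmean (f : X -> R) : measurable_fun setT f ->
  measurable_fun setT (tmean f).
Proof.
move=> mf; apply: measurable_funM.
  apply: (measurable_Rintegral_param nu (f := fun z => f z.2 * tweight z.1 z.2)).
  by apply: measurable_funM; [exact: measurableT_comp|exact: measurable_tweight2].
exact: (measurableT_comp (@measurable_invr R) measurable_tmass).
Qed.

Definition tcov (g : X -> R) j eta : R :=
  tmean (fun x => g x * T j x) eta - tmean g eta * tmean (T j) eta.

Lemma measurable_tcov (g : X -> R) j : measurable_fun setT g ->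
  measurable_fun setT (tcov g j).
Proof.
move=> mg; apply: measurable_funB; first by apply: measurable_tmean; exact: measurable_funM.
by apply: measurable_funM; exact: measurable_tmean.
Qed.

(** One factor [tbound_mass] bounds the numerator, the other one the inverse of the normalizing
    mass. *)
Lemma tmean_le (f : X -> R) (c : R) eta : measurable_fun setT f -> cbox eta ->
  (forall x, `|f x| * tweight eta x <= c * tbound x) ->
  `|tmean f eta| <= c * tbound_mass * tbound_mass.
Proof.
move=> mf beta fc.
have ifw : nu.-integrable setT (EFin \o (fun x => f x * tweight eta x)).
  apply: le_integrableR (integrableZR c tbound_integrable).
    by apply: measurable_funM => //; exact: measurable_tweight.
  by move=> x; rewrite normrM (gtr0_norm (tweight_gt0 _ _)).
have c0 : 0 <= c * tbound_mass.
  rewrite /tbound_mass -RintegralZl//; last exact: tbound_integrable.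
  apply: Rintegral_ge0 => x _; apply: le_trans (fc x).
  by rewrite mulr_ge0// ltW// tweight_gt0.
rewrite /tmean normrM; apply: ler_pM => //.
  apply: le_trans (le_normr_Rintegral measurableT ifw) _.
  rewrite -RintegralZl//; last exact: tbound_integrable.
  apply: le_Rintegral => //.
  - exact: integrable_norm ifw.
  - by apply: integrableZR; exact: tbound_integrable.
  - by move=> x _; rewrite normrM (gtr0_norm (tweight_gt0 _ _)).
rewrite gtr0_norm ?invr_gt0 ?tmass_gt0//.
rewrite -[leRHS]invrK lef_pV2 ?posrE ?tmass_gt0// ?invr_gt0 ?tbound_mass_gt0//.
exact: tmass_lower.
Qed.

Lemma tmean_bounded (g : X -> R) (c : R) eta : measurable_fun setT g ->
  (forall x, `|g x| <= c) -> cbox eta -> `|tmean g eta| <= c.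
Proof.
move=> mg gc beta; have ig := tweightM_integrable mg gc beta.
rewrite /tmean normrM (gtr0_norm (x := _^-1)) ?invr_gt0 ?tmass_gt0//.
rewrite ler_pdivrMr ?tmass_gt0//.
apply: le_trans (le_normr_Rintegral measurableT ig) _.
rewrite /tmass -RintegralZl//; last exact: tweight_integrable.
apply: le_Rintegral => //.
- exact: integrable_norm ig.
- by apply: integrableZR; exact: tweight_integrable.
- move=> x _; rewrite normrM (gtr0_norm (tweight_gt0 _ _)) ler_wpM2r//.
  by rewrite ltW// tweight_gt0.
Qed.

(** Uniformity over the shrunk box is what makes the covariance integrable in [eta], so that the
    coordinates can be integrated one at a time. *)
Lemma tcov_bounded (g : X -> R) (c : R) j : measurable_fun setT g ->
  (forall x, `|g x| <= c) ->
  exists K : R, forall eta, ibox eta -> `|tcov g j eta| <= K.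
Proof.
move=> mg gc; exists (c * (tau * r j)^-1 * tbound_mass * tbound_mass +
  c * ((tau * r j)^-1 * tbound_mass * tbound_mass)) => eta ieta.
have beta := ibox_cbox ieta.
apply: le_trans (ler_normB _ _) _; apply: lerD.
  apply: tmean_le => //; first exact: measurable_funM.
  move=> x; rewrite normrM -!mulrA; apply: ler_pM => //.
    by rewrite mulr_ge0// ltW// tweight_gt0.
  exact: tdom1.
rewrite normrM; apply: ler_pM => //; first exact: tmean_bounded.
by apply: tmean_le => // x; exact: tdom1.
Qed.

Lemma tweight_replace eta j (u : R) x : tweight (replace eta j u) x =
  expR (\sum_(l < k | l != j) (tnth eta l - m l) * T l x) *
  expR ((u - m j) * T j x).
Proof.
rewrite /tweight (bigD1 j)//= tnth_mktuple eqxx expRD mulrC; congr (expR _ * _).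
by apply: eq_bigr => l lj; rewrite tnth_mktuple (negbTE lj).
Qed.

Lemma cbox_replace eta j (u : R) :
  (forall l, l != j -> `|tnth eta l - m l| <= r l) -> `|u - m j| <= r j ->
  cbox (replace eta j u).
Proof.
move=> etal uj l; rewrite tnth_mktuple; case: eqVneq => [->//|lj].
exact: etal.
Qed.

(** Only coordinate j moves; the weights of the other coordinates are frozen into the factor [b] of
    the one-dimensional integration by parts. *)
Lemma tcov_slice (g : X -> R) (c : R) j eta : measurable_fun setT g ->
  (forall x, `|g x| <= c) -> 0 < r j ->
  (forall l, l != j -> `|tnth eta l - m l| <= r l) ->
  let a := (1 - tau) * r j in
  \int[lebesgue_measure]_(u in `[m j - a, m j + a])
    ((r j ^+ 2 - (u - m j) ^+ 2) * tcov g j (replace eta j u)) =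
  (r j ^+ 2 - a ^+ 2) *
    (tmean g (replace eta j (m j + a)) - tmean g (replace eta j (m j - a))) +
  \int[lebesgue_measure]_(u in `[m j - a, m j + a])
    (2 * (u - m j) * tmean g (replace eta j u)).
Proof.
move=> mg gc rj etal a.
pose b x := expR (\sum_(l < k | l != j) (tnth eta l - m l) * T l x).
have mb : measurable_fun setT b.
  apply: (measurableT_comp (@measurable_expR R)).
  rewrite (_ : (fun x => _) = fun x =>
    \sum_(l < k) (if l != j then (tnth eta l - m l) * T l x else 0)).
    apply: measurable_sum => l; case: (l != j) => //.
    exact: measurable_funM.
  by apply/funext => x; rewrite -big_mkcond.
have b0 x : 0 <= b x by exact: expR_ge0.
have a0 : 0 < a by rewrite mulr_gt0// subr_gt0.
have ar : a < r j by apply: gap_lt; rewrite gt_eqF.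
have wE u x : tweight (replace eta j u) x = b x * expR ((u - m j) * T j x).
  exact: tweight_replace.
(* The dominating function is the sum of the two weights at the ends m_j - r_j and m_j + r_j of the
   slice, which still belong to the closed box. *)
have ib : nu.-integrable setT (EFin \o (fun x =>
    b x * (expR (r j * T j x) + expR (- r j * T j x)))).
  have c1 : cbox (replace eta j (m j + r j)).
    by apply: cbox_replace => //; rewrite addrAC subrr add0r ger0_norm.
  have c2 : cbox (replace eta j (m j - r j)).
    by apply: cbox_replace => //; rewrite addrAC subrr add0r normrN ger0_norm.
  apply: (eq_integrable measurableT)
    (integrableDR (tweight_integrable c1) (tweight_integrable c2)) => x _ /=.
  congr EFin; rewrite !wE mulrDr; congr (_ * expR _ + _ * expR _).
    by congr (_ * _); ring.
  by congr (_ * _); ring.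
pose L (u : R) := \int[nu]_x (b x * expR ((u - m j) * T j x)).
pose L1 (u : R) := \int[nu]_x (b x * T j x * expR ((u - m j) * T j x)).
pose N (u : R) := \int[nu]_x (g x * b x * expR ((u - m j) * T j x)).
pose N1 (u : R) := \int[nu]_x (g x * b x * T j x * expR ((u - m j) * T j x)).
have LE u : L u = tmass (replace eta j u).
  by apply: eq_Rintegral => x _; rewrite wE.
have L0 v : `|v - m j| < r j -> 0 < L v.
  by move=> vr; rewrite LE; apply: tmass_gt0; apply: cbox_replace => //; exact: ltW.
have GE u : N u / L u = tmean g (replace eta j u).
  rewrite LE; congr (_ / _).
  by apply: eq_Rintegral => x _; rewrite wE mulrA.
have H := tilt_by_parts (mT j) mb mg b0 gc a0 ar ib L0.
transitivity (\int[lebesgue_measure]_(v in `[m j - a, m j + a])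
  ((r j ^+ 2 - (v - m j) ^+ 2) *
   (N1 v / L v - N v / L v * (L1 v / L v)))).
  apply: eq_Rintegral => u _; congr (_ * _); rewrite GE LE /tcov.
  congr (_ / _ - _ * (_ / _)); apply: eq_Rintegral => x _; rewrite wE; ring.
rewrite [LHS]H -!GE; congr (_ + _).
by apply: eq_Rintegral => u _; rewrite -GE.
Qed.

End tilted_family.

(** * Independent samples from a tilted family *)

Section iid_tilted.
Context (R : realType) (d : measure_display) (X : measurableType d) (k n : nat).
Variables (nu : probability X R) (T : 'I_k -> X -> R) (m r : 'I_k -> R).
Variable P : euclid R k -> probability X R.
Hypotheses (mT : forall j, measurable_fun setT (T j)) (P_tilted : tilted nu T m r P).

Definition sum_stat (j : 'I_k) (x : n.-tuple X) : R := \sum_(i < n) T j (tnth x i).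

Lemma measurable_sum_stat j : measurable_fun setT (sum_stat j).
Proof.
apply: measurable_sum => i.
exact: (measurableT_comp (mT j) (measurable_tnth i)).
Qed.

Lemma tweight_sum_stat eta (x : n.-tuple X) :
  tweight sum_stat m eta x = \prod_(i < n) tweight T m eta (tnth x i).
Proof.
rewrite /tweight -expR_sum exchange_big/=; congr expR.
by apply: eq_bigr => j _; rewrite -mulr_sumr.
Qed.

(** The product of the n weights is the weight of the summed statistic at the same parameter. *)
Lemma iid_tilted : tilted (iid n nu) sum_stat m r (fun eta => iid n (P eta)).
Proof.
move=> eta beta; have [_ H] := P_tilted beta.
have L0 := tmass_gt0 P_tilted beta.
pose q x := tweight T m eta x / tmass nu T m eta.
have mq : measurable_fun setT q.
  by apply: measurable_funM => //; exact: measurable_tweight.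
have q0 x : 0 <= q x by rewrite divr_ge0 ?ltW ?tweight_gt0.
have D := ge0_integral_iid_density (n := n) mq q0 H.
have prodq (x : n.-tuple X) : \prod_(i < n) q (tnth x i) =
    (tmass nu T m eta) ^- n * tweight sum_stat m eta x.
  rewrite tweight_sum_stat /q big_split/= mulrC; congr (_ * _).
  by rewrite prodr_const card_ord exprVn.
have mprod : measurable_fun setT (fun x : n.-tuple X => \prod_(i < n) q (tnth x i)).
  exact: measurable_prod_tnth.
have prod0 (x : n.-tuple X) : 0 <= \prod_(i < n) q (tnth x i) by exact: prodr_ge0.
(* Total mass 1 of the product law identifies the normalizing mass as an n-th power. *)
have int1 : (\int[iid n nu]_x (\prod_(i < n) q (tnth x i))%:E = 1)%E.
  have := D (cst 1%E) (measurable_cst _) (fun=> lee01).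
  rewrite integral_prob_cst => /esym; under eq_integral do rewrite mul1e.
  exact.
have iprod : (iid n nu).-integrable setT
    (EFin \o (fun x => \prod_(i < n) q (tnth x i))).
  apply/integrableP; split; first exact/measurable_EFinP.
  under eq_integral do rewrite gee0_abs ?lee_fin//.
  by rewrite [X in (X < _)%E]int1 ltry.
have wE (x : n.-tuple X) : tweight sum_stat m eta x =
    tmass nu T m eta ^+ n * \prod_(i < n) q (tnth x i).
  by rewrite prodq mulrA mulfV ?mul1r// expf_neq0// gt_eqF.
have mE : tmass (iid n nu) sum_stat m eta = tmass nu T m eta ^+ n.
  rewrite /tmass; under eq_Rintegral do rewrite wE.
  by rewrite RintegralZl// /Rintegral int1 mulr1.
split=> [|f mf f0].
  apply: (eq_integrable measurableT) (integrableZR (tmass nu T m eta ^+ n) iprod).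
  by move=> x _ /=; rewrite wE.
rewrite D//; apply: eq_integral => x _; congr (_ * _%:E)%E.
by rewrite mE prodq mulrC.
Qed.

End iid_tilted.

(** * Averaging over a uniform parameter *)

Section uniform.
Context (R : realType).
Implicit Types (a b c r : R).

Lemma uniform_itv_degenerate a b : b <= a ->
  uniform_itv a b = \d_(a : measurableTypeR R) :> probability _ _.
Proof. by rewrite /uniform_itv; case: pselect => // ab; rewrite leNgt ab. Qed.

Lemma bounded_integrable_itv a b c (f : measurableTypeR R -> R) :
  measurable_fun setT f -> (forall x, a <= x <= b -> `|f x| <= c) ->
  (@lebesgue_measure R).-integrable `[a, b] (EFin \o f).
Proof.
move=> mf fc; apply: measurable_bounded_integrable => //.
- rewrite [X in (X < _)%E](_ : _ = @lebesgue_measure R `[a, b]%classic)//.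
  by rewrite lebesgue_measure_itv/=; case: ifPn => // _; rewrite -EFinB ltry.
- exact: measurable_funTS.
- exists c; split; first exact: num_real.
  by move=> M cM x /=; rewrite in_itv/= => /fc/le_trans; apply; exact: ltW.
Qed.

Lemma Rintegral_uniform a b c (f : measurableTypeR R -> R) : a < b ->
  measurable_fun setT f -> (forall x, a <= x <= b -> `|f x| <= c) ->
  \int[uniform_itv a b]_x f x =
  (b - a)^-1 * \int[lebesgue_measure]_(x in `[a, b]) f x.
Proof.
move=> ab mf fc; rewrite /uniform_itv; case: pselect => // {}ab.
pose q (x : measurableTypeR R) : R := (b - a)^-1 * \1_(`[a, b]%classic : set (measurableTypeR R)) x.
have q0 x : 0 <= q x by rewrite mulr_ge0// invr_ge0 subr_ge0 ltW.
have H (f0 : measurableTypeR R -> \bar R) : measurable_fun setT f0 ->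
    (forall x, 0 <= f0 x)%E ->
    (\int[uniform_prob ab]_x f0 x = \int[lebesgue_measure]_x (f0 (id x) * (q x)%:E))%E.
  move=> mf0 f00; rewrite integral_uniform// -ge0_integralZl//; last 2 first.
  - exact: measurable_funTS.
  - by rewrite lee_fin invr_ge0 subr_ge0 ltW.
  rewrite integral_mkcond; apply: eq_integral => x _.
  rewrite patchE /q indicE; case: ifPn => _; rewrite ?mulr1 ?mulr0 ?mule0//.
  by rewrite muleC.
rewrite (transfer_Rintegral q0 H)//.
rewrite -RintegralZl//; last exact: (bounded_integrable_itv mf fc).
rewrite [RHS]Rintegral_mkcond; apply: eq_Rintegral => x _.
rewrite patchE /q indicE; case: ifPn => _; rewrite ?mulr1 ?mulr0//.
by rewrite mulrC.
Qed.

Lemma uniform_itv_conull a b : a <= b ->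
  uniform_itv a b (~` (`[a, b]%classic : set (measurableTypeR R))) = 0%E.
Proof.
move=> ab; have mI : measurable (`[a, b]%classic : set (measurableTypeR R)) by exact: measurable_itv.
rewrite /uniform_itv; case: pselect => [ab'|nab].
  rewrite /= /uniform_prob integral_mkcond integral0_eq// => x _.
  rewrite patchE /uniform_pdf; case: ifPn => // /set_mem/= /negP.
  by rewrite in_itv/= => /negbTE ->.
rewrite /= diracE memNset//= => H; apply: H; rewrite in_itv/= lexx.
by [].
Qed.

Lemma Rintegral_dirac (d : measure_display) (X : measurableType d) (x : X) (f : X -> R) :
  measurable_fun setT f -> \int[\d_x]_y f y = f x.
Proof.
move=> mf; rewrite /Rintegral integral_dirac//; last exact/measurable_EFinP.
by rewrite diracT mul1e.
Qed.

Lemma uniform_variance c r : 0 <= r ->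
  \int[uniform_itv (c - r) (c + r)]_u ((u - c) ^+ 2) = r ^+ 2 / 3.
Proof.
rewrite le_eqVlt => /orP[/eqP <-|r0].
  rewrite subr0 addr0 uniform_itv_degenerate// Rintegral_dirac.
    by rewrite subrr expr0n mul0r.
  apply: measurable_funX; exact: measurable_funB.
have ab : c - r < c + r by lra.
rewrite (Rintegral_uniform (c := r ^+ 2))//; last 2 first.
- apply: measurable_funX; exact: measurable_funB.
- move=> u; rewrite -ler_distl => ur.
  by rewrite normrX ler_pXn2r// nnegrE// ltW.
pose F (u : R) := (u - c) ^+ 3 / 3.
have dF (u : R) : is_derive u (1 : R) F ((u - c) ^+ 2).
  have -> : F = (3^-1) \*: ((id - cst c) * (id - cst c) * (id - cst c)).
    apply/funext => w.
    transitivity (3^-1 * ((w - c) * (w - c) * (w - c))); last by [].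
    by rewrite /F; field.
  apply: is_derive_eq.
  rewrite /GRing.scale/=.
  by rewrite !fctE; field.
have cts (u : R) : {for u, continuous F}.
  by apply: differentiable_continuous; apply/derivable1_diffP; have [] := dF u.
rewrite /Rintegral (continuous_FTC2 (F := F))//.
- by rewrite /F/=; field; rewrite gt_eqF; lra.
- apply: continuous_subspaceT => u.
  apply: (@continuous_comp _ _ _ (fun v : R => v - c) (fun v : R => v ^+ 2)).
    by apply: cvgB; [exact: cvg_id|exact: cvg_cst].
  exact: exprn_continuous.
- split.
  + by move=> u _; have [] := dF u.
  + by apply: cvg_at_right_filter; exact: cts.
  + by apply: cvg_at_left_filter; exact: cts.
- by move=> u _; rewrite derive1E; apply: derive_val.
Qed.

(** The shrunk interval occupies the fraction 1 - tau of a proper interval, and carries all the mass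
    if the interval is a point. *)
Lemma uniform_inner_mass c r (tau a : R) : 0 <= r -> 0 < tau -> tau < 1 ->
  a = (1 - tau) * r ->
  1 - tau <= \int[uniform_itv (c - r) (c + r)]_u
    (\1_(`[c - a, c + a]%classic : set (measurableTypeR R)) u).
Proof.
move=> r0 t0 t1 aE.
have a0 : 0 <= a by rewrite aE mulr_ge0// subr_ge0 ltW.
have mI : measurable (`[c - a, c + a]%classic : set (measurableTypeR R)) by exact: measurable_itv.
have mf : measurable_fun setT
    (\1_(`[c - a, c + a]%classic : set (measurableTypeR R)) : _ -> R).
  exact: measurable_indic.
move: r0; rewrite le_eqVlt => /orP[/eqP r0|r0].
  rewrite -r0 subr0 addr0 uniform_itv_degenerate// Rintegral_dirac//.
  rewrite indicE mem_set; first by rewrite gerBl ltW.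
  by rewrite /= in_itv/= gerBl lerDl a0.
have ab : c - r < c + r by lra.
have ar : a <= r by rewrite aE ler_piMl ?(ltW r0)// gerBl ltW.
rewrite (Rintegral_uniform (c := 1))//; last first.
  by move=> u _; rewrite indicE; case: (_ \in _); rewrite ?normr1 ?normr0.
have -> : \int[lebesgue_measure]_(x in `[c - r, c + r])
    (\1_(`[c - a, c + a]%classic : set (measurableTypeR R)) x) = 2 * a.
  rewrite /Rintegral integral_indic//.
  have -> : (`[c - a, c + a] `&` `[c - r, c + r])%classic =
      `[c - a, c + a]%classic :> set R.
    apply/setIidPl => x /=; rewrite !in_itv/= => /andP[x1 x2].
    by apply/andP; split; lra.
  rewrite [X in fine X](_ : _ = @lebesgue_measure R `[c - a, c + a]%classic)//.
  rewrite lebesgue_measure_itv/= lte_fin.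
  case: ltP => h /=; first by ring.
  have a00 : a = 0 by lra.
  by rewrite a00 mulr0.
rewrite le_eqVlt; apply/orP; left; apply/eqP; rewrite aE; field.
by rewrite gt_eqF//; lra.
Qed.

End uniform.

Lemma integral_resample_prod (R : realType) (d : measure_display)
    (X : measurableType d) (n : nat) (Q : 'I_n -> probability X R) (i : 'I_n)
    (f : n.-tuple X -> \bar R) :
  measurable_fun setT f -> (forall x, 0 <= f x)%E ->
  (\int[product_prob Q]_x f x =
   \int[(product_prob Q \x Q i)]_z f (replace z.1 i z.2))%E.
Proof.
move=> mf f0; rewrite (ge0_integral_resample Q i mf f0) fubini_tonelli1//.
by apply: measurableT_comp => //; exact: measurable_replace.
Qed.

Lemma Rintegral_resample (R : realType) (d : measure_display)
    (X : measurableType d) (n : nat) (Q : 'I_n -> probability X R) (i : 'I_n)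
    (F : n.-tuple X -> R) (c : R) :
  measurable_fun setT F -> (forall x, `|F x| <= c) ->
  \int[product_prob Q]_x F x =
  \int[product_prob Q]_x \int[Q i]_y F (replace x i y).
Proof.
move=> mF Fc; have mr := measurable_replace (T := X) i.
rewrite (pullback_Rintegral (integral_resample_prod Q i))//.
have iF : (product_prob Q \x Q i)%E.-integrable setT
    (EFin \o (fun z => F (replace z.1 i z.2))).
  apply: prob_bounded_integrable (fun z => Fc _).
  exact: measurableT_comp.
rewrite /Rintegral -(integral12_prod_meas1 iF); congr fine.
apply: eq_integral => x _; rewrite /fubini_F/= fineK//.
apply: (integrable_fin_num measurableT).
apply: (@prob_bounded_integrable _ _ _ (Q i) (fun y => F (replace x i y)) c) => //.
apply: measurableT_comp => //.
apply: (measurableT_comp mr (g := fun y : X => (x, y))).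
exact: measurable_fun_pair.
Qed.

(** * Integration by parts averaged over the box *)

Section box_by_parts.
Context (R : realType) (d : measure_display) (X : measurableType d) (k : nat).
Variables (nu : probability X R) (T : 'I_k -> X -> R) (m r : 'I_k -> R).
Variable P : euclid R k -> probability X R.
Hypotheses (mT : forall j, measurable_fun setT (T j)) (r_ge0 : forall j, 0 <= r j)
  (P_tilted : tilted nu T m r P)
  (T_degenerate : forall j, r j = 0 -> forall x, T j x = 0).
Variable tau : R.
Hypotheses (tau_gt0 : 0 < tau) (tau_lt1 : tau < 1).
Variables (g : X -> R) (j : 'I_k).
Hypotheses (mg : measurable_fun setT g) (g_le : forall x, `|g x| <= r j).

Definition sides (l : 'I_k) : probability (measurableTypeR R) R :=
  uniform_itv (m l - r l) (m l + r l).

Let B := ibox m r tau.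

Lemma measurable_ibox : measurable B.
Proof.
rewrite /B (_ : ibox m r tau = [set eta : euclid R k | forall l,
    (`[m l - (1 - tau) * r l, m l + (1 - tau) * r l]%classic : set (measurableTypeR R))
    (tnth eta l)]).
  apply: (measurable_product_set (S := fun l =>
    (`[m l - (1 - tau) * r l, m l + (1 - tau) * r l]%classic : set (measurableTypeR R)))).
  by move=> l; exact: measurable_itv.
by apply/seteqP; split => eta /= H l; have := H l; rewrite /= in_itv/= ler_distl.
Qed.

Let w (eta : euclid R k) : R := r j ^+ 2 - (tnth eta j - m j) ^+ 2.

Lemma ibox_weight eta : cbox m r eta -> 0 <= w eta <= r j ^+ 2.
Proof.
move=> beta; have := beta j; rewrite -(ler_pXn2r (n := 2))// ?nnegrE// => h.
rewrite real_normK ?num_real// in h.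
by rewrite /w subr_ge0 h/= gerBl sqr_ge0.
Qed.

Let f1 (eta : euclid R k) : R := w eta * tcov nu T m g j eta.
Let f2 (eta : euclid R k) : R := 2 * (tnth eta j - m j) * tmean nu T m g eta.

Let mcoord : measurable_fun setT (fun eta : euclid R k => tnth eta j - m j).
Proof. by apply: measurable_funB => //; exact: measurable_tnth. Qed.

Let mf1 : measurable_fun setT f1.
Proof.
apply: measurable_funM; last exact: measurable_tcov.
by apply: measurable_funB => //; exact: measurable_funX.
Qed.

Let mf2 : measurable_fun setT f2.
Proof.
apply: measurable_funM; last exact: measurable_tmean.
exact: measurable_funM.
Qed.

Lemma by_parts_bounded1 : exists K, forall eta, B eta -> `|f1 eta| <= K.
Proof.
have [K HK] := tcov_bounded mT r_ge0 P_tilted T_degenerate tau_gt0 j mg g_le.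
exists (r j ^+ 2 * K) => eta Beta; rewrite normrM; apply: ler_pM => //; last exact: HK.
have /andP[w0 w1] := ibox_weight (ibox_cbox r_ge0 tau_gt0 Beta).
by rewrite ger0_norm.
Qed.

Lemma by_parts_bounded2 eta : cbox m r eta -> `|f2 eta| <= 2 * r j ^+ 2.
Proof.
move=> beta; have h1 := beta j.
have h2 := tmean_bounded mT P_tilted mg g_le beta.
rewrite /f2 normrM [X in X * _]normrM (ger0_norm (x := 2))// -mulrA expr2.
by rewrite ler_pM2l//; exact: ler_pM.
Qed.

(** Resampling coordinate j reduces the claim to one slice. There only the boundary term is lost:
    with a = (1 - tau) r_j and |g| <= r_j it is at most (r_j^2 - a^2) 2 r_j, divided by the length 2
    r_j of the side, and r_j^2 - a^2 <= 2 tau r_j^2. *)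
Lemma by_parts_box :
  \int[product_prob sides]_eta (\1_B eta * f1 eta) >=
  \int[product_prob sides]_eta (\1_B eta * f2 eta) - 2 * tau * r j ^+ 2.
Proof.
have [K1 HK1] := by_parts_bounded1.
have mB : measurable_fun setT (\1_B : euclid R k -> R).
  by apply: measurable_indic; exact: measurable_ibox.
have bd (f : euclid R k -> R) (K : R) : (forall eta, B eta -> `|f eta| <= K) -> 0 <= K ->
    forall eta, `|\1_B eta * f eta| <= K.
  move=> fK K0 eta; rewrite indicE; case: (boolP (eta \in B)) => [|_].
    by rewrite inE => /fK; rewrite mul1r.
  by rewrite mul0r normr0.
have K10 : 0 <= K1.
  apply: le_trans (normr_ge0 _) (HK1 [tuple m l | l < k] _) => l.
  rewrite tnth_mktuple subrr normr0 mulr_ge0// subr_ge0 ltW//.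
have r20 : 0 <= 2 * r j ^+ 2 by rewrite mulr_ge0// sqr_ge0.
have b1 := bd f1 K1 HK1 K10.
have b2 := bd f2 (2 * r j ^+ 2) (fun eta Be => by_parts_bounded2 (ibox_cbox r_ge0 tau_gt0 Be)) r20.
have i1 := prob_bounded_integrable (product_prob sides) (measurable_funM mB mf1) b1.
have i2 := prob_bounded_integrable (product_prob sides) (measurable_funM mB mf2) b2.
rewrite lerBlDr -lerBlDl -RintegralB//.
pose F eta := \1_B eta * f2 eta - \1_B eta * f1 eta.
have mF : measurable_fun setT F.
  by apply: measurable_funB; exact: measurable_funM.
have bF eta : `|F eta| <= 2 * r j ^+ 2 + K1.
  by apply: le_trans (ler_normB _ _) _; exact: lerD.
rewrite -/(F _) (Rintegral_resample sides j mF bF).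
have mrep eta : measurable_fun setT
    (fun u : measurableTypeR R => replace eta j u).
  apply: (measurableT_comp (measurable_replace (T := measurableTypeR R) j)
    (g := fun u : measurableTypeR R => (eta, u))).
  exact: measurable_fun_pair.
have inner eta : \int[sides j]_u F (replace eta j u) <= 2 * tau * r j ^+ 2.
  have FE u : F (replace eta j u) =
      \1_B (replace eta j u) * (f2 (replace eta j u) - f1 (replace eta j u)).
    by rewrite /F mulrBr.
  have rhs0 : 0 <= 2 * tau * r j ^+ 2.
    by rewrite mulr_ge0 ?sqr_ge0// mulr_ge0// ltW.
  (* The slice contributes nothing when the side is a point, where the weight and eta_j - m_j both
     vanish, or when another coordinate lies outside the shrunk box. *)
  have zero : (forall u, F (replace eta j u) = 0) ->
      \int[sides j]_u F (replace eta j u) <= 2 * tau * r j ^+ 2.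
    by move=> F0; under eq_Rintegral do rewrite F0; rewrite prob_Rintegral_cst.
  have [rj0|rj0] := eqVneq (r j) 0.
    apply: zero => u; rewrite FE indicE; case: (boolP (_ \in _)) => [|_]; last by rewrite mul0r.
    rewrite inE => /(_ j); rewrite rj0 mulr0 normr_le0 => /eqP e.
    by rewrite /f1 /f2 /w e rj0 !mulr0 !mul0r expr0n/= subrr mul0r subrr mulr0.
  have rj : 0 < r j by rewrite lt_neqAle eq_sym rj0 r_ge0.
  have [etal|netal] := pselect
    (forall l, l != j -> `|tnth eta l - m l| <= (1 - tau) * r l); last first.
    apply: zero => u; rewrite FE indicE memNset ?mul0r// => Bu; apply: netal => l lj.
    by have := Bu l; rewrite tnth_mktuple (negbTE lj).
  set a := (1 - tau) * r j.
  have a0 : 0 <= a by rewrite mulr_ge0// subr_ge0 ltW.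
  have ar : a <= r j by rewrite ler_piMl// gerBl ltW.
  have BE u : B (replace eta j u) <-> `|u - m j| <= a.
    split=> [/(_ j)|ua l]; first by rewrite tnth_mktuple eqxx.
    by rewrite tnth_mktuple; case: eqVneq => [->//|lj]; exact: etal.
  have ab : m j - r j < m j + r j by lra.
  rewrite /sides (Rintegral_uniform (c := 2 * r j ^+ 2 + K1) ab) //; last first.
    exact: measurableT_comp.
  have -> : \int[lebesgue_measure]_(x in `[m j - r j, m j + r j]) F (replace eta j x) =
      \int[lebesgue_measure]_(x in `[m j - a, m j + a])
        (f2 (replace eta j x) - f1 (replace eta j x)).
    rewrite Rintegral_mkcond [RHS]Rintegral_mkcond; apply: eq_Rintegral => u _.
    rewrite !patchE FE indicE; case: (boolP (u \in `[m j - a, m j + a]%classic)) => ua.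
      rewrite (mem_set (A := B)) ?mul1r.
        rewrite mem_set//=; move: ua; rewrite inE/= !in_itv/= => /andP[? ?].
        by apply/andP; split; lra.
      by apply/BE; move: ua; rewrite inE/= in_itv/= -ler_distl.
    rewrite (memNset (A := B)) ?mul0r; first by case: ifP.
    move/BE; rewrite ler_distl => h; move/negP: ua; apply.
    by rewrite inE /= in_itv.
  have mf1r : measurable_fun setT (fun u : measurableTypeR R => f1 (replace eta j u)).
    exact: measurableT_comp.
  have mf2r : measurable_fun setT (fun u : measurableTypeR R => f2 (replace eta j u)).
    exact: measurableT_comp.
  have if1 : (@lebesgue_measure R).-integrable `[m j - a, m j + a]
      (EFin \o (fun u => f1 (replace eta j u))).
    by apply: (bounded_integrable_itv (c := K1)) => // u; rewrite -ler_distl => /BE/HK1.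
  have if2 : (@lebesgue_measure R).-integrable `[m j - a, m j + a]
      (EFin \o (fun u => f2 (replace eta j u))).
    apply: (bounded_integrable_itv (c := 2 * r j ^+ 2)) => // u; rewrite -ler_distl => /BE Bu.
    by apply: by_parts_bounded2; exact: (ibox_cbox r_ge0 tau_gt0 Bu).
  rewrite RintegralB//.
  have etalr l : l != j -> `|tnth eta l - m l| <= r l.
    by move=> /etal/le_trans; apply; rewrite ler_piMl// gerBl ltW.
  have := tcov_slice mT r_ge0 P_tilted tau_gt0 tau_lt1 mg g_le rj etalr.
  cbv zeta; rewrite -/a.
  have -> : \int[lebesgue_measure]_(u in `[m j - a, m j + a])
      ((r j ^+ 2 - (u - m j) ^+ 2) * tcov nu T m g j (replace eta j u)) =
      \int[lebesgue_measure]_(u in `[m j - a, m j + a]) f1 (replace eta j u).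
    by apply: eq_Rintegral => u _; rewrite /f1 /w tnth_mktuple eqxx.
  have -> : \int[lebesgue_measure]_(u in `[m j - a, m j + a])
      (2 * (u - m j) * tmean nu T m g (replace eta j u)) =
      \int[lebesgue_measure]_(u in `[m j - a, m j + a]) f2 (replace eta j u).
    by apply: eq_Rintegral => u _; rewrite /f2 tnth_mktuple eqxx.
  move=> ->.
  have cb u : `|u - m j| <= a -> cbox m r (replace eta j u).
    by move=> /BE Bu; exact: (ibox_cbox r_ge0 tau_gt0 Bu).
  have G1 : `|tmean nu T m g (replace eta j (m j + a))| <= r j.
    apply: (tmean_bounded mT P_tilted mg g_le); apply: cb.
    by rewrite addrAC subrr add0r ger0_norm.
  have G2 : `|tmean nu T m g (replace eta j (m j - a))| <= r j.
    apply: (tmean_bounded mT P_tilted mg g_le); apply: cb.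
    by rewrite addrAC subrr add0r normrN ger0_norm.
  move: G1 G2; move: (tmean nu T m g (replace eta j (m j + a)))
    (tmean nu T m g (replace eta j (m j - a))) => x1 x2.
  rewrite !ler_norml => /andP[G1 G1'] /andP[G2 G2'].
  move: (\int[lebesgue_measure]_(u in `[m j - a, m j + a]) f2 (replace eta j u)) => z.
  have -> : m j + r j - (m j - r j) = 2 * r j by ring.
  have -> : z - ((r j ^+ 2 - a ^+ 2) * (x1 - x2) + z) =
      (r j ^+ 2 - a ^+ 2) * (x2 - x1) by ring.
  have ra : 0 <= r j ^+ 2 - a ^+ 2.
    by rewrite subr_ge0 ler_pXn2r// nnegrE.
  rewrite mulrC ler_pdivrMr ?mulr_gt0//.
  apply: (@le_trans _ _ ((r j ^+ 2 - a ^+ 2) * (2 * r j))).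
    by rewrite ler_wpM2l//; lra.
  rewrite ler_wpM2r ?mulr_ge0//.
  have -> : r j ^+ 2 - a ^+ 2 = 2 * tau * r j ^+ 2 - (tau * r j) ^+ 2.
    by rewrite /a; ring.
  by rewrite gerBl sqr_ge0.
rewrite -[leRHS](prob_Rintegral_cst (product_prob sides)).
apply: le_Rintegral => //.
- apply: (prob_bounded_integrable _ (c := 2 * r j ^+ 2 + K1)) => [|eta].
    apply: (measurable_Rintegral_param (sides j)
      (f := fun z : euclid R k * measurableTypeR R => F (replace z.1 j z.2))).
    apply: measurableT_comp => //; exact: measurable_replace.
  apply: prob_bounded_Rintegral => //; exact: measurableT_comp.
- exact: (prob_bounded_integrable _ (c := `|2 * tau * r j ^+ 2|)).
Qed.

End box_by_parts.

(** * Private mechanisms on a tilted family *)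

Lemma measurable_sqrt (R : realType) : measurable_fun setT (@Num.sqrt R).
Proof. by apply: continuous_measurable_fun; exact: sqrt_continuous. Qed.

(** Cauchy-Schwarz, obtained by expanding the nonnegative double sum of (|a_j| - |a_l|)^2. *)
Lemma sum_norm_le_sqrt (R : rcfType) (k : nat) (a : 'I_k -> R) :
  \sum_(j < k) `|a j| <= Num.sqrt k%:R * Num.sqrt (\sum_(j < k) a j ^+ 2).
Proof.
have s0 : 0 <= \sum_(j < k) `|a j| by apply: sumr_ge0.
rewrite -(ger0_norm s0) -sqrtr_sqr -sqrtrM ?ler0n// ler_sqrt; last first.
  by rewrite mulr_ge0// sumr_ge0// => j _; exact: sqr_ge0.
have : 0 <= \sum_(j < k) \sum_(l < k) (`|a j| - `|a l|) ^+ 2.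
  by apply: sumr_ge0 => j _; apply: sumr_ge0 => l _; exact: sqr_ge0.
have -> : \sum_(j < k) \sum_(l < k) (`|a j| - `|a l|) ^+ 2 =
    2 * (k%:R * \sum_(j < k) a j ^+ 2) - 2 * (\sum_(j < k) `|a j|) ^+ 2.
  have e1 : \sum_(j < k) \sum_(l < k) `|a j| ^+ 2 = k%:R * \sum_(j < k) a j ^+ 2.
    rewrite mulr_sumr; apply: eq_bigr => j _.
    by rewrite sumr_const card_ord real_normK ?num_real// mulr_natl.
  have e2 : \sum_(j < k) \sum_(l < k) `|a j| * `|a l| = (\sum_(j < k) `|a j|) ^+ 2.
    by rewrite expr2 big_distrl/=; apply: eq_bigr => j _; rewrite big_distrr.
  rewrite mulr2n mulrDl mul1r -{1}e1 -{1}e1 [X in _ + X - _]exchange_big/=.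
  rewrite -e2 -big_split/= mulr_sumr -sumrB; apply: eq_bigr => j _.
  rewrite -big_split/= mulr_sumr -sumrB; apply: eq_bigr => l _.
  by ring.
lra.
Qed.

Section private_tilted.
Context (R : realType) (d : measure_display) (X : measurableType d) (k n : nat).
Variables (nu : probability X R) (T : 'I_k -> X -> R) (m r : 'I_k -> R).
Variable P : euclid R k -> probability X R.
Hypotheses (mT : forall j, measurable_fun setT (T j)) (r_ge0 : forall j, 0 <= r j)
  (P_tilted : tilted nu T m r P)
  (T_degenerate : forall j, r j = 0 -> forall x, T j x = 0).
Variables (S : set X) (M : R.-pker (n.-tuple X) ~> (euclid R k)) (eps delta : R).
Hypotheses (mS : measurable S) (P_S : forall eta, cbox m r eta -> P eta (~` S) = 0%E)
  (eps_ge0 : 0 <= eps) (eps_le1 : eps <= 1)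
  (delta_ge0 : 0 <= delta) (M_dp : dp eps delta S M).
Variables (t0 b : R).
Hypotheses (t0_gt0 : 0 < t0) (b_ge : forall j, 2 * r j ^+ 3 <= b).

(** Clipping bounds the output everywhere, also for datasets outside S, and changes nothing for
    outputs in the box. *)
Definition clip j (y : euclid R k) : R := Num.max (- r j) (Num.min (r j) (tnth y j)).

Lemma measurable_clip j : measurable_fun setT (clip j).
Proof.
apply: measurable_maxr => //; apply: measurable_minr => //.
exact: measurable_tnth.
Qed.

Lemma clip_bounded j y : `|clip j y| <= r j.
Proof.
rewrite ler_norml /clip le_max lexx/= ge_max ge_min lexx/= andbT.
by have := r_ge0 j; lra.
Qed.

Lemma clip_id j y : `|tnth y j| <= r j -> clip j y = tnth y j.
Proof.
by rewrite ler_norml /clip => /andP[y1 y2]; rewrite (min_idPr y2) (max_idPr y1).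
Qed.

Let g j := kernel_mean M (clip j).

Let mg j : measurable_fun setT (g j).
Proof. exact: measurable_kernel_mean (measurable_clip j). Qed.

Let g_le j x : `|g j x| <= r j.
Proof. exact: kernel_mean_bounded (measurable_clip j) (clip_bounded j) x. Qed.

Definition sweight (eta : euclid R k) j : R := r j ^+ 2 - (tnth eta j - m j) ^+ 2.

Definition score (eta : euclid R k) j (y : euclid R k) : R :=
  sweight eta j * (clip j y - (tnth eta j - m j)).

Lemma measurable_score eta j : measurable_fun setT (score eta j).
Proof. by apply: measurable_funM => //; apply: measurable_funB => //; exact: measurable_clip. Qed.

Lemma sweight_bounds eta j : cbox m r eta -> 0 <= sweight eta j <= r j ^+ 2.
Proof. exact: ibox_weight. Qed.

Lemma score_bounded eta j y : cbox m r eta -> `|score eta j y| <= b.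
Proof.
move=> beta; apply: le_trans (b_ge j); have /andP[w0 w1] := sweight_bounds j beta.
rewrite /score normrM (ger0_norm w0).
have -> : 2 * r j ^+ 3 = r j ^+ 2 * (r j + r j) by ring.
apply: ler_pM => //; apply: le_trans (ler_normB _ _) _.
by apply: lerD; [exact: clip_bounded|exact: beta].
Qed.

Definition cstat (eta : euclid R k) j (x : X) : R := T j x - tmean nu T m (T j) eta.

(** A bound on |<s, T - mu>| that is uniform in the output of the mechanism: every score is at most
    [b], and sqrt(k) comes from comparing the l1 and l2 norms of T - mu. *)
Definition stat_dev (eta : euclid R k) (x : X) : R :=
  b * Num.sqrt k%:R * Num.sqrt (\sum_(j < k) cstat eta j x ^+ 2).

Definition excess (eta : euclid R k) (x : X) : R := Num.max (stat_dev eta x - t0) 0.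

Definition quad_score (eta : euclid R k) : R := \sum_(j < k) \sum_(l < k)
  (\int[iid n (P eta)]_x kernel_mean M (fun y => score eta j y * score eta l y) x) *
  (\int[P eta]_x (cstat eta j x * cstat eta l x)).

Variable tau : R.
Hypotheses (tau_gt0 : 0 < tau) (tau_lt1 : tau < 1).
Let B := ibox m r tau.

Section interior_parameter.
Variable eta : euclid R k.
Hypothesis ieta : B eta.

Let beta : cbox m r eta := ibox_cbox r_ge0 tau_gt0 ieta.

Lemma measurable_cstat j : measurable_fun setT (cstat eta j).
Proof. exact: measurable_funB. Qed.

Lemma stat_integrable j : (P eta).-integrable setT (EFin \o T j).
Proof.
apply: (tilted_integrable mT P_tilted beta) => //.
exact: (tweightT_integrable mT r_ge0 P_tilted T_degenerate tau_gt0).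
Qed.

Lemma stat_mean j : \int[P eta]_x T j x = tmean nu T m (T j) eta.
Proof.
rewrite (tilted_RintegralE P_tilted beta)//.
exact: (tweightT_integrable mT r_ge0 P_tilted T_degenerate tau_gt0).
Qed.

Let icst (c : R) : (P eta).-integrable setT (EFin \o cst c).
Proof. exact: (prob_bounded_integrable _ (c := `|c|)). Qed.

Lemma cstat_integrable j : (P eta).-integrable setT (EFin \o cstat eta j).
Proof. exact: (integrableB measurableT (stat_integrable j) (icst _)). Qed.

Lemma cstat_mean j : \int[P eta]_x cstat eta j x = 0.
Proof.
rewrite (RintegralB measurableT (stat_integrable j) (icst _)).
by rewrite prob_Rintegral_cst stat_mean subrr.
Qed.

Lemma cstat2_integrable j l :
  (P eta).-integrable setT (EFin \o (fun x => cstat eta j x * cstat eta l x)).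
Proof.
set a := tmean nu T m (T j) eta; set c := tmean nu T m (T l) eta.
have iTT : (P eta).-integrable setT (EFin \o (fun x => T j x * T l x)).
  apply: (tilted_integrable mT P_tilted beta); first exact: measurable_funM.
  exact: (tweightTT_integrable mT r_ge0 P_tilted T_degenerate tau_gt0).
have := integrableDR (integrableDR iTT (integrableZR (- c) (stat_integrable j)))
  (integrableDR (integrableZR (- a) (stat_integrable l)) (icst (a * c))).
apply: eq_integrable => // x _ /=; congr EFin.
by rewrite /cstat -/a -/c; ring.
Qed.

Lemma b_ge0 (j : 'I_k) : 0 <= b.
Proof. by apply: le_trans (b_ge j); rewrite mulr_ge0// exprn_ge0. Qed.

Lemma measurable_stat_dev : measurable_fun setT (stat_dev eta).
Proof.
apply: measurable_funM => //; apply: (measurableT_comp (@measurable_sqrt R)).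
by apply: measurable_sum => j; apply: measurable_funX; exact: measurable_cstat.
Qed.

Lemma stat_dev_integrable : (P eta).-integrable setT (EFin \o stat_dev eta).
Proof.
have i2 : (P eta).-integrable setT (EFin \o (fun x => \sum_(j < k) cstat eta j x ^+ 2)).
  apply: integrable_sumR => j; under eq_fun do rewrite expr2.
  exact: cstat2_integrable.
have := integrableZR (`|b| * Num.sqrt k%:R) (integrableDR (icst 1) i2).
apply: le_integrableR; first exact: measurable_stat_dev.
move=> x; set s := \sum_(j < k) _.
have s0 : 0 <= s by apply: sumr_ge0 => j _; exact: sqr_ge0.
rewrite /stat_dev -/s !normrM !(ger0_norm (sqrtr_ge0 _)).
rewrite ler_wpM2l ?mulr_ge0 ?sqrtr_ge0//=.
have := sqr_ge0 (Num.sqrt s - 2^-1); have := sqr_sqrtr s0; nra.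
Qed.

Lemma score_cstat_le x y :
  `|\sum_(j < k) score eta j y * cstat eta j x| <= stat_dev eta x.
Proof.
apply: le_trans (ler_norm_sum _ _ _) _.
apply: (@le_trans _ _ (b * \sum_(j < k) `|cstat eta j x|)).
  rewrite mulr_sumr; apply: ler_sum => j _; rewrite normrM ler_wpM2r//.
  exact: score_bounded.
rewrite /stat_dev -mulrA; case: (posnP k) => [k0|k0]; last first.
  by apply: ler_wpM2l; [exact: (b_ge0 (Ordinal k0))|exact: sum_norm_le_sqrt].
rewrite big1 ?mulr0; last by case=> j jk; exfalso; rewrite k0 in jk.
have -> : k%:R = 0 :> R by rewrite k0.
by rewrite sqrtr0 mul0r mulr0.
Qed.

Let Pn := iid n (P eta).
Let mSS := measurable_sum_stat (n := n) mT.
Let Pn_tilted := iid_tilted n mT P_tilted.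

Lemma sum_stat_degenerate j : r j = 0 -> forall x, @sum_stat _ _ _ _ n T j x = 0.
Proof. by move=> r0 x; rewrite /sum_stat big1// => i _; exact: T_degenerate. Qed.

(** The covariance with the summed statistic splits over the sample points. Subtracting eta_j - m_j
    from the output inside the score is free, since the statistic is centred. *)
Lemma tcov_fingerprint j :
  sweight eta j * tcov (iid n nu) (@sum_stat _ _ _ _ n T) m (g j) j eta =
  \sum_(i < n) \int[Pn]_x (kernel_mean M (score eta j) x * cstat eta j (tnth x i)).
Proof.
set w := sweight eta j; set c := tnth eta j - m j.
have kE x : kernel_mean M (score eta j) x = w * (g j x - c).
  rewrite /kernel_mean /score.
  have ic : (kernel_prob M x).-integrable setT (EFin \o clip j).
    exact: prob_bounded_integrable (measurable_clip j) (clip_bounded j).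
  have icc : (kernel_prob M x).-integrable setT (EFin \o cst c).
    exact: (prob_bounded_integrable _ (c := `|c|)).
  rewrite RintegralZl//; last exact: (integrableB measurableT ic icc).
  by rewrite (RintegralB measurableT ic icc) prob_Rintegral_cst.
have ig : Pn.-integrable setT (EFin \o g j) by exact: prob_bounded_integrable (g_le j).
have ic' (a : R) : Pn.-integrable setT (EFin \o cst a).
  exact: (prob_bounded_integrable _ (c := `|a|)).
have iT (i : 'I_n) : Pn.-integrable setT (EFin \o (fun x => T j (tnth x i))).
  apply/(pullback_integrable (measurable_tnth i)
    (ge0_integral_tnth (fun=> P eta) i) (mT j)); exact: stat_integrable.
have igT (i : 'I_n) : Pn.-integrable setT (EFin \o (fun x => g j x * T j (tnth x i))).
  apply: le_integrableR (integrableZR (r j) (integrable_norm (iT i))).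
    by apply: measurable_funM => //; exact: (measurableT_comp (mT j) (measurable_tnth i)).
  by move=> x; rewrite normrM ler_wpM2r.
set mu := tmean nu T m (T j) eta.
have ET (i : 'I_n) : \int[Pn]_x T j (tnth x i) = mu.
  by rewrite -(pullback_Rintegral (ge0_integral_tnth (fun=> P eta) i) (mT j)) stat_mean.
have tm (f : n.-tuple X -> R) : measurable_fun setT f ->
    (iid n nu).-integrable setT (EFin \o
      (fun x => f x * tweight (@sum_stat _ _ _ _ n T) m eta x)) ->
    tmean (iid n nu) (@sum_stat _ _ _ _ n T) m f eta = \int[Pn]_x f x.
  by move=> mf fi; exact: (esym (tilted_RintegralE Pn_tilted beta mf fi)).
rewrite /tcov !tm//; last first.
- exact: (tweightMT_integrable mSS r_ge0 Pn_tilted sum_stat_degenerate tau_gt0 j (mg j) (g_le j) ieta).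
- exact: measurable_funM.
- exact: (tweightM_integrable mSS Pn_tilted (mg j) (g_le j)).
- exact: (tweightT_integrable mSS r_ge0 Pn_tilted sum_stat_degenerate tau_gt0).
have -> : \int[Pn]_x (g j x * @sum_stat _ _ _ _ n T j x) =
    \sum_(i < n) \int[Pn]_x (g j x * T j (tnth x i)).
  by rewrite -Rintegral_sum//; apply: eq_Rintegral => x _; rewrite /sum_stat mulr_sumr.
have -> : \int[Pn]_x @sum_stat _ _ _ _ n T j x = \sum_(i < n) mu.
  by rewrite /sum_stat Rintegral_sum//; apply: eq_bigr => i _; exact: ET.
rewrite mulr_sumr -sumrB mulr_sumr; apply: eq_bigr => i _.
have E x : kernel_mean M (score eta j) x * cstat eta j (tnth x i) =
    w * ((g j x * T j (tnth x i) + (- mu) * g j x) +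
         ((- c) * T j (tnth x i) + c * mu)).
  by rewrite kE /cstat -/mu; ring.
under [RHS]eq_Rintegral do rewrite E.
have i1 := integrableDR (igT i) (integrableZR (- mu) ig).
have i2 := integrableDR (integrableZR (- c) (iT i)) (ic' (c * mu)).
rewrite (RintegralZl _ measurableT (integrableDR i1 i2)); congr (_ * _).
rewrite (RintegralD measurableT i1 i2) (RintegralD measurableT (igT i) (integrableZR (- mu) ig)).
rewrite (RintegralD measurableT (integrableZR (- c) (iT i)) (ic' (c * mu))).
rewrite [X in _ = _ + (_ + X)]prob_Rintegral_cst.
by rewrite !RintegralZl// ET; ring.
Qed.

(** The privacy bound does not depend on the sample point, so the n terms add up to the factor n. *)
Lemma tcov_score_le :
  \sum_(j < k) sweight eta j *
    tcov (iid n nu) (@sum_stat _ _ _ _ n T) m (g j) j eta <=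
  n%:R * (2 * delta * t0 + 2 * eps * Num.sqrt (quad_score eta) +
          2 * \int[P eta]_x excess eta x).
Proof.
under eq_bigr do rewrite tcov_fingerprint.
rewrite exchange_big/= -[X in _ <= X%:R * _]card_ord mulr_natl -sumr_const.
apply: ler_sum => i _.
have ms j := measurable_score eta j.
have mk j : measurable_fun setT (kernel_mean M (score eta j)) by exact: measurable_kernel_mean.
rewrite -Rintegral_sum.
  exact: (dp_fingerprint mS eps_ge0 eps_le1 delta_ge0 M_dp i (P_S beta) ms
    (fun j y => score_bounded j y beta) measurable_cstat cstat_integrable cstat2_integrable
    cstat_mean measurable_stat_dev stat_dev_integrable score_cstat_le t0_gt0).
move=> j.
have iT : Pn.-integrable setT (EFin \o (fun x => cstat eta j (tnth x i))).
  apply/(pullback_integrable (measurable_tnth i)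
    (ge0_integral_tnth (fun=> P eta) i) (measurable_cstat j)); exact: cstat_integrable.
apply: le_integrableR (integrableZR b (integrable_norm iT)).
  by apply: measurable_funM => //; exact: (measurableT_comp (measurable_cstat j) (measurable_tnth i)).
move=> x; rewrite normrM ler_wpM2r//.
by apply: kernel_mean_bounded => // y; exact: score_bounded.
Qed.

End interior_parameter.

Variable A : R.
Hypotheses (A_ge0 : 0 <= A) (accuracy : forall eta, cbox m r eta ->
  \sum_(j < k) \int[iid n (P eta)]_x
    kernel_mean M (fun y => (clip j y - (tnth eta j - m j)) ^+ 2) x <= A).

(** Pointwise (y - c)^2 = c^2 - 2 c y + y^2, and the square of the output is dropped. *)
Lemma accuracy_correlation eta : cbox m r eta ->
  \sum_(j < k) (tnth eta j - m j) ^+ 2 - A <=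
  \sum_(j < k) 2 * (tnth eta j - m j) *
    tmean (iid n nu) (@sum_stat _ _ _ _ n T) m (g j) eta.
Proof.
move=> beta; rewrite lerBlDr -lerBlDl; apply: le_trans (accuracy beta).
rewrite -sumrB; apply: ler_sum => j _; set c := tnth eta j - m j.
have mSS := measurable_sum_stat (n := n) mT.
have Pn_tilted := iid_tilted n mT P_tilted.
have -> : tmean (iid n nu) (@sum_stat _ _ _ _ n T) m (g j) eta =
    \int[iid n (P eta)]_x g j x.
  exact: (esym (tilted_RintegralE Pn_tilted beta (mg j)
    (tweightM_integrable mSS Pn_tilted (mg j) (g_le j) beta))).
have ic (d0 : measure_display) (Y : measurableType d0) (Q : probability Y R) (a : R) :
    Q.-integrable setT (EFin \o cst a).
  exact: (prob_bounded_integrable _ (c := `|a|)).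
have ig : (iid n (P eta)).-integrable setT (EFin \o g j).
  exact: prob_bounded_integrable (g_le j).
have mcl : measurable_fun setT (fun y => (clip j y - c) ^+ 2).
  by apply: measurable_funX; apply: measurable_funB => //; exact: measurable_clip.
have clb y : `|(clip j y - c) ^+ 2| <= (r j + r j) ^+ 2.
  rewrite normrX ler_pXn2r ?nnegrE ?addr_ge0//; apply: le_trans (ler_normB _ _) _.
  by apply: lerD; [exact: clip_bounded|exact: beta].
rewrite -[X in X - _](prob_Rintegral_cst (iid n (P eta))) -RintegralZl//.
rewrite -(RintegralB measurableT (ic _ _ _ (c ^+ 2)) (integrableZR (2 * c) ig)).
apply: le_Rintegral => //.
- exact: (integrableB measurableT (ic _ _ _ (c ^+ 2)) (integrableZR (2 * c) ig)).
- exact: kernel_mean_integrable mcl clb.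
- move=> x _; have icl : (kernel_prob M x).-integrable setT (EFin \o clip j).
    exact: prob_bounded_integrable (measurable_clip j) (clip_bounded j).
  rewrite /g /kernel_mean -[X in X - _](prob_Rintegral_cst (kernel_prob M x)).
  rewrite -RintegralZl// -(RintegralB measurableT (ic _ _ _ (c ^+ 2)) (integrableZR (2 * c) icl)).
  apply: le_Rintegral => //.
  + exact: (integrableB measurableT (ic _ _ _ (c ^+ 2)) (integrableZR (2 * c) icl)).
  + exact: prob_bounded_integrable mcl clb.
  + move=> y _; rewrite /= -subr_ge0.
    have -> : (clip j y - c) ^+ 2 - (c ^+ 2 - 2 * c * clip j y) = clip j y ^+ 2 by ring.
    exact: sqr_ge0.
Qed.

Let U := product_prob (sides m r).

(** The cap at r_j^2 is inactive on the support of the uniform law and makes the integrand bounded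
    on the whole parameter space. *)
Lemma uniform_min_variance j :
  \int[U]_eta Num.min ((tnth eta j - m j) ^+ 2) (r j ^+ 2) = r j ^+ 2 / 3.
Proof.
have mh : measurable_fun setT
    (fun u : measurableTypeR R => Num.min ((u - m j) ^+ 2) (r j ^+ 2)).
  by apply: measurable_minr => //; apply: measurable_funX; exact: measurable_funB.
rewrite -(pullback_Rintegral (ge0_integral_tnth (sides m r) j) mh).
rewrite -(uniform_variance (m j) (r_ge0 j)) /Rintegral; congr fine.
apply: (@eq_integral_conull _ _ _ (uniform_itv (m j - r j) (m j + r j))
  (`[m j - r j, m j + r j]%classic : set (measurableTypeR R))) => //.
- by apply: uniform_itv_conull; have := r_ge0 j; lra.
- exact/measurable_EFinP.
- by apply/measurable_EFinP; apply: measurable_funX; exact: measurable_funB.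
- move=> u /=; rewrite in_itv/= -ler_distl => ur; congr EFin; apply/min_idPl.
  by rewrite -(real_normK (num_real (u - m j))) ler_pXn2r ?nnegrE.
Qed.

(** Of the error, 2 tau r_j^2 per coordinate is the boundary term of the integration by parts; the
    part with the factor k is the uniform mass outside the shrunk box, by a union bound over the
    coordinates. *)
Lemma tcov_score_lower :
  \sum_(j < k) r j ^+ 2 / 3 - A - tau * ((2 + k%:R) * \sum_(j < k) r j ^+ 2) <=
  \int[U]_eta (\1_B eta * \sum_(j < k) sweight eta j *
    tcov (iid n nu) (@sum_stat _ _ _ _ n T) m (g j) j eta).
Proof.
have mSS := measurable_sum_stat (n := n) mT.
have Pn_tilted := iid_tilted n mT P_tilted.
have mB : measurable_fun setT (\1_B : euclid R k -> R).
  by apply: measurable_indic; exact: measurable_ibox.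
have mc j : measurable_fun setT (fun eta : euclid R k => tnth eta j - m j).
  by apply: measurable_funB => //; exact: measurable_tnth.
pose f1 j (eta : euclid R k) : R := sweight eta j *
  tcov (iid n nu) (@sum_stat _ _ _ _ n T) m (g j) j eta.
pose f2 j (eta : euclid R k) : R := 2 * (tnth eta j - m j) *
  tmean (iid n nu) (@sum_stat _ _ _ _ n T) m (g j) eta.
have mf1 j : measurable_fun setT (f1 j).
  apply: measurable_funM; last exact: measurable_tcov.
  by apply: measurable_funB => //; exact: measurable_funX.
have mf2 j : measurable_fun setT (f2 j).
  apply: measurable_funM; last exact: measurable_tmean.
  by apply: measurable_funM; [exact: measurable_cst|exact: mc].
have bd (f : euclid R k -> R) (K : R) : measurable_fun setT f ->
    (forall eta, B eta -> `|f eta| <= K) ->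
    U.-integrable setT (EFin \o (fun eta => \1_B eta * f eta)).
  move=> mf fK; apply: (prob_bounded_integrable _ (c := `|K|)) => [|eta].
    exact: measurable_funM.
  rewrite indicE; case: (boolP (eta \in B)) => [|_].
    by rewrite inE => /fK; rewrite mul1r => /le_trans; apply; exact: ler_norm.
  by rewrite mul0r normr0.
have i1 j : U.-integrable setT (EFin \o (fun eta => \1_B eta * f1 j eta)).
  have [K HK] := by_parts_bounded1 mSS r_ge0 Pn_tilted sum_stat_degenerate tau_gt0 (mg j) (g_le j).
  by apply: (bd (f1 j) K (mf1 j)) => eta Be; exact: HK.
have i2 j : U.-integrable setT (EFin \o (fun eta => \1_B eta * f2 j eta)).
  apply: (bd (f2 j) (2 * r j ^+ 2) (mf2 j)) => eta Be.
  apply: (by_parts_bounded2 mSS Pn_tilted (mg j) (g_le j)).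
  exact: (ibox_cbox r_ge0 tau_gt0 Be).
under [leRHS]eq_Rintegral do rewrite mulr_sumr.
rewrite [leRHS]Rintegral_sum//.
pose I l : set (measurableTypeR R) :=
  `[m l - (1 - tau) * r l, m l + (1 - tau) * r l]%classic.
have mI l : measurable_fun setT (\1_(I l) : measurableTypeR R -> R).
  by apply: measurable_indic; exact: measurable_itv.
have mIt l : measurable_fun setT (fun eta : euclid R k => \1_(I l) (tnth eta l) : R).
  exact: (measurableT_comp (mI l) (measurable_tnth l)).
have I01 l u : 0 <= (\1_(I l) u : R) <= 1.
  by rewrite indicE; case: (_ \in _); rewrite ?lexx ler01.
have iI l : U.-integrable setT (EFin \o (fun eta => \1_(I l) (tnth eta l))).
  apply: (prob_bounded_integrable _ (c := 1)) => // eta.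
  by have /andP[? ?] := I01 l (tnth eta l); rewrite ger0_norm.
pose h j (eta : euclid R k) := Num.min ((tnth eta j - m j) ^+ 2) (r j ^+ 2).
have ih j : U.-integrable setT (EFin \o h j).
  apply: (prob_bounded_integrable _ (c := r j ^+ 2)) => [|eta].
    by apply: measurable_minr => //; exact: measurable_funX.
  by rewrite ger0_norm /h ?le_min ?sqr_ge0// ge_min lexx orbT.
set V := \sum_(j < k) r j ^+ 2.
have V0 : 0 <= V by apply: sumr_ge0 => j _; exact: sqr_ge0.
have ic (a : R) : U.-integrable setT (EFin \o cst a).
  exact: (prob_bounded_integrable _ (c := `|a|)).
have iIs : U.-integrable setT (EFin \o (fun eta => \sum_(l < k) \1_(I l) (tnth eta l))).
  exact: integrable_sumR.
have ihs : U.-integrable setT (EFin \o (fun eta => \sum_(l < k) h l eta)).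
  exact: integrable_sumR.
have iL := integrableDR (integrableDR ihs (integrableZR V iIs)) (ic (- A - V * k%:R)).
have main : \sum_(j < k) r j ^+ 2 / 3 - A - tau * k%:R * V <=
    \sum_(j < k) \int[U]_eta (\1_B eta * f2 j eta).
  (* The terms with [V] amount to -V times the number of coordinates outside the shrunk box. They
     vanish on [B]; off [B] they are at most -V, which cancels the capped squares, whose sum is at
     most V. *)
  apply: (@le_trans _ _ (\int[U]_eta (\sum_(l < k) h l eta +
      V * \sum_(l < k) \1_(I l) (tnth eta l) + (- A - V * k%:R)))).
    rewrite (RintegralD measurableT (integrableDR ihs (integrableZR V iIs)) (ic (- A - V * k%:R))).
    rewrite (RintegralD measurableT ihs (integrableZR V iIs)) prob_Rintegral_cst.
    rewrite RintegralZl// Rintegral_sum// Rintegral_sum//.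
    have -> : \sum_(j < k) \int[U]_x h j x = \sum_(j < k) r j ^+ 2 / 3.
      by apply: eq_bigr => j _; exact: uniform_min_variance.
    have HI : (1 - tau) * k%:R <= \sum_(l < k) \int[U]_eta \1_(I l) (tnth eta l).
      rewrite -[k in k%:R]card_ord mulr_natr -sumr_const; apply: ler_sum => l _.
      rewrite -(pullback_Rintegral (ge0_integral_tnth (sides m r) l) (mI l)).
      exact: uniform_inner_mass.
    have := ler_wpM2l V0 HI; lra.
  rewrite -Rintegral_sum//; apply: le_Rintegral => //.
    exact: integrable_sumR.
  move=> eta _; rewrite -mulr_sumr.
  have Ik : \sum_(l < k) (\1_(I l) (tnth eta l) : R) <= k%:R.
    rewrite -[X in _ <= X%:R]card_ord -sumr_const; apply: ler_sum => l _.
    by have /andP[] := I01 l (tnth eta l).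
  rewrite indicE; case: (boolP (eta \in B)) => [|etaB].
    rewrite inE => Be; have beta := ibox_cbox r_ge0 tau_gt0 Be; rewrite mul1r.
    apply: le_trans (accuracy_correlation beta).
    have hc : \sum_(l < k) h l eta <= \sum_(j < k) (tnth eta j - m j) ^+ 2.
      by apply: ler_sum => j _; rewrite /h ge_min lexx.
    have := ler_wpM2l V0 Ik; lra.
  have hV : \sum_(l < k) h l eta <= V.
    by apply: ler_sum => j _; rewrite /h ge_min lexx orbT.
  have [l Il] : exists l, ~ I l (tnth eta l).
    apply: contrapT => /forallNP H; move/negP: etaB; apply; rewrite inE => l.
    by have /contrapT := H l; rewrite /I/= in_itv/= -ler_distl.
  have Ik1 : \sum_(l < k) (\1_(I l) (tnth eta l) : R) <= k%:R - 1.
    have -> : k%:R = \sum_(l < k) 1 :> R by rewrite sumr_const card_ord.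
    rewrite (bigD1 l)//= [X in _ <= X - _](bigD1 l)//= addrAC subrr add0r.
    rewrite indicE memNset//= add0r; apply: ler_sum => l' _.
    by have /andP[] := I01 l' (tnth eta l').
  rewrite mul0r; have := ler_wpM2l V0 Ik1; move: hV A_ge0.
  by rewrite mulrBr mulr1; lra.
apply: (@le_trans _ _ (\sum_(j < k) (\int[U]_eta (\1_B eta * f2 j eta) -
    2 * tau * r j ^+ 2))); last first.
  apply: ler_sum => j _.
  exact: (by_parts_box mSS r_ge0 Pn_tilted sum_stat_degenerate tau_gt0 tau_lt1 (mg j) (g_le j)).
rewrite sumrB -mulr_sumr -/V.
by move: main; rewrite !mulrDl !mulrDr; lra.
Qed.

(** Written through [nu] so as to be measurable in [eta], like [tmean]. *)
Definition excess_mean (eta : euclid R k) : R :=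
  \int[nu]_x (excess eta x * (tweight T m eta x / tmass nu T m eta)).

Lemma excess_ge0 eta x : 0 <= excess eta x.
Proof. by rewrite /excess le_max lexx orbT. Qed.

Lemma measurable_excess2 :
  measurable_fun setT (fun z : euclid R k * X => excess z.1 z.2).
Proof.
apply: measurable_maxr => //; apply: measurable_funB => //.
apply: measurable_funM => //; apply: (measurableT_comp (@measurable_sqrt R)).
apply: measurable_sum => j; apply: measurable_funX; apply: measurable_funB.
  exact: (measurableT_comp (mT j) measurable_snd).
exact: (measurableT_comp (measurable_tmean nu m mT (mT j)) measurable_fst).
Qed.

Lemma excess_meanE eta : cbox m r eta -> \int[P eta]_x excess eta x = excess_mean eta.
Proof.
move=> beta; rewrite (tilted_Rintegral P_tilted beta)//.
apply: (measurableT_comp measurable_excess2 (g := fun x => (eta, x))).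
exact: measurable_fun_pair.
Qed.

Lemma measurable_excess_mean : measurable_fun setT excess_mean.
Proof.
apply: (measurable_Rintegral_param nu (f := fun z : euclid R k * X =>
  excess z.1 z.2 * (tweight T m z.1 z.2 / tmass nu T m z.1))).
apply: measurable_funM; first exact: measurable_excess2.
apply: measurable_funM; first exact: measurable_tweight2.
apply: (measurableT_comp (@measurable_invr R)).
exact: (measurableT_comp (measurable_tmass nu m mT) measurable_fst).
Qed.

Lemma excess_mean_ge0 eta : 0 <= excess_mean eta.
Proof.
apply: Rintegral_ge0 => x _; rewrite mulr_ge0 ?excess_ge0// divr_ge0 ?tmass_ge0//.
by rewrite ltW// tweight_gt0.
Qed.

(* [q] and [e] need not be measurable, so their integrals cannot be added up
   directly; the part of the covariance not accounted for by the (measurable)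
   excess is measurable and is dominated by [q] alone. *)
Lemma private_tilted_lower (D : set (euclid R k)) (q e : euclid R k -> \bar R) :
  B `<=` D ->
  (forall eta, (0 <= q eta)%E) -> (forall eta, (0 <= e eta)%E) ->
  (forall eta, B eta -> ((Num.sqrt (quad_score eta))%:E <= q eta)%E) ->
  (forall eta, B eta -> ((\int[P eta]_x excess eta x)%:E <= e eta)%E) ->
  ((\sum_(j < k) r j ^+ 2 / 3 - A - tau * ((2 + k%:R) * \sum_(j < k) r j ^+ 2))%:E <=
   n%:R%:E * ((2 * delta * t0)%:E + (2 * eps)%:E * \int[U]_(eta in D) q eta
     + 2%:E * \int[U]_(eta in D) e eta))%E.
Proof.
move=> BD q0 e0 qB eB.
pose f1 (eta : euclid R k) : R := \sum_(j < k) sweight eta j *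
  tcov (iid n nu) (@sum_stat _ _ _ _ n T) m (g j) j eta.
pose f eta : R := \1_B eta * f1 eta.
have mB : measurable_fun setT (\1_B : euclid R k -> R).
  by apply: measurable_indic; exact: measurable_ibox.
have mf : measurable_fun setT f.
  apply: measurable_funM => //; apply: measurable_sum => j.
  apply: measurable_funM; last by apply: measurable_tcov => //; exact: measurable_sum_stat.
  apply: measurable_funB => //; apply: measurable_funX; apply: measurable_funB => //.
  exact: measurable_tnth.
pose c := n%:R * (2 * delta * t0).
pose a := n%:R * (2 * eps).
have c0 : 0 <= c by rewrite /c !mulr_ge0// ltW.
have a0 : 0 <= a by rewrite /a !mulr_ge0.
pose h eta : R := \1_B eta * excess_mean eta.
have mh : measurable_fun setT h.
  by apply: measurable_funM => //; exact: measurable_excess_mean.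
have h0 eta : 0 <= h eta.
  by apply: mulr_ge0; [rewrite indicE ler0n|exact: excess_mean_ge0].
have nh eta : 0 <= n%:R * 2 * h eta.
  by apply: mulr_ge0; [rewrite mulr_ge0|exact: h0].
pose rest eta : R := Num.max (f eta - c - n%:R * 2 * h eta) 0.
have mrest : measurable_fun setT rest.
  apply: measurable_maxr => //; apply: measurable_funB; first exact: measurable_funB.
  exact: measurable_funM.
have rest0 eta : 0 <= rest eta by rewrite /rest le_max lexx orbT.
have restB eta : rest eta <= \1_B eta * (a * Num.sqrt (quad_score eta)).
  have n0 := nh eta.
  rewrite /rest ge_max; apply/andP; split; last first.
    by apply: mulr_ge0; [rewrite indicE ler0n|rewrite mulr_ge0// sqrtr_ge0].
  move: n0; rewrite /f /h indicE; case: (boolP (eta \in B)) => [|_]; last first.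
    by rewrite /= !mul0r; lra.
  rewrite inE => Be; rewrite /= !mul1r => _.
  have := tcov_score_le Be; rewrite -/(f1 eta).
  rewrite (excess_meanE (ibox_cbox r_ge0 tau_gt0 Be)) /c /a; lra.
have rq eta : B eta -> ((a^-1 * rest eta)%:E <= q eta)%E.
  move=> Be; apply: le_trans (qB _ Be); rewrite lee_fin.
  have := restB eta; rewrite indicE mem_set// mul1r => H.
  have [a00|an0] := eqVneq a 0; first by rewrite a00 invr0 mul0r sqrtr_ge0.
  by rewrite mulrC ler_pdivrMr ?lt_neqAle ?a0 1?eq_sym ?an0// mulrC.
(* For eps = 0 or n = 0 the constant [a] is 0; then [restB] forces [rest] to vanish, and the
   factorization survives the convention 1/0 = 0. *)
have rE eta : rest eta = a * (a^-1 * rest eta).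
  have [a00|an0] := eqVneq a 0; last by rewrite mulVKf.
  apply/eqP; rewrite a00 mul0r eq_le rest0 andbT.
  by apply: le_trans (restB eta) _; rewrite a00 mul0r mulr0.
have rN eta : ~ B eta -> rest eta = 0.
  move=> NB; apply/eqP; rewrite eq_le rest0 andbT; apply: le_trans (restB eta) _.
  by rewrite indicE memNset// mul0r.
have ar0 eta : 0 <= a^-1 * rest eta by rewrite mulr_ge0// invr_ge0.
have mind (u : euclid R k -> R) : measurable_fun setT u ->
    measurable_fun setT (EFin \o u) by move=> ?; exact/measurable_EFinP.
apply: (@le_trans _ _ (\int[U]_eta (f eta)%:E)%E).
  have fi : U.-integrable setT (EFin \o f).
    have mSS := measurable_sum_stat (n := n) mT.
    have Pn_tilted := iid_tilted n mT P_tilted.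
    rewrite (_ : f = fun eta => \sum_(j < k) \1_B eta * (sweight eta j *
        tcov (iid n nu) (@sum_stat _ _ _ _ n T) m (g j) j eta)); last first.
      by apply/funext => eta; rewrite /f /f1 mulr_sumr.
    apply: integrable_sumR => j.
    have [K HK] := by_parts_bounded1 mSS r_ge0 Pn_tilted sum_stat_degenerate tau_gt0 (mg j) (g_le j).
    apply: (prob_bounded_integrable _ (c := `|K|)) => [|eta].
      apply: measurable_funM => //.
      apply: measurable_funM; last exact: measurable_tcov.
      apply: measurable_funB => //; apply: measurable_funX; apply: measurable_funB => //.
      exact: measurable_tnth.
    rewrite indicE; case: (boolP (eta \in B)) => [|_]; last by rewrite mul0r normr0.
    by rewrite inE mul1r => Be; apply: le_trans (HK _ Be) (ler_norm _).
  rewrite -[leRHS]fineK; last exact: (integrable_fin_num _ fi).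
  by rewrite lee_fin; exact: tcov_score_lower.
apply: (@le_trans _ _ (\int[U]_eta (c%:E + (n%:R * 2)%:E * (h eta)%:E + (rest eta)%:E))%E).
  (* Passing to the positive part of [f] leaves only nonnegative integrands, for which comparison
     and additivity need no integrability. *)
  apply: (@le_trans _ _ (\int[U]_eta (Num.max (f eta) 0)%:E)%E).
    rewrite integralE [leRHS](_ : _ = \int[U]_x ((EFin \o f)^\+ x))%E; last first.
      by apply: eq_integral => x _; rewrite funeposE/= EFin_max.
    by rewrite -[leRHS]adde0 leeD2l// oppe_le0 integral_ge0.
  apply: ge0_le_integral => //.
  - by move=> x _; rewrite lee_fin le_max lexx orbT.
  - by apply: mind; exact: measurable_maxr.
  - apply: emeasurable_funD; last exact: mind.
    by apply: emeasurable_funD => //; apply: emeasurable_funM => //; exact: mind.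
  - move=> x _; rewrite -EFinM -!EFinD lee_fin ge_max; apply/andP; split; last first.
      exact: addr_ge0 (addr_ge0 c0 (nh x)) (rest0 x).
    have : f x - c - n%:R * 2 * h x <= rest x by rewrite /rest le_max lexx.
    lra.
have nh0 x : (0 <= (n%:R * 2)%:E * (h x)%:E)%E.
  by rewrite -EFinM lee_fin; exact: nh.
rewrite ge0_integralD//; last 4 first.
- by move=> x _; rewrite adde_ge0// lee_fin.
- by apply: emeasurable_funD => //; apply: emeasurable_funM => //; exact: mind.
- by move=> x _; rewrite lee_fin.
- exact: mind mrest.
rewrite ge0_integralD//; last first.
  by apply: emeasurable_funM => //; exact: mind.
have intZ (z : R) (u : euclid R k -> R) : 0 <= z -> measurable_fun setT u ->
    (forall x, 0 <= u x) ->
    (\int[U]_x (z%:E * (u x)%:E) = z%:E * \int[U]_x (u x)%:E)%E.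
  by move=> z0 mu_ u0; rewrite ge0_integralZl ?lee_fin//; [exact: mind|move=> x _; rewrite lee_fin].
have nn0 : 0 <= n%:R * 2 :> R by rewrite mulr_ge0.
rewrite integral_prob_cst (intZ _ h nn0)//.
under [X in (_ + _ + X <= _)%E]eq_integral do rewrite rE EFinM.
have mar : measurable_fun setT (fun x => a^-1 * rest x) by exact: measurable_funM.
rewrite (intZ a (fun x => a^-1 * rest x))//.
have H1 : (\int[U]_x (h x)%:E <= \int[U]_(x in D) e x)%E.
  rewrite [leRHS]integral_mkcond; apply: ge0_le_integral_nomeas => x _.
    by rewrite lee_fin.
  rewrite patchE /h indicE; case: (boolP (x \in B)) => [|_].
    rewrite inE => Bx; rewrite mul1r mem_set; last exact: BD.
    by rewrite -(excess_meanE (ibox_cbox r_ge0 tau_gt0 Bx)); exact: eB.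
  by rewrite mul0r; case: ifP.
have H2 : (\int[U]_x (a^-1 * rest x)%:E <= \int[U]_(x in D) q x)%E.
  rewrite [leRHS]integral_mkcond; apply: ge0_le_integral_nomeas => x _.
    by rewrite lee_fin.
  rewrite patchE; have [Bx|NB] := pselect (B x).
    by rewrite mem_set; [exact: rq|exact: BD].
  by rewrite rN// mulr0; case: ifP.
have q00 : (0 <= \int[U]_(x in D) q x)%E by exact: integral_ge0.
have e00 : (0 <= \int[U]_(x in D) e x)%E by exact: integral_ge0.
have d0 : (0 <= (2 * delta * t0)%:E)%E by rewrite lee_fin !mulr_ge0// ltW.
have eq0 : (0 <= (2 * eps)%:E * \int[U]_(x in D) q x)%E.
  by rewrite mule_ge0// lee_fin mulr_ge0.
have ee0 : (0 <= 2%:E * \int[U]_(x in D) e x)%E by rewrite mule_ge0// lee_fin.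
rewrite (ge0_muleDr _ (adde_ge0 d0 eq0) ee0) (ge0_muleDr _ d0 eq0).
rewrite -[X in (_ <= X + _ + _)%E]EFinM -/c !muleA -!EFinM -/a.
rewrite addeAC; apply: leeD; last by apply: lee_wpmul2l; rewrite ?lee_fin.
by apply: leeD2l; apply: lee_wpmul2l; rewrite ?lee_fin.
Qed.

End private_tilted.

(** * Exponential families *)

Section expfam_tilted.
Context (R : realType) (d k : nat).
Variables (K : family_kind) (S : set (euclid R d))
  (h : euclid R d -> R) (T : euclid R d -> euclid R k).
Hypotheses (mS : measurable S) (h_ge0 : forall x, S x -> 0 <= h x)
  (mh : measurable_fun S h) (mT : measurable_fun S T).
Variable p : euclid R k -> probability (euclid R d) R.
Hypothesis p_expfam : is_expfam K S h T p.
Variables (eta1 eta2 : euclid R k).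
Hypotheses (eta12 : forall j, tnth eta1 j <= tnth eta2 j)
  (box_nat : box eta1 eta2 `<=` natural_range K S h T).

Definition centre (j : 'I_k) : R := midpoint eta1 eta2 j ord0.

Definition radius (j : 'I_k) : R := range_vec eta1 eta2 j ord0 / 2.

Definition stat_in (j : 'I_k) (x : euclid R d) : R :=
  if x \in S then tnth (T x) j else 0.

(* Coordinates with a degenerate parameter interval are not differentiated, so
   the corresponding statistics, which may fail to be integrable, are dropped. *)
Definition active_stat (j : 'I_k) (x : euclid R d) : R :=
  if radius j == 0 then 0 else stat_in j x.

Lemma centreE j : centre j = (tnth eta1 j + tnth eta2 j) / 2.
Proof. by rewrite /centre /midpoint !mxE mulrC. Qed.

Lemma radiusE j : radius j = (tnth eta2 j - tnth eta1 j) / 2.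
Proof. by rewrite /radius /range_vec !mxE. Qed.

Lemma radius_ge0 j : 0 <= radius j.
Proof. by rewrite radiusE divr_ge0// subr_ge0. Qed.

Lemma cbox_centre : cbox centre radius = box eta1 eta2.
Proof.
apply/seteqP; split=> eta H j; have := H j; rewrite /= ler_distl centreE radiusE;
  move=> /andP[? ?]; apply/andP; split; lra.
Qed.

Lemma sides_uniform_box :
  product_prob (sides centre radius) = uniform_box eta1 eta2.
Proof.
rewrite /uniform_box; congr product_prob; apply/funext => j.
by rewrite /sides centreE radiusE; congr uniform_itv; field.
Qed.

Lemma measurable_restrict_in (f : euclid R d -> R) : measurable_fun S f ->
  measurable_fun setT (fun x => if x \in S then f x else 0).
Proof.
move=> mf; have /(measurable_restrictT _ mS) := mf.
by apply: eq_measurable_fun => x _; rewrite /patch.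
Qed.

Lemma measurable_stat_in j : measurable_fun setT (stat_in j).
Proof.
apply: measurable_restrict_in.
exact: (measurableT_comp (measurable_tnth j) mT).
Qed.

Lemma measurable_active_stat j : measurable_fun setT (active_stat j).
Proof.
rewrite /active_stat; case: (radius j == 0); first exact: measurable_cst.
exact: measurable_stat_in.
Qed.

Lemma active_stat_degenerate j : radius j = 0 -> forall x, active_stat j x = 0.
Proof. by move=> r0 x; rewrite /active_stat r0 eqxx. Qed.

Lemma dot_vecE (u v : euclid R k) : dot (vec u) (vec v) = \sum_(j < k) tnth u j * tnth v j.
Proof. by rewrite /dot mxE; apply: eq_bigr => j _; rewrite !mxE. Qed.

Let rho eta x : R := if x \in S then expfam_density K S h T eta x else 0.

Let rho_ge0 eta x : 0 <= rho eta x.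
Proof.
rewrite /rho; case: ifPn => // /set_mem Sx.
by rewrite /expfam_density mulr_ge0 ?expR_ge0 ?h_ge0.
Qed.

Let mrho eta : measurable_fun setT (rho eta).
Proof.
apply: measurable_restrict_in; apply: measurable_funM => //.
apply: (measurableT_comp (@measurable_expR R)); apply: measurable_funB => //.
rewrite (_ : (fun x => _) = fun x => \sum_(j < k) tnth eta j * tnth (T x) j); last first.
  by apply/funext => x; rewrite dot_vecE.
apply: measurable_sum => j; apply: measurable_funM => //.
exact: (measurableT_comp (measurable_tnth j) mT).
Qed.

Let p_density eta : box eta1 eta2 eta -> forall f : euclid R d -> \bar R,
  measurable_fun setT f -> (forall x, 0 <= f x)%E ->
  (\int[p eta]_x f x = \int[base_measure R d K]_x (f x * (rho eta x)%:E))%E.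
Proof.
move=> beta f mf f0; apply: ge0_integral_density => // A mA.
apply: etrans (p_expfam (box_nat beta) mA) _.
rewrite [LHS]integral_mkcond [RHS]integral_mkcond; congr (integral _ _).
apply/funext => x; rewrite /patch /rho in_setI.
by case: (x \in S); case: (x \in A).
Qed.

Definition mid : euclid R k := [tuple centre j | j < k].

Lemma mid_box : box eta1 eta2 mid.
Proof. by move=> j; rewrite tnth_mktuple centreE; have := eta12 j; move=> ?; apply/andP; split; lra. Qed.

(** The quotient of the densities at [eta] and at the midpoint is exp<eta - m, T> times a constant.
    A coordinate with radius 0 has eta_j = m_j on the box, so replacing its statistic by 0 does not
    change the exponent. *)
Lemma expfam_tilted : tilted (p mid) active_stat centre radius p.
Proof.
move=> eta ceta; have beta : box eta1 eta2 eta by rewrite -cbox_centre.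
pose c := expR (fine (log_partition K S h T mid) - fine (log_partition K S h T eta)).
have c0 : 0 < c by exact: expR_gt0.
pose w := tweight active_stat centre eta.
have mw : measurable_fun setT w by exact: measurable_tweight measurable_active_stat eta.
have w0 x : 0 < w x by exact: tweight_gt0.
have rhoE x : rho eta x = w x * c * rho mid x.
  rewrite /rho; case: (boolP (x \in S)) => [Sx|_]; last by rewrite mulr0.
  have e : dot (vec eta) (vec (T x)) = dot (vec mid) (vec (T x)) +
      \sum_(j < k) (tnth eta j - centre j) * active_stat j x.
    rewrite !dot_vecE -big_split/=; apply: eq_bigr => j _.
    rewrite tnth_mktuple /active_stat /stat_in Sx; case: eqP => [r0|_]; last by ring.
    by have := ceta j; rewrite r0 normr_le0 subr_eq0 => /eqP ->; ring.
  rewrite /expfam_density e /c /w /tweight.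
  generalize (log_partition K S h T) => lp.
  move: (fine (lp eta)) (fine (lp mid)) (dot (vec mid) (vec (T x))) => a b v.
  move: (\sum_(j < k) _) => u.
  have -> : v + u - a = u + (b - a) + (v - b) by ring.
  by rewrite (expRD (u + (b - a)) (v - b)) (expRD u (b - a)) mulrCA.
have D f : measurable_fun setT f -> (forall x, 0 <= f x)%E ->
    (\int[p eta]_x f x = \int[p mid]_x (f x * (w x * c)%:E))%E.
  move=> mf f0; rewrite p_density// (p_density mid_box); last 2 first.
  - by apply: emeasurable_funM => //; apply/measurable_EFinP; exact: measurable_funM.
  - by move=> x; rewrite mule_ge0// lee_fin mulr_ge0 ?(ltW (w0 x))// ltW.
  by apply: eq_integral => x _; rewrite rhoE EFinM muleA.
(* The constant exp(Z(m) - Z(eta)) is the inverse of the normalizing mass because [p eta] has total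
   mass 1. *)
have I1 : (\int[p mid]_x (w x)%:E = c^-1%:E)%E.
  have := D (cst 1%E) (measurable_cst _) (fun=> lee01).
  rewrite integral_prob_cst; under eq_integral do rewrite mul1e EFinM.
  rewrite ge0_integralZr//; last 3 first.
  - exact/measurable_EFinP.
  - by move=> x _; rewrite lee_fin ltW.
  - by rewrite lee_fin ltW.
  move=> /(congr1 (fun z => z * c^-1%:E)%E); rewrite mul1e -muleA -EFinM.
  by rewrite mulfV ?gt_eqF// mule1.
have iw : (p mid).-integrable setT (EFin \o w).
  apply/integrableP; split; first exact/measurable_EFinP.
  under eq_integral do rewrite gee0_abs ?lee_fin ?(ltW (w0 _))//.
  by rewrite I1 ltry.
split=> // f mf f0; rewrite D//; apply: eq_integral => x _; congr (_ * (_ * _)%:E)%E.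
by rewrite /tmass /Rintegral I1 invrK.
Qed.

Lemma expfam_conull eta : box eta1 eta2 eta -> p eta (~` S) = 0%E.
Proof.
move=> /box_nat neta; apply: etrans (p_expfam neta (measurableC mS)) _.
by rewrite setICr integral_set0.
Qed.

End expfam_tilted.

Section kernel_conull.
Context (R : realType) (d d' d0 : measure_display).
Context (X : measurableType d) (Y : measurableType d') (Z : measurableType d0).
Variable M : R.-pker X ~> Y.

(** Almost every input is a dataset in S, on which the output lies in the box almost surely. An
    unbounded integrand of the theorem may thus be exchanged for its clipped version, whose integral
    is a real number. *)
Lemma integral_kernel_conull (Q : probability Z R) (phi : Z -> X) (D : set Z)
    (E : set Y) (f g : Y -> R) (c : R) :
  measurable_fun setT phi -> measurable D -> Q (~` D) = 0%E -> measurable E ->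
  (forall z, D z -> M (phi z) E = 1%E) ->
  measurable_fun setT f -> measurable_fun setT g -> (forall y, `|g y| <= c) ->
  (forall y, E y -> f y = g y) ->
  (\int[Q]_z \int[M (phi z)]_y (f y)%:E =
   (\int[Q]_z kernel_mean M g (phi z))%:E)%E.
Proof.
move=> mphi mD D0 mE ME mf mg gc fg.
have mk := measurable_kernel_mean M mg.
have mkp : measurable_fun setT (fun z => kernel_mean M g (phi z)).
  exact: measurableT_comp mk mphi.
have ik : Q.-integrable setT (EFin \o (fun z => kernel_mean M g (phi z))).
  by apply: prob_bounded_integrable mkp (fun z => kernel_mean_bounded M mg gc (phi z)).
rewrite /Rintegral fineK; last exact: (integrable_fin_num _ ik).
apply: (eq_integral_conull mD D0).
- exact: measurableT_comp (measurable_kernel_integral M mf) mphi.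
- exact/measurable_EFinP.
- move=> z Dz; have ig : (kernel_prob M (phi z)).-integrable setT (EFin \o g).
    exact: prob_bounded_integrable mg gc.
  rewrite /kernel_mean /Rintegral fineK; last exact: (integrable_fin_num _ ig).
  apply: (@eq_integral_conull _ _ _ (kernel_prob M (phi z)) E) => //.
  + have c0 (Q0 : probability Y R) : Q0 E = 1%E -> Q0 (~` E) = 0%E.
      by move=> e; rewrite probability_setC// e subee.
    exact: c0 (kernel_prob M (phi z)) (ME z Dz).
  + exact/measurable_EFinP.
  + exact/measurable_EFinP.
  + by move=> y Ey; rewrite fg.
Qed.

End kernel_conull.

(** Adding t0 on both sides turns the excess into max(f, t0), whose level sets agree with those of f
    above t0; the levels in [0, t0] contribute at most t0. No translation of the variable t is
    required. *)
Lemma integral_excess_le (R : realType) (d : measure_display)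
    (X : measurableType d) (P : probability X R) (f : X -> R) (t0 : R) :
  measurable_fun setT f -> 0 <= t0 ->
  ((\int[P]_x Num.max (f x - t0) 0)%:E <=
   \int[@lebesgue_measure R]_(t in `]t0, +oo[) P [set x | (t < f x)%R])%E.
Proof.
move=> mf t00; pose e x : R := Num.max (f x - t0) 0.
have me : measurable_fun setT e by apply: measurable_maxr => //; exact: measurable_funB.
have e0 x : 0 <= e x by rewrite /e le_max lexx orbT.
(* If the extended integral is infinite, its real-valued version is 0 and the inequality still
   holds. *)
apply: (@le_trans _ _ (\int[P]_x (e x)%:E)%E).
  have : (0 <= \int[P]_x (e x)%:E)%E by apply: integral_ge0 => x _; rewrite lee_fin.
  by rewrite /Rintegral -/(e _); case: (\int[P]_x (e x)%:E)%E => [z| |]//= _; rewrite ?leey ?lexx.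
rewrite -(leeD2lE (x := t0%:E))//.
have -> : (t0%:E + \int[P]_x (e x)%:E = \int[P]_x (t0 + e x)%:E)%E.
  under [RHS]eq_integral do rewrite EFinD.
  rewrite ge0_integralD//; last 2 first.
  - by move=> x _; rewrite lee_fin.
  - exact/measurable_EFinP.
  by rewrite integral_prob_cst.
have mte : measurable_fun setT (fun x => t0 + e x) by exact: measurable_funD.
rewrite ge0_integral_layer_cake//; last by move=> x; rewrite addr_ge0.
have -> : `[0%R, +oo[%classic = `[0, t0] `|` `]t0, +oo[ :> set R.
  by rewrite -itv_bndbnd_setU// bnd_simp.
have mtail := measurable_tail P mte.
rewrite ge0_integral_setU//=; last 2 first.
- by apply: measurable_funTS.
- apply/disj_setPRL => t /=; rewrite !in_itv/= andbT => t0t.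
  by apply/negP; rewrite negb_and -!ltNge t0t orbT.
apply: leeD.
  apply: (@le_trans _ _ (\int[@lebesgue_measure R]_(t in `[0%R, t0]) 1)%E).
    apply: ge0_le_integral => //.
    + by apply: measurable_funTS.
    + move=> t _; apply: probability_le1.
      rewrite [X in measurable X](_ : _ = (fun x => t0 + e x) @^-1` `]t, +oo[).
        by rewrite -[X in measurable X]setTI; apply: mte.
      by apply/seteqP; split => y /=; rewrite in_itv/= andbT.
  rewrite integral_cst//= mul1e.
  rewrite [X in (X <= _)%E](_ : _ = @lebesgue_measure R `[0, t0]%classic)//.
  rewrite lebesgue_measure_itv/= lte_fin; case: ifP => // _.
  by rewrite oppr0 adde0.
rewrite le_eqVlt; apply/orP; left; apply/eqP.
apply: eq_integral => t; rewrite inE/= in_itv/= andbT => t0t.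
congr (P _); apply/seteqP; split => x /=; rewrite /e.
  by rewrite -ltrBlDl lt_max => /orP[|]; lra.
by move=> tf; rewrite -ltrBlDl lt_max; apply/orP; left; lra.
Qed.

Lemma kernel_mean_sum (R : realType) (d d' : measure_display) (X : measurableType d)
    (Y : measurableType d') (M : R.-pker X ~> Y) (I : finType) (f : I -> Y -> R)
    (c : I -> R) (x : X) :
  (forall j, measurable_fun setT (f j)) -> (forall j y, `|f j y| <= c j) ->
  kernel_mean M (fun y => \sum_j f j y) x = \sum_j kernel_mean M (f j) x.
Proof.
move=> mf fc; rewrite /kernel_mean Rintegral_sum// => j.
exact: prob_bounded_integrable (mf j) (fc j).
Qed.

(** * Accuracy, quadratic form and tail of the theorem in terms of the tilted family *)

Section fingerprint_terms.
Context (R : realType) (d k n : nat).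
Variables (K : family_kind) (S : set (euclid R d))
  (h : euclid R d -> R) (T : euclid R d -> euclid R k).
Hypotheses (mS : measurable S) (h_ge0 : forall x, S x -> 0 <= h x)
  (mh : measurable_fun S h) (mT : measurable_fun S T).
Variable p : euclid R k -> probability (euclid R d) R.
Hypothesis p_expfam : is_expfam K S h T p.
Variables (eta1 eta2 : euclid R k).
Hypotheses (eta12 : forall j, tnth eta1 j <= tnth eta2 j)
  (box_nat : box eta1 eta2 `<=` natural_range K S h T).
Variable M : R.-pker (n.-tuple (euclid R d)) ~> (euclid R k).
Hypothesis M_box : forall x, datasets S x -> M x (centered_box eta1 eta2) = 1%E.

Let m := centre eta1 eta2.
Let r := radius eta1 eta2.
Let nu := p (mid eta1 eta2).
Let A := active_stat S T eta1 eta2.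
Let mA : forall j, measurable_fun setT (A j) := measurable_active_stat mS mT eta1 eta2.
Let r_ge0 : forall j, 0 <= r j := radius_ge0 eta12.
Let A_tilted : tilted nu A m r p :=
  expfam_tilted mS h_ge0 mh mT p_expfam eta12 box_nat.
Let A_degenerate : forall j, r j = 0 -> forall x, A j x = 0 :=
  @active_stat_degenerate _ _ _ S T eta1 eta2.

Let P_S eta : cbox m r eta -> p eta (~` S) = 0%E.
Proof. by rewrite cbox_centre => /(expfam_conull mS p_expfam box_nat). Qed.

Lemma measurable_centered_box : measurable (centered_box eta1 eta2).
Proof.
rewrite (_ : centered_box eta1 eta2 = [set y : euclid R k | forall l,
    (`[- r l, r l]%classic : set (measurableTypeR R)) (tnth y l)]).
  apply: (measurable_product_set (S := fun l =>
    (`[- r l, r l]%classic : set (measurableTypeR R)))).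
  by move=> l; exact: measurable_itv.
by apply/seteqP; split => y /= H l; have := H l; rewrite /= in_itv.
Qed.

Lemma clip_centered_box y j : centered_box eta1 eta2 y -> clip r j y = tnth y j.
Proof. by move=> /(_ j) H; apply: clip_id; rewrite ler_norml. Qed.

Lemma mean_sq_error_clip eta : cbox m r eta ->
  mean_sq_error eta1 eta2 p M eta = (\sum_(j < k) \int[iid n (p eta)]_x
    kernel_mean M (fun y => (clip r j y - (tnth eta j - m j)) ^+ 2) x)%:E.
Proof.
move=> beta; pose g j y : R := (clip r j y - (tnth eta j - m j)) ^+ 2.
have mg j : measurable_fun setT (g j).
  apply: measurable_funX; apply: measurable_funB => //; exact: measurable_clip.
have g_le j y : `|g j y| <= (r j + r j) ^+ 2.
  rewrite /g normrX ler_pXn2r ?nnegrE ?addr_ge0//; apply: le_trans (ler_normB _ _) _.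
  by apply: lerD; [exact: clip_bounded|exact: beta].
have gs y : `|\sum_(j < k) g j y| <= \sum_(j < k) (r j + r j) ^+ 2.
  by apply: le_trans (ler_norm_sum _ _ _) _; exact: ler_sum.
have nE (y : euclid R k) : norm2 (vec y - (vec eta - midpoint eta1 eta2)) ^+ 2 =
    \sum_(j < k) (tnth y j - (tnth eta j - m j)) ^+ 2.
  rewrite /norm2 sqr_sqrtr; last by apply: sumr_ge0 => j _; exact: sqr_ge0.
  by apply: eq_bigr => j _; rewrite !mxE /m /centre !mxE.
rewrite /mean_sq_error.
under eq_integral do under eq_integral do rewrite nE.
rewrite (integral_kernel_conull (phi := id) (D := datasets S)
  (E := centered_box eta1 eta2) (g := fun y => \sum_(j < k) g j y) _ _ _ _ _ _ _ gs)//.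
- congr EFin; under eq_Rintegral do rewrite (kernel_mean_sum _ _ mg g_le).
  by rewrite Rintegral_sum// => j; exact: kernel_mean_integrable (mg j) (g_le j).
- exact: measurable_datasets.
- by apply: iid_datasets_conull => //; exact: P_S.
- exact: measurable_centered_box.
- apply: measurable_sum => j; apply: measurable_funX; apply: measurable_funB => //.
  exact: measurable_tnth.
- exact: measurable_sum.
- by move=> y cy; apply: eq_bigr => j _; rewrite /g clip_centered_box.
Qed.

Variable tau : R.
Hypothesis tau_gt0 : 0 < tau.
Variable eta : euclid R k.
Hypothesis ieta : ibox m r tau eta.

Let beta : cbox m r eta := ibox_cbox r_ge0 tau_gt0 ieta.

Let activeE j x : r j != 0 -> A j x = stat_in S T j x.
Proof. by rewrite /A /active_stat -/(r j) => /negbTE ->. Qed.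

Lemma mean_statE j : r j != 0 ->
  mean_stat S T (p eta) j ord0 = tmean nu A m (A j) eta.
Proof.
move=> rj; rewrite mxE -(stat_mean mA r_ge0 A_tilted A_degenerate tau_gt0 ieta).
rewrite Rintegral_mkcond; apply: eq_Rintegral => x _.
by rewrite patchE activeE.
Qed.

Lemma centered_statE j x : r j != 0 -> S x ->
  (vec (T x) - mean_stat S T (p eta)) j ord0 = cstat nu A m eta j x.
Proof.
move=> rj Sx; rewrite /cstat -mean_statE// activeE// /stat_in mem_set//.
by rewrite !mxE.
Qed.

Lemma cov_statE j l : r j != 0 -> r l != 0 ->
  cov_stat S T (p eta) j l =
  \int[p eta]_x (cstat nu A m eta j x * cstat nu A m eta l x).
Proof.
move=> rj rl; rewrite mxE Rintegral_mkcond /Rintegral; congr fine.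
have mc i : measurable_fun setT (cstat nu A m eta i) by exact: measurable_cstat.
have mcc : measurable_fun setT (fun x => cstat nu A m eta j x * cstat nu A m eta l x).
  exact: measurable_funM.
have PE x : S x -> ((vec (T x) - mean_stat S T (p eta)) *m
    (vec (T x) - mean_stat S T (p eta))^T) j l =
    cstat nu A m eta j x * cstat nu A m eta l x.
  by move=> Sx; rewrite mxE big_ord1 [X in _ * X]mxE !centered_statE.
apply: (eq_integral_conull mS (P_S beta)).
- apply/measurable_EFinP; have /(measurable_restrictT _ mS) : measurable_fun S
    (fun x => cstat nu A m eta j x * cstat nu A m eta l x) by exact: measurable_funTS.
  by apply: eq_measurable_fun => x _; rewrite /patch; case: ifPn => // /set_mem/PE ->.
- exact/measurable_EFinP.
- by move=> x Sx; rewrite patchE mem_set// PE.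
Qed.

Lemma sweight_degenerate j : r j = 0 -> sweight m r eta j = 0.
Proof.
move=> r0; have := beta j; rewrite r0 normr_le0 => /eqP c0.
by rewrite /sweight c0 r0 expr0n subrr.
Qed.

Lemma svecE j y : svec eta1 eta2 eta y j ord0 =
  sweight m r eta j * (tnth y j - (tnth eta j - m j)).
Proof.
rewrite mxE /sweight; congr ((_ - _) * _).
by rewrite /r /radius exprMn exprVn; congr (_ / _); ring.
Qed.

(** X_{~i} has the law of X, so the index i disappears. Only coordinates of positive radius matter,
    and there the entries of the covariance matrix are genuine second moments. *)
Lemma quad_form_meanE i :
  quad_form_mean eta1 eta2 S T p M i eta = (quad_score nu A m r p M eta)%:E.
Proof.
pose s j y := score m r eta j y.
pose cov j l : R := \int[p eta]_x (cstat nu A m eta j x * cstat nu A m eta l x).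
have ms j : measurable_fun setT (s j) by exact: measurable_score.
pose b := \sum_(j < k) 2 * r j ^+ 3.
have b_ge j : 2 * r j ^+ 3 <= b.
  rewrite /b (bigD1 j)//= lerDl sumr_ge0// => l _.
  by rewrite mulr_ge0// exprn_ge0.
have sb j y : `|s j y| <= b by exact: score_bounded.
pose g jl y : R := s jl.1 y * s jl.2 y * cov jl.1 jl.2.
have mg jl : measurable_fun setT (g jl).
  by apply: measurable_funM => //; exact: measurable_funM.
have g_le jl y : `|g jl y| <= b * b * `|cov jl.1 jl.2|.
  rewrite /g normrM ler_wpM2r// normrM; apply: ler_pM => //; exact: sb.
have qE y : ((svec eta1 eta2 eta y)^T *m cov_stat S T (p eta) *m
      svec eta1 eta2 eta y) ord0 ord0 =
    \sum_(jl : 'I_k * 'I_k) svec eta1 eta2 eta y jl.1 ord0 *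
      svec eta1 eta2 eta y jl.2 ord0 * cov jl.1 jl.2.
  rewrite mxE -(pair_bigA _ (fun j l => svec eta1 eta2 eta y j ord0 *
      svec eta1 eta2 eta y l ord0 * cov j l))/= exchange_big/=.
  apply: eq_bigr => l _; rewrite mxE big_distrl/=; apply: eq_bigr => j _.
  rewrite [X in X * _ * _]mxE !svecE.
  (* At a degenerate coordinate the entry of s is 0, whatever value the covariance entry takes when
     T_j is not integrable. *)
  have [r0|rj] := eqVneq (r j) 0; first by rewrite sweight_degenerate// !mul0r.
  have [r0|rl] := eqVneq (r l) 0; first by rewrite (sweight_degenerate r0) !mul0r !mulr0 mul0r.
  by rewrite cov_statE// -/(cov j l); ring.
rewrite /quad_form_mean.
under eq_integral do under eq_integral do rewrite qE.
have gs y : `|\sum_jl g jl y| <= \sum_jl (b * b * `|cov jl.1 jl.2|).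
  by apply: le_trans (ler_norm_sum _ _ _) _; exact: ler_sum.
rewrite (integral_kernel_conull (phi := fun z => replace z.1 i z.2)
  (D := datasets S `*` S) (E := centered_box eta1 eta2)
  (g := fun y => \sum_jl g jl y) _ _ _ _ _ _ _ gs)//.
- have mk : measurable_fun setT (kernel_mean M (fun y => \sum_jl g jl y)).
    by apply: measurable_kernel_mean; exact: measurable_sum.
  rewrite -(pullback_Rintegral (integral_resample_prod (fun=> p eta) i) mk).
  under eq_Rintegral do rewrite (kernel_mean_sum _ _ mg g_le).
  rewrite Rintegral_sum => [|jl]; last exact: kernel_mean_integrable (mg jl) (g_le jl).
  rewrite /quad_score pair_bigA/=; congr EFin; apply: eq_bigr => -[j l] _ /=.
  have mss : measurable_fun setT (fun y => s j y * s l y) by exact: measurable_funM.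
  have ss_le y : `|s j y * s l y| <= b * b.
    by rewrite normrM; apply: ler_pM => //; exact: sb.
  rewrite -RintegralZr//; last exact: kernel_mean_integrable mss ss_le.
  apply: eq_Rintegral => x _; rewrite /kernel_mean /g/= -/(cov j l) RintegralZr//.
  exact: prob_bounded_integrable mss ss_le.
- exact: measurable_replace.
- by apply: measurableX => //; exact: measurable_datasets.
- apply: joint_conull => //; [exact: measurable_datasets| |exact: P_S].
  by apply: iid_datasets_conull => //; exact: P_S.
- exact: measurable_centered_box.
- by move=> [x z] [/= Sx Sz]; apply: M_box; exact: datasets_replace.
- apply: measurable_sum => jl; apply: measurable_funM => //; under eq_fun do rewrite !svecE.
  by apply: measurable_funM; apply: measurable_funM => //; apply: measurable_funB => //;
    exact: measurable_tnth.
- exact: measurable_sum.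
- move=> y cy; apply: eq_bigr => jl _; rewrite /g /s /score !svecE.
  by rewrite !clip_centered_box.
Qed.

(** The dropped coordinates contribute 0 on the left, hence an inequality, which points in the
    direction required for the tail. *)
Lemma stat_norm_le x : S x ->
  Num.sqrt (\sum_(j < k) cstat nu A m eta j x ^+ 2) <=
  norm2 (vec (T x) - mean_stat S T (p eta)).
Proof.
move=> Sx; rewrite /norm2 ler_sqrt; last first.
  by apply: sumr_ge0 => j _; exact: sqr_ge0.
apply: ler_sum => j _; have [r0|rj] := eqVneq (r j) 0; last by rewrite centered_statE.
rewrite /cstat (_ : A j = cst 0); last by apply/funext => y; exact: A_degenerate.
rewrite /tmean; under eq_Rintegral do rewrite mul0r.
by rewrite Rintegral_cst// mul0r mul0r subrr expr0n sqr_ge0.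
Qed.

Lemma measurable_tail_set (i : 'I_n) (c : R) : measurable [set x : n.-tuple (euclid R d) |
  datasets S x /\ c < norm2 (vec (T (tnth x i)) - mean_stat S T (p eta))].
Proof.
pose N x : R := Num.sqrt (\sum_(j < k) (stat_in S T j x - mean_stat S T (p eta) j ord0) ^+ 2).
have mN : measurable_fun setT (fun x : n.-tuple (euclid R d) => N (tnth x i)).
  apply: (measurableT_comp _ (measurable_tnth i)).
  apply: (measurableT_comp (@measurable_sqrt R)); apply: measurable_sum => j.
  by apply: measurable_funX; apply: measurable_funB => //; exact: measurable_stat_in.
rewrite [X in measurable X](_ : _ = datasets S `&`
    (fun x : n.-tuple (euclid R d) => N (tnth x i)) @^-1` `]c, +oo[).
  apply: measurableI; first exact: measurable_datasets.
  by rewrite -[X in measurable X]setTI; apply: mN.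
have NE (x : n.-tuple (euclid R d)) : datasets S x ->
    norm2 (vec (T (tnth x i)) - mean_stat S T (p eta)) = N (tnth x i).
  move=> Sx; congr Num.sqrt; apply: eq_bigr => j _; congr (_ ^+ 2).
  rewrite !mxE; congr (_ - _); first by rewrite /stat_in mem_set//; exact: Sx.
apply/seteqP; split => x /= [Sx]; rewrite in_itv/= andbT NE//.
Qed.

(** With b = |R|_oo^3/4, the event t < b sqrt(k) |T - mu| is exactly the threshold 4t/(|R|_oo^3
    sqrt(k)) of the theorem. Restricting the event to datasets in S changes no probability. *)
Lemma excess_le_tail (i : 'I_n) (t0 : R) : 0 < t0 ->
  ((\int[p eta]_x excess nu A m t0 (normoo (range_vec eta1 eta2) ^+ 3 / 4) eta x)%:E <=
   \int[@lebesgue_measure R]_(t in `]t0, +oo[) tail_prob eta1 eta2 S T p i eta t)%E.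
Proof.
move=> t00; set b := _ / 4; pose sd := stat_dev nu A m b eta.
have msd : measurable_fun setT sd by exact: measurable_stat_dev.
apply: le_trans (integral_excess_le (p eta) msd (ltW t00)) _.
apply: ge0_le_integral_nomeas => [t _|t /=]; first exact: measure_ge0.
rewrite in_itv/= andbT => t0t.
have mset : measurable [set x | t < sd x].
  rewrite [X in measurable X](_ : _ = sd @^-1` `]t, +oo[).
    by rewrite -[X in measurable X]setTI; apply: msd.
  by apply/seteqP; split => y /=; rewrite in_itv/= andbT.
have mset_i : measurable [set x : n.-tuple (euclid R d) | t < sd (tnth x i)].
  rewrite [X in measurable X](_ : _ = (fun x => tnth x i) @^-1` [set x | t < sd x])//.
  by rewrite -[X in measurable X]setTI; exact: (measurable_tnth i).
have mtl := measurable_tail_set i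
  (4 * t / (normoo (range_vec eta1 eta2) ^+ 3 * Num.sqrt k%:R)).
have mD := measurable_datasets (n := n) mS.
have -> : p eta [set x | t < sd x] = iid n (p eta) [set x | t < sd (tnth x i)].
  transitivity (\int[p eta]_x (\1_[set x | t < sd x] x)%:E)%E.
    by rewrite integral_indic// setIT.
  rewrite (ge0_integral_tnth (fun=> p eta) i); last 2 first.
  - by apply/measurable_EFinP; exact: measurable_indic.
  - by move=> x; rewrite lee_fin.
  by rewrite (integral_indic (iid n (p eta)) measurableT mset_i) setIT.
apply: (@le_trans _ _ (iid n (p eta) ([set x | datasets S x /\
    norm2 (vec (T (tnth x i)) - mean_stat S T (p eta)) >
    4 * t / (normoo (range_vec eta1 eta2) ^+ 3 * Num.sqrt k%:R)] `|` ~` datasets S))).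
  apply: le_measure; rewrite ?inE//.
    by apply: measurableU => //; exact: measurableC.
  move=> x /= tsd; have [Sx|] := pselect (datasets S x); last by right.
  left; split => //; set q := _ * Num.sqrt _.
  have N_le := stat_norm_le (Sx i).
  apply: lt_le_trans N_le; move: tsd; rewrite /sd /stat_dev.
  set N := Num.sqrt (\sum_(j < k) _); have -> : b * Num.sqrt k%:R = q / 4.
    by rewrite /b /q; ring.
  move=> tq; have t_gt0 : 0 < t by exact: lt_trans t0t.
  have N0 : 0 <= N by exact: sqrtr_ge0.
  (* A bound [stat_dev] exceeding t > 0 excludes q = 0, so the threshold is a true quotient rather
     than a division by 0. *)
  have q0 : 0 < q.
    rewrite ltNge; apply/negP => q0; have : q * N <= 0 by exact: mulr_le0_ge0.
    by lra.
  by rewrite ltr_pdivrMr// mulrC; lra.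
apply: le_trans (measureU2 _ _ _) _ => //; first exact: measurableC.
rewrite [X in (_ + X)%E](iid_datasets_conull n mS (P_S beta)) adde0.
exact: lexx.
Qed.

End fingerprint_terms.

Theorem theorem3p5 (R : realType) (d k n : nat) (n_gt0 : (0 < n)%N)
    (K : family_kind) (S : set (euclid R d))
    (h : euclid R d -> R) (T : euclid R d -> euclid R k)
    (mS : measurable S)
    (h_ge0 : forall x, S x -> 0 <= h x)
    (mh : measurable_fun S h)
    (mT : measurable_fun S T)
    (p : euclid R k -> probability (euclid R d) R)
    (p_expfam : is_expfam K S h T p)
    (eta1 eta2 : euclid R k)
    (eta1_nat : natural_range K S h T eta1)
    (eta2_nat : natural_range K S h T eta2)
    (eta12 : forall j, tnth eta1 j <= tnth eta2 j)
    (box_nat : box eta1 eta2 `<=` natural_range K S h T)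
    (M : R.-pker (n.-tuple (euclid R d)) ~> (euclid R k))
    (M_box : forall x, datasets S x -> M x (centered_box eta1 eta2) = 1%E)
    (eps delta alpha : R)
    (eps_ge0 : 0 <= eps) (eps_le1 : eps <= 1) (delta_ge0 : 0 <= delta)
    (M_dp : dp eps delta S M)
    (M_acc : forall eta, box eta1 eta2 eta ->
      (mean_sq_error eta1 eta2 p M eta <= (alpha ^+ 2)%:E)%E)
    (alpha_le : alpha ^+ 2 <= norm2 (range_vec eta1 eta2) ^+ 2 / 24) :
  forall t0 : R, 0 < t0 -> exists i : 'I_n,
    ((norm2 (range_vec eta1 eta2) ^+ 2 / 24)%:E <=
      n%:R%:E *
      ((2 * delta * t0)%:E
       + (2 * eps)%:E *
         \int[uniform_box eta1 eta2]_(eta in box eta1 eta2)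
           sqrte (quad_form_mean eta1 eta2 S T p M i eta)
       + 2%:E *
         \int[uniform_box eta1 eta2]_(eta in box eta1 eta2)
           \int[@lebesgue_measure R]_(t in `]t0, +oo[)
             tail_prob eta1 eta2 S T p i eta t))%E.
Proof.
(* Every index works, since the comparisons of the quadratic form and of the tail hold for each
   sample point; the first one is taken. *)
move=> t0 t0_gt0; exists (Ordinal n_gt0); set i := Ordinal n_gt0.
pose m := centre eta1 eta2; pose r := radius eta1 eta2.
pose A := active_stat S T eta1 eta2; pose b := normoo (range_vec eta1 eta2) ^+ 3 / 4.
have r_ge0 j : 0 <= r j by exact: radius_ge0.
have normE : norm2 (range_vec eta1 eta2) ^+ 2 = \sum_(j < k) range_vec eta1 eta2 j ord0 ^+ 2.
  by rewrite /norm2 sqr_sqrtr// sumr_ge0// => j _; exact: sqr_ge0.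
have sum_r : \sum_(j < k) r j ^+ 2 / 3 = norm2 (range_vec eta1 eta2) ^+ 2 / 12.
  rewrite normE mulr_suml; apply: eq_bigr => j _; by rewrite /r /radius; field.
(* As r_j = R_j/2, the score bound 2 r_j^3 equals R_j^3/4. *)
have b_ge j : 2 * r j ^+ 3 <= b.
  have -> : 2 * r j ^+ 3 = range_vec eta1 eta2 j ord0 ^+ 3 / 4 by rewrite /r /radius; field.
  have R0 : 0 <= range_vec eta1 eta2 j ord0.
    by have := r_ge0 j; rewrite /r /radius; lra.
  have RN : range_vec eta1 eta2 j ord0 <= normoo (range_vec eta1 eta2).
    rewrite -(ger0_norm R0).
    exact: (le_bigmax 0 (fun l => `|range_vec eta1 eta2 l ord0|) j).
  by rewrite ler_wpM2r// ler_pXn2r ?nnegrE// (le_trans R0).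
have cE : cbox m r = box eta1 eta2 := cbox_centre eta1 eta2.
have P_S eta : cbox m r eta -> p eta (~` S) = 0%E.
  by rewrite cE => /(expfam_conull mS p_expfam box_nat).
have acc eta : cbox m r eta -> \sum_(j < k) \int[iid n (p eta)]_x
    kernel_mean M (fun y => (clip r j y - (tnth eta j - m j)) ^+ 2) x <= alpha ^+ 2.
  move=> ceta; have beta : box eta1 eta2 eta by rewrite -cE.
  rewrite -lee_fin -(mean_sq_error_clip mS p_expfam eta12 box_nat M_box ceta).
  exact: M_acc.
apply/lee_addgt0Pr => e e0.
pose C := (2 + k%:R) * \sum_(j < k) r j ^+ 2.
have C0 : 0 <= C.
  by rewrite /C mulr_ge0 ?addr_ge0// sumr_ge0// => j _; exact: sqr_ge0.
(* Chosen so that 0 < tau < 1 and the total error tau C is at most [e]. *)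
pose tau := e / (e + C + 1).
have tau_gt0 : 0 < tau by rewrite divr_gt0//; lra.
have tau_lt1 : tau < 1 by rewrite ltr_pdivrMr; lra.
have tauC : tau * C <= e.
  rewrite /tau mulrAC ler_pdivrMr; last by lra.
  by rewrite ler_pM2l//; lra.
have A_tilted := expfam_tilted mS h_ge0 mh mT p_expfam eta12 box_nat.
have := private_tilted_lower (measurable_active_stat mS mT eta1 eta2) r_ge0 A_tilted
  (@active_stat_degenerate _ _ _ S T eta1 eta2) mS P_S eps_ge0 eps_le1 delta_ge0 M_dp
  t0_gt0 b_ge tau_gt0 tau_lt1 (sqr_ge0 alpha) acc
  (D := box eta1 eta2) (q := fun eta => sqrte (quad_form_mean eta1 eta2 S T p M i eta))
  (e := fun eta => (\int[@lebesgue_measure R]_(t in `]t0, +oo[)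
             tail_prob eta1 eta2 S T p i eta t)%E).
rewrite sides_uniform_box sum_r -/C => H.
(* |R|^2/12 - alpha^2 is at least |R|^2/24 by the bound on alpha, and [e] absorbs tau C. *)
apply: (@le_trans _ _ ((norm2 (range_vec eta1 eta2) ^+ 2 / 12 - alpha ^+ 2 - tau * C)%:E + e%:E)%E).
  by rewrite -EFinD lee_fin; lra.
apply: leeD2r; apply: H.
- by move=> eta /(ibox_cbox r_ge0 tau_gt0); rewrite cE.
- by move=> eta; exact: sqrte_ge0.
- by move=> eta; apply: integral_ge0 => t _; exact: measure_ge0.
- move=> eta ieta.
  by rewrite (quad_form_meanE mS h_ge0 mh mT p_expfam eta12 box_nat M_box tau_gt0 ieta).
- move=> eta ieta.
  exact: (excess_le_tail mS h_ge0 mh mT p_expfam eta12 box_nat tau_gt0 ieta i t0_gt0).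
Qed.
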